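(* Let $\nu\ge 2$ and $p\ge 3$ be integers, let $\omega\in\mathbb{R}^{\nu}$ be non-resonant, and let $c,d:\mathbb{Z}^{\nu}\to\mathbb{C}$. Assume that there exist $A>0$ and $r>\nu+2$ such that $$|c(n)|\le A(1+|n|)^{-r},\qquad |d(n)|\le A(1+|n|)^{-r},\qquad n\in\mathbb{Z}^{\nu}.$$ Let $K_{r,\nu}:=2^{r+1}\sum_{m\in\mathbb{Z}^\nu}(1+|m|)^{-r}$ and set $$M_{p,r}:=\max\{1,AK_{r,\nu}\},\qquad L_{p,r}:=\frac{1}{p\,2^{p+3}M_{p,r}^{p-1}}.$$ Then, on $[0,L_{p,r}]$, the quasi-periodic Cauchy problem $$u_{tt}-u_{xx}-u_{xxtt}-(u^p)_{xx}=0,\qquad u(0,x)=\sum_{n\in\mathbb{Z}^{\nu}}c(n)e^{i\langle n,\omega\rangle x},\qquad u_t(0,x)=\sum_{n\in\mathbb{Z}^{\nu}}d(n)e^{i\langle n,\omega\rangle x},\qquad x\in\mathbb{R},$$ admits a classical spatially quasi-periodic solution $$u(t,x)=\sum_{n\in\mathbb{Z}^{\nu}}\widehat u(t,n)e^{i\langle n,\omega\rangle x}$$ satisfying $$|\widehat u(t,n)|\le 2A(1+|n|)^{-r},\qquad 0\le t\le L_{p,r},\ n\in\mathbb{Z}^{\nu}.$$ Moreover, this solution is unique among all spatially quasi-periodic solutions of the Cauchy problem on $[0,L_{p,r}]$ (with the same frequency vector $\omega$) satisfying this polynomial decay estimate.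
   Context: For $n=(n_1,\dots,n_\nu)\in\mathbb{Z}^\nu$, $|n|:=\sum_{j=1}^\nu|n_j|$ and $\langle n,\omega\rangle:=\sum_{j=1}^\nu n_j\omega_j$. The vector $\omega\in\mathbb{R}^\nu$ is non-resonant (rationally independent) if $\langle n,\omega\rangle=0$ with $n\in\mathbb{Z}^\nu$ implies $n=0$. A classical spatially quasi-periodic solution on $[0,L]$ with frequency vector $\omega$ is a function $u:[0,L]\times\mathbb{R}\to\mathbb{C}$ of the form $u(t,x)=\sum_{n\in\mathbb{Z}^\nu}\widehat u(t,n)e^{i\langle n,\omega\rangle x}$ for which the derivatives $u_t,u_{tt},u_{xx},u_{xxtt},(u^p)_{xx}$ exist as continuous functions on $[0,L]\times\mathbb{R}$ (one-sided in $t$ at the endpoints), the equation holds pointwise on $[0,L]\times\mathbb{R}$, and the two initial conditions hold pointwise. *)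

(* Defs.v *)
From Stdlib Require Import Reals ZArith List.
From mathcomp Require Import all_boot.
From Coquelicot Require Import Coquelicot.

Set Implicit Arguments.
Unset Strict Implicit.
Unset Printing Implicit Defensive.

Local Open Scope R_scope.

(* Unconditional summation: the filter of the finite subsets of I, directed by
   inclusion; a finite subset is represented by a duplicate-free list. *)
Definition finite_subsets (I : Type) (P : list I -> Prop) : Prop :=
  exists l0 : list I, forall l : list I, NoDup l -> incl l0 l -> P l.

Definition is_sum (I : Type) (V : NormedModule R_AbsRing) (a : I -> V) (s : V)
    : Prop :=
  filterlim (fun l : list I => fold_right plus zero (List.map a l))
    (@finite_subsets I) (locally s).

(* As with RInt, the value is meaningful only when the family is summable. *)
Definition Sum (I : Type) (V : CompleteNormedModule R_AbsRing) (a : I -> V)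
    : V :=
  iota (is_sum a).

Definition lattice (nu : nat) : Type := {ffun 'I_nu -> Z}.

Definition l1norm (nu : nat) (n : lattice nu) : R :=
  \big[Rplus/0]_(j < nu) Rabs (IZR (n j)).

Definition pairing (nu : nat) (n : lattice nu) (omega : 'I_nu -> R) : R :=
  \big[Rplus/0]_(j < nu) (IZR (n j) * omega j).

Definition nonresonant (nu : nat) (omega : 'I_nu -> R) : Prop :=
  forall n : lattice nu, pairing n omega = 0 -> n = [ffun=> 0%Z].

Definition expi (y : R) : C := (cos y, sin y).

Definition is_qp_series (nu : nat) (omega : 'I_nu -> R) (a : lattice nu -> C)
    (x : R) (s : C) : Prop :=
  is_sum (V := C_R_NormedModule)
    (fun n : lattice nu => Cmult (a n) (expi (pairing n omega * x))) s.

Definition weight (nu : nat) (r : R) (n : lattice nu) : R :=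
  Rpower (1 + l1norm n) (- r).

Definition Kconst (r : R) (nu : nat) : R :=
  Rpower 2 (r + 1) *
  Sum (V := R_CompleteNormedModule) (fun m : lattice nu => weight r m).

Definition Mconst (nu : nat) (A r : R) : R := Rmax 1 (A * Kconst r nu).

Definition Lconst (nu p : nat) (A r : R) : R :=
  1 / (INR p * 2 ^ (p + 3)%N * Mconst nu A r ^ (p - 1)%N).

(* Functions on [0, L] x R are total functions of which only the restriction
   to [0, L] x R is used; [g] is the t-derivative of [f], taken along [0, L]
   and hence one-sided at the endpoints. *)
Definition is_partial_t (L : R) (f g : R -> R -> C) : Prop :=
  forall t x : R, 0 <= t <= L ->
    filterdiff (U := R_NormedModule) (V := C_R_NormedModule)
      (fun s : R => f s x)
      (within (fun s : R => 0 <= s <= L) (locally t))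
      (fun s : R => scal s (g t x : C_R_NormedModule)).

Definition is_partial_x (L : R) (f g : R -> R -> C) : Prop :=
  forall t x : R, 0 <= t <= L ->
    is_derive (V := C_R_NormedModule) (fun y : R => f t y) x (g t x).

Definition continuous_strip (L : R) (f : R -> R -> C) : Prop :=
  continuous_on (T := prod_UniformSpace R_UniformSpace R_UniformSpace)
    (U := C_R_NormedModule)
    (fun z : R * R => 0 <= fst z <= L) (fun z : R * R => f (fst z) (snd z)).

(* Here w = u^p.  In u_xxtt the x-derivatives are taken first; the intermediate
   derivatives ux, uxxt and wx are only required to exist. *)
Definition classical_solution (nu p : nat) (omega : 'I_nu -> R)
    (c d : lattice nu -> C) (L : R) (u : R -> R -> C) : Prop :=
  exists ut utt ux uxx uxxt uxxtt wx wxx : R -> R -> C,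
    (is_partial_t L u ut /\ is_partial_t L ut utt) /\
    (is_partial_x L u ux /\ is_partial_x L ux uxx) /\
    (is_partial_t L uxx uxxt /\ is_partial_t L uxxt uxxtt) /\
    (is_partial_x L (fun t x => Cpow (u t x) p) wx /\ is_partial_x L wx wxx) /\
    (continuous_strip L ut /\ continuous_strip L utt /\
     continuous_strip L uxx /\ continuous_strip L uxxtt /\
     continuous_strip L wxx) /\
    (forall t x : R, 0 <= t <= L ->
       (utt t x - uxx t x - uxxtt t x - wxx t x)%C = RtoC 0) /\
    (forall x : R, is_qp_series omega c x (u 0 x)) /\
    (forall x : R, is_qp_series omega d x (ut 0 x)).

Definition qp_classical_solution (nu p : nat) (omega : 'I_nu -> R)
    (c d : lattice nu -> C) (L : R) (u : R -> R -> C)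
    (uhat : R -> lattice nu -> C) : Prop :=
  (forall t x : R, 0 <= t <= L -> is_qp_series omega (uhat t) x (u t x)) /\
  classical_solution p omega c d L u.

Definition poly_decay (nu : nat) (A r L : R) (uhat : R -> lattice nu -> C)
    : Prop :=
  forall (t : R) (n : lattice nu), 0 <= t <= L ->
    Cmod (uhat t n) <= 2 * A * weight r n.

(* Main.v *)
Require Import Defs.
From Stdlib Require Import Reals ZArith List.
From HB Require Import structures.
From mathcomp Require Import all_boot.
From Coquelicot Require Import Coquelicot.
From Stdlib Require Import Lra Lia Permutation Classical FunctionalExtensionality.
Local Open Scope R_scope.

(** On the Fourier mode of frequency mu the equation reads
    (1 + mu^2) a'' = - mu^2 (a + (u^p)^), that is, a'' = - theta (a + (u^p)^)
    with theta = mu^2 / (1 + mu^2) in [0, 1): no derivative is lost, and the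
    problem is an ordinary differential equation in the space of coefficients
    bounded by a multiple of the weight (1 + |n|)^{-r}.

    Existence.  The weight satisfies w * w <= K w ([lsum_weight_conv]), because
    one of m, n - m is at least half as large as n.  Hence p-fold convolution is
    bounded and Lipschitz on the ball |a(n)| <= 2 A w(n) ([conv_pow_decays],
    [conv_pow_lipschitz]), and L is so small that the twice integrated equation
    is a contraction of that ball ([picard_admissible], [picard_contracts]).
    The series of the fixed point may be multiplied and differentiated
    termwise, twice in x since r - 2 > nu ([is_qp_series_mult],
    [Sum_filterdiff]).  All of this rests on one tool: dominated convergence
    for unconditional sums along an arbitrary filter
    ([Sum_dominated_convergence]), from which Fubini for double sums,
    continuity and termwise differentiation follow.

    Uniqueness is proved in the sup norm, without Fourier coefficients: decay
    bounds both solutions on the strip.  Let w be the real or the imaginary part of their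
    difference and P = w + (the same part of) v^p - u^p.  Integrating the
    equation twice in time gives w = w_xx + g_xx, where g is the double time
    integral of P; thus h = w + g is a bounded solution of h - h_xx = g on the
    line, and the maximum principle gives |w| <= 2 sup |g|
    ([linear_estimate]).  As P is Lipschitz in the difference and g carries a
    factor L^2, any bound on |v - u| can be halved
    ([classical_solution_unique]).  The definition of a classical solution
    provides little regularity of the intermediate derivatives.  Therefore h_xx
    is handled through second difference quotients, and the vanishing of
    w_xxt at t = 0, which the initial conditions do not state, is derived from
    w = O(t^2) ([wxxt_initial]). *)

(** * Unconditional sums *)

Lemma norm_minus_triangle {V : NormedModule R_AbsRing} (y x z : V) :
  norm (minus x z) <= norm (minus x y) + norm (minus y z).
Proof. rewrite (minus_trans y); apply norm_triangle. Qed.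

Lemma norm_minus_sym {V : NormedModule R_AbsRing} (x y : V) :
  norm (minus x y) = norm (minus y x).
Proof. rewrite -(norm_opp (minus x y)) opp_minus //. Qed.

Lemma norm_minus_lt3 {V : NormedModule R_AbsRing} (x y z w : V) (e : R) :
  norm (minus x y) <= e / 3 -> norm (minus y z) < e / 3 ->
  norm (minus w z) <= e / 3 -> norm (minus x w) < e.
Proof.
intros H1 H2 H3.
pose proof (norm_minus_triangle y x w).
pose proof (norm_minus_triangle z y w).
rewrite (norm_minus_sym z w) in H0; lra.
Qed.

Lemma minus_zero {V : NormedModule R_AbsRing} (x : V) : minus x zero = x.
Proof. unfold minus; rewrite opp_zero plus_zero_r //. Qed.

Definition lsum {I : Type} {V : NormedModule R_AbsRing} (a : I -> V)
    (l : list I) : V := fold_right plus zero (List.map a l).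

(** These families play the role of integrable dominating functions in every
    exchange of limits below. *)
Definition summable {I : Type} (g : I -> R) : Prop :=
  (forall i, 0 <= g i) /\
  exists M, forall l : list I, NoDup l -> lsum (V := R_NormedModule) g l <= M.

Lemma exists_NoDup {I : Type} (l0 : list I) :
  exists l, NoDup l /\ incl l0 l /\ incl l l0.
Proof.
induction l0 as [|x l0 [l [Hl [H1 H2]]]].
- exists nil; split; [constructor|split; intros x []].
- destruct (classic (In x l)) as [Hx|Hx].
  + exists l; split; [exact Hl|split].
    * intros y [<-|Hy]; [exact Hx|apply H1, Hy].
    * intros y Hy; right; apply H2, Hy.
  + exists (cons x l); split; [constructor; assumption|split].
    * intros y [<-|Hy]; [left; reflexivity|right; apply H1, Hy].
    * intros y [<-|Hy]; [left; reflexivity|right; apply H2, Hy].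
Qed.

Global Instance finite_subsets_filter (I : Type) :
  ProperFilter (@finite_subsets I).
Proof.
constructor.
- intros P [l0 H]; destruct (exists_NoDup l0) as [l [Hl [Hi _]]].
  exists l; apply H; assumption.
- constructor.
  + exists nil; intros; exact Logic.I.
  + intros P Q [l1 H1] [l2 H2]; exists (app l1 l2); intros l Hl Hi; split.
    * apply H1; [exact Hl|]; intros x Hx; apply Hi, in_or_app; left; exact Hx.
    * apply H2; [exact Hl|]; intros x Hx; apply Hi, in_or_app; right; exact Hx.
  + intros P Q HPQ [l0 H]; exists l0; intros l Hl Hi; apply HPQ, H; assumption.
Qed.

(** Enumerations of larger finite sets are, up to order, extensions of those of
    smaller ones; this turns sums over inclusions into sums plus remainders. *)
Lemma NoDup_complement {I : Type} (l0 l : list I) :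
  NoDup l0 -> incl l0 l -> exists r, Permutation l (app l0 r).
Proof.
revert l; induction l0 as [|x l0 IH]; intros l H0 Hi.
- exists l; apply Permutation_refl.
- destruct (in_split x l (Hi x (or_introl Logic.eq_refl))) as [l1 [l2 ->]].
  inversion H0 as [|? ? Hx H0']; subst.
  destruct (IH (app l1 l2) H0') as [r Hr].
  { intros y Hy; assert (Hy' := Hi y (or_intror Hy)).
    apply in_app_or in Hy'; apply in_or_app; destruct Hy' as [?|[Hyx|?]]; auto.
    subst; contradiction. }
  exists r; apply Permutation_sym, Permutation_cons_app, Permutation_sym, Hr.
Qed.

Lemma lsum_cons {I : Type} {V : NormedModule R_AbsRing} (a : I -> V) i l :
  lsum a (cons i l) = plus (a i) (lsum a l).
Proof. reflexivity. Qed.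

Section FiniteSums.
Context {I : Type} {V : NormedModule R_AbsRing}.
Implicit Types (a b : I -> V) (l : list I).

Lemma lsum_app a l1 l2 : lsum a (app l1 l2) = plus (lsum a l1) (lsum a l2).
Proof.
induction l1 as [|x l1 IH]; simpl.
- change (lsum a l2 = plus zero (lsum a l2)); rewrite plus_zero_l; reflexivity.
- rewrite !lsum_cons IH plus_assoc; reflexivity.
Qed.

Lemma lsum_perm a l1 l2 : Permutation l1 l2 -> lsum a l1 = lsum a l2.
Proof.
induction 1 as [|x l1 l2 _ IH|x y l|l1 l2 l3 _ IH1 _ IH2].
- reflexivity.
- rewrite !lsum_cons IH; reflexivity.
- rewrite !lsum_cons !plus_assoc (plus_comm (a x)); reflexivity.
- rewrite IH1; exact IH2.
Qed.

Lemma lsum_plus a b l :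
  lsum (fun i => plus (a i) (b i)) l = plus (lsum a l) (lsum b l).
Proof.
induction l as [|x l IH].
- symmetry; apply plus_zero_l.
- rewrite !lsum_cons IH -!plus_assoc; f_equal.
  rewrite !plus_assoc (plus_comm (b x)); reflexivity.
Qed.

Lemma lsum_ext a b l : (forall i, In i l -> a i = b i) -> lsum a l = lsum b l.
Proof.
induction l as [|x l IH]; intros H; [reflexivity|].
rewrite !lsum_cons H; [|left; reflexivity].
rewrite IH; [reflexivity|]; intros i Hi; apply H; right; exact Hi.
Qed.

Lemma lsum_scal (k : R) a l :
  lsum (fun i => scal k (a i)) l = scal k (lsum a l).
Proof.
induction l as [|x l IH].
- symmetry; exact (scal_zero_r (V := V) k).
- rewrite !lsum_cons IH scal_distr_l; reflexivity.
Qed.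

Lemma lsum_le (f g : I -> R) l : (forall i, In i l -> f i <= g i) ->
  lsum (V := R_NormedModule) f l <= lsum (V := R_NormedModule) g l.
Proof.
induction l as [|x l IH]; intros H; [apply Rle_refl|].
rewrite !lsum_cons; apply Rplus_le_compat.
- apply H; left; reflexivity.
- apply IH; intros i Hi; apply H; right; exact Hi.
Qed.

Lemma lsum_ge0 (g : I -> R) l : (forall i, 0 <= g i) ->
  0 <= lsum (V := R_NormedModule) g l.
Proof.
intros H; induction l as [|x l IH]; [apply Rle_refl|].
rewrite lsum_cons; apply Rplus_le_le_0_compat; auto.
Qed.

Lemma norm_lsum_le a (g : I -> R) l :
  (forall i, In i l -> norm (a i) <= g i) ->
  norm (lsum a l) <= lsum (V := R_NormedModule) g l.
Proof.
induction l as [|x l IH]; intros H.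
- change (norm (zero : V) <= 0); rewrite norm_zero; apply Rle_refl.
- rewrite !lsum_cons; eapply Rle_trans; [apply norm_triangle|].
  apply Rplus_le_compat.
  + apply H; left; reflexivity.
  + apply IH; intros i Hi; apply H; right; exact Hi.
Qed.

Lemma lsum_map {J : Type} (s : J -> I) a (l : list J) :
  lsum a (List.map s l) = lsum (fun j => a (s j)) l.
Proof. unfold lsum; rewrite List.map_map; reflexivity. Qed.

End FiniteSums.

Lemma lsum_incl {I : Type} (g : I -> R) l l' : (forall i, 0 <= g i) ->
  NoDup l -> incl l l' ->
  lsum (V := R_NormedModule) g l <= lsum (V := R_NormedModule) g l'.
Proof.
intros Hg Hl Hi.
destruct (NoDup_complement _ _ Hl Hi) as [r Hr].
rewrite (lsum_perm _ _ _ Hr) lsum_app.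
pose proof (lsum_ge0 g r Hg) as H; change plus with Rplus; simpl in *; lra.
Qed.

Lemma summable_le {I : Type} (f g : I -> R) :
  (forall i, 0 <= f i <= g i) -> summable g -> summable f.
Proof.
intros H [_ [M HM]]; split; [intros i; apply H|].
exists M; intros l Hl; eapply Rle_trans; [|apply HM, Hl].
apply lsum_le; intros i _; apply H.
Qed.

Lemma summable_scal {I : Type} (k : R) (g : I -> R) :
  0 <= k -> summable g -> summable (fun i => k * g i).
Proof.
intros Hk [Hg [M HM]]; split.
- intros i; apply Rmult_le_pos; auto.
- exists (k * M); intros l Hl.
  rewrite (lsum_scal (V := R_NormedModule) k g).
  apply Rmult_le_compat_l; auto.
Qed.

(** The supremum of the finite sums is nearly attained on some [l0], so that
    nothing outside [l0] can contribute more than [eps]. *)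
Lemma summable_tail {I : Type} (g : I -> R) (eps : R) :
  summable g -> 0 < eps ->
  exists l0, NoDup l0 /\
    forall r, NoDup (app l0 r) -> lsum (V := R_NormedModule) g r <= eps.
Proof.
intros [Hg [M HM]] Heps.
destruct (completeness
  (fun s => exists l, NoDup l /\ s = lsum (V := R_NormedModule) g l))
  as [S [HS1 HS2]].
- exists M; intros s [l [Hl ->]]; apply HM, Hl.
- exists 0, nil; split; [constructor|reflexivity].
- destruct (classic (exists l0, NoDup l0 /\
    S - eps < lsum (V := R_NormedModule) g l0)) as [[l0 [H0 H1]]|Hn].
  + exists l0; split; [exact H0|]; intros r Hr.
    assert (H2 : lsum (V := R_NormedModule) g (app l0 r) <= S)
      by (apply HS1; exists (app l0 r); split; auto).
    rewrite lsum_app in H2; change plus with Rplus in H2; simpl in *; lra.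
  + exfalso; assert (S <= S - eps); [|lra].
    apply HS2; intros s [l [Hl ->]]; apply Rnot_lt_le; intros H.
    apply Hn; exists l; split; assumption.
Qed.

Section SumAlgebra.
Context {I : Type} {V : NormedModule R_AbsRing}.
Implicit Types (a b : I -> V).

Lemma is_sum_plus a b s t :
  is_sum a s -> is_sum b t -> is_sum (fun i => plus (a i) (b i)) (plus s t).
Proof.
intros Ha Hb; unfold is_sum.
eapply filterlim_ext.
- intros l; symmetry; exact (lsum_plus a b l).
- exact (filterlim_comp_2 _ _ _ Ha Hb (filterlim_plus s t)).
Qed.

Lemma is_sum_zero : is_sum (fun _ : I => zero : V) zero.
Proof.
unfold is_sum; apply (filterlim_ext (fun _ => zero)).
- intros l; induction l as [|x l IH]; [reflexivity|].
  simpl; rewrite -IH plus_zero_l; reflexivity.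
- apply filterlim_const.
Qed.

Lemma is_sum_ext a b s :
  (forall i, a i = b i) -> is_sum a s -> is_sum b s.
Proof.
intros H; unfold is_sum; apply filterlim_ext; intros l.
apply lsum_ext; intros i _; apply H.
Qed.

Lemma is_sum_lsum {J : Type} (x : I -> J -> V) (s : J -> V) (l : list J) :
  (forall j, is_sum (fun i => x i j) (s j)) ->
  is_sum (fun i => lsum (x i) l) (lsum s l).
Proof.
intros H; induction l as [|j l IH].
- exact is_sum_zero.
- exact (is_sum_plus _ _ _ _ (H j) IH).
Qed.

End SumAlgebra.

Section Dominated.
Context {I : Type} {V : CompleteNormedModule R_AbsRing}.
Implicit Types (a b : I -> V) (g : I -> R).

Lemma is_sum_Sum a s : is_sum a s -> Sum a = s.
Proof. intros H; apply (iota_filterlim_locally _ _ H). Qed.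

Lemma is_sum_unique a s1 s2 : is_sum a s1 -> is_sum a s2 -> s1 = s2.
Proof.
intros H1 H2; rewrite -(is_sum_Sum _ _ H1); exact (is_sum_Sum _ _ H2).
Qed.

Lemma lsum_tail_le a g l0 eps :
  (forall i, norm (a i) <= g i) -> NoDup l0 ->
  (forall r, NoDup (app l0 r) -> lsum (V := R_NormedModule) g r <= eps) ->
  forall l, NoDup l -> incl l0 l -> norm (minus (lsum a l) (lsum a l0)) <= eps.
Proof.
intros Ha H0 Ht l Hl Hi.
destruct (NoDup_complement _ _ H0 Hi) as [r Hr].
pose proof (Permutation_NoDup Hr Hl) as Hnd.
rewrite (lsum_perm _ _ _ Hr) lsum_app.
replace (minus (plus (lsum a l0) (lsum a r)) (lsum a l0)) with (lsum a r).
- eapply Rle_trans; [apply norm_lsum_le; intros i _; apply Ha|].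
  apply Ht, Hnd.
- unfold minus; rewrite (plus_comm (lsum a l0)) -plus_assoc plus_opp_r.
  symmetry; apply plus_zero_r.
Qed.

Lemma filterlim_normP {T : Type} {F : (T -> Prop) -> Prop} {FF : Filter F}
    (f : T -> V) (y : V) :
  filterlim f F (locally y) <->
  (forall eps : posreal, F (fun x => norm (minus (f x) y) < eps)).
Proof. exact (filterlim_locally_ball_norm f y). Qed.

Lemma is_sum_dominated a g :
  (forall i, norm (a i) <= g i) -> summable g -> is_sum a (Sum a).
Proof.
intros Ha Hg.
assert (Hex : exists s, is_sum a s).
{ apply (proj1 (filterlim_locally_cauchy (U := V) (fun l => lsum a l))).
  intros eps.
  destruct (summable_tail g (eps / 3) Hg) as [l0 [H0 Ht]].
  { destruct eps; simpl; lra. }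
  exists (fun l => NoDup l /\ incl l0 l); split.
  - exists l0; intros l Hl Hi; split; assumption.
  - intros l1 l2 [Hl1 Hi1] [Hl2 Hi2].
    apply: norm_compat1.
    pose proof (lsum_tail_le _ _ _ _ Ha H0 Ht _ Hl1 Hi1) as H1.
    pose proof (lsum_tail_le _ _ _ _ Ha H0 Ht _ Hl2 Hi2) as H2.
    eapply Rle_lt_trans;
      [apply (norm_minus_triangle (V := V) (lsum a l0))|].
    rewrite (norm_minus_sym (V := V) (lsum a l0) (lsum a l1)).
    destruct eps; simpl in *; lra. }
destruct Hex as [s Hs]; rewrite (is_sum_Sum _ _ Hs); exact Hs.
Qed.

Lemma filterlim_norm_le {T : Type} {F : (T -> Prop) -> Prop}
    {FF : ProperFilter F} (f : T -> V) (y z : V) (M : R) :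
  filterlim f F (locally y) -> F (fun t => norm (minus (f t) z) <= M) ->
  norm (minus y z) <= M.
Proof.
intros Hf HM; apply Rnot_lt_le; intros H.
assert (He : 0 < norm (minus y z) - M) by lra.
pose proof (proj1 (filterlim_normP f y) Hf (mkposreal _ He)) as H1.
destruct (filter_ex _ (filter_and _ _ H1 HM)) as [t [H2 H3]]; simpl in H2.
assert (H4 : norm (minus y z) <= norm (minus (f t) y) + norm (minus (f t) z)).
{ rewrite (norm_minus_sym (V := V) (f t) y).
  exact (norm_minus_triangle (V := V) (f t) y z). }
lra.
Qed.

Lemma Sum_tail_le a g l0 eps :
  (forall i, norm (a i) <= g i) -> summable g -> NoDup l0 ->
  (forall r, NoDup (app l0 r) -> lsum (V := R_NormedModule) g r <= eps) ->
  norm (minus (Sum a) (lsum a l0)) <= eps.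
Proof.
intros Ha Hg H0 Ht.
apply (filterlim_norm_le _ _ _ _ (is_sum_dominated _ _ Ha Hg)).
exists l0; intros l Hl Hi; exact (lsum_tail_le _ _ _ _ Ha H0 Ht l Hl Hi).
Qed.

Lemma norm_is_sum_le a g s M :
  (forall i, norm (a i) <= g i) ->
  (forall l, NoDup l -> lsum (V := R_NormedModule) g l <= M) ->
  is_sum a s -> norm s <= M.
Proof.
intros Ha HM Hs.
rewrite -(minus_zero (V := V) s).
apply (filterlim_norm_le _ _ _ _ Hs).
exists nil; intros l Hl _; rewrite (minus_zero (V := V)).
eapply Rle_trans; [|apply (HM l Hl)].
apply norm_lsum_le; intros i _; apply Ha.
Qed.

Lemma Sum_ext a b : (forall i, a i = b i) -> Sum a = Sum b.
Proof. intros H; congr Sum; apply functional_extensionality, H. Qed.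

(** Dominated convergence for sums: up to [eps] both sums live on a common
    finite set, where convergence is termwise. *)
Lemma Sum_dominated_convergence {T : Type} {F : (T -> Prop) -> Prop}
    {FF : ProperFilter F} (f : T -> I -> V) (f0 : I -> V) g :
  summable g ->
  F (fun t => forall i, norm (f t i) <= g i) ->
  (forall i, filterlim (fun t => f t i) F (locally (f0 i))) ->
  filterlim (fun t => Sum (f t)) F (locally (Sum f0)).
Proof.
intros Hg Hd Hf.
assert (H0 : forall i, norm (f0 i) <= g i).
{ intros i.
  rewrite -(minus_zero (V := V) (f0 i)).
  apply (filterlim_norm_le _ _ _ _ (Hf i)).
  apply: filter_imp Hd => t Ht.
  rewrite (minus_zero (V := V)); apply Ht. }
apply filterlim_normP; intros [eps Heps]; simpl.
destruct (summable_tail g (eps / 3) Hg) as [l0 [Hl0 Ht]]; [lra|].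
assert (Hl : filterlim (fun t => lsum (f t) l0) F (locally (lsum f0 l0))).
{ clear Hl0 Ht; induction l0 as [|i l IH]; [apply filterlim_const|].
  exact (filterlim_comp_2 _ _ _ (Hf i) IH (filterlim_plus _ _)). }
assert (He : 0 < eps / 3) by lra.
pose proof (proj1 (filterlim_normP _ _) Hl (mkposreal _ He)) as H1.
apply: filter_imp (filter_and _ _ Hd H1) => t [H2 H3]; simpl in H3.
pose proof (Sum_tail_le _ _ _ _ H2 Hg Hl0 Ht) as H4.
pose proof (Sum_tail_le _ _ _ _ H0 Hg Hl0 Ht) as H5.
exact (norm_minus_lt3 (V := V) _ _ _ _ _ H4 H3 H5).
Qed.

End Dominated.

Lemma norm_Sum_le {I : Type} {V : CompleteNormedModule R_AbsRing}
    (a : I -> V) (g : I -> R) M :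
  (forall i, norm (a i) <= g i) -> (forall i, 0 <= g i) ->
  (forall l, NoDup l -> lsum (V := R_NormedModule) g l <= M) ->
  norm (Sum a) <= M.
Proof.
intros Ha Hg HM; apply (norm_is_sum_le a g _ M Ha HM).
apply (is_sum_dominated a g Ha); split; [exact Hg|exists M; exact HM].
Qed.

(** Fubini for a dominated double family: the finite partial sums in [j]
    commute with the sum over [i], and dominated convergence lets them grow. *)
Lemma is_sum_swap {I J : Type} {V : CompleteNormedModule R_AbsRing}
    (x : I -> J -> V) (G : I -> J -> R) (y : I -> R) :
  (forall i j, norm (x i j) <= G i j) -> (forall i j, 0 <= G i j) ->
  (forall i l, NoDup l -> lsum (V := R_NormedModule) (G i) l <= y i) ->
  summable y ->
  is_sum (fun j => Sum (fun i => x i j)) (Sum (fun i => Sum (x i))).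
Proof.
intros Hx HG Hy Sy.
assert (Hj : forall j, is_sum (fun i => x i j) (Sum (fun i => x i j))).
{ intros j; apply (is_sum_dominated _ y); [|exact Sy]; intros i.
  eapply Rle_trans; [apply Hx|].
  eapply Rle_trans; [|apply (Hy i (cons j nil))].
  - rewrite lsum_cons; unfold lsum; simpl.
    change (G i j <= G i j + 0); lra.
  - constructor; [intros []|constructor]. }
unfold is_sum.
apply (filterlim_ext (fun l => Sum (fun i => lsum (x i) l))).
{ intros l; apply is_sum_Sum, (is_sum_lsum x _ l Hj). }
apply (Sum_dominated_convergence (fun l i => lsum (x i) l) _ y Sy).
- exists nil; intros l Hl _ i; eapply Rle_trans; [|apply (Hy i l Hl)].
  apply norm_lsum_le; intros j _; apply Hx.
- intros i; apply (is_sum_dominated _ (G i)); [apply Hx|].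
  split; [apply HG|exists (y i); apply Hy].
Qed.

Lemma is_sum_reindex {I J : Type} {V : NormedModule R_AbsRing}
    (s : J -> I) (s' : I -> J) (a : I -> V) (S : V) :
  (forall j, s' (s j) = j) -> (forall i, s (s' i) = i) ->
  is_sum a S -> is_sum (fun j => a (s j)) S.
Proof.
intros K1 K2 H P HP; destruct (H P HP) as [l0 Hl0].
exists (List.map s' l0); intros l Hl Hi.
change (P (lsum (fun j => a (s j)) l)); rewrite -lsum_map.
apply Hl0.
- apply FinFun.Injective_map_NoDup; [|exact Hl].
  intros j j' Hj; rewrite -(K1 j) Hj; apply K1.
- intros i Hx; rewrite -(K2 i); apply in_map, Hi, in_map, Hx.
Qed.

Lemma is_sum_linear {I : Type} {U V : NormedModule R_AbsRing} (f : U -> V)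
    (a : I -> U) (s : U) :
  is_linear f -> is_sum a s -> is_sum (fun i => f (a i)) (f s).
Proof.
intros Hf Ha; unfold is_sum.
apply (filterlim_ext (fun l => f (lsum a l))).
- intros l; induction l as [|i l IH].
  + apply (linear_zero _ Hf).
  + rewrite lsum_cons (linear_plus _ Hf) IH; reflexivity.
- eapply filterlim_comp; [exact Ha|apply (linear_cont _ _ Hf)].
Qed.

Lemma lsum_le_Sum {I : Type} (g : I -> R) (l : list I) :
  summable g -> NoDup l ->
  lsum (V := R_NormedModule) g l <= Sum (V := R_CompleteNormedModule) g.
Proof.
intros Hg Hl.
assert (Hs : is_sum (V := R_CompleteNormedModule) g
               (Sum (V := R_CompleteNormedModule) g)).
{ apply (is_sum_dominated (V := R_CompleteNormedModule) g g); [|exact Hg].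
  intros i; change (Rabs (g i) <= g i); rewrite Rabs_pos_eq;
    [apply Rle_refl|apply Hg]. }
apply (filterlim_le (F := @finite_subsets I)
  (fun _ => lsum (V := R_NormedModule) g l)
  (fun l => lsum (V := R_NormedModule) g l)
  (lsum (V := R_NormedModule) g l) (Sum (V := R_CompleteNormedModule) g)).
- exists l; intros l' Hl' Hi; apply lsum_incl; try assumption; apply Hg.
- apply filterlim_const.
- exact Hs.
Qed.

(** * The lattice and its weights *)

(* Monoid structures on the real numbers, for the lemmas on big operators. *)
HB.instance Definition _ := Monoid.isComLaw.Build R 0 Rplus
  (fun x y z => Logic.eq_sym (Rplus_assoc x y z)) Rplus_comm Rplus_0_l.
HB.instance Definition _ := Monoid.isComLaw.Build R 1 Rmult
  (fun x y z => Logic.eq_sym (Rmult_assoc x y z)) Rmult_comm Rmult_1_l.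
HB.instance Definition _ := Monoid.isMulLaw.Build R 0 Rmult
  Rmult_0_l Rmult_0_r.
HB.instance Definition _ := Monoid.isAddLaw.Build R Rmult Rplus
  Rmult_plus_distr_r Rmult_plus_distr_l.

Lemma lsum_big {I : Type} (g : I -> R) (l : list I) :
  lsum (V := R_NormedModule) g l = \big[Rplus/0]_(i <- l) g i.
Proof.
induction l as [|x l IH]; [rewrite big_nil //|].
rewrite big_cons lsum_cons IH //.
Qed.

Lemma Rpower_neg_le (x y r : R) : 0 <= r -> 0 < x <= y ->
  Rpower y (- r) <= Rpower x (- r).
Proof.
intros Hr Hx; rewrite !Rpower_Ropp.
apply Rinv_le_contravar; [apply exp_pos|apply Rle_Rpower_l; lra].
Qed.

Lemma Rpower_pos (x y : R) : 0 < Rpower x y.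
Proof. apply exp_pos. Qed.

(** By the mean value theorem, (N+1)^{-s} is at most the N-th term of the
    telescoping series of x^{1-s} / (s-1). *)
Lemma sum_Rpower_bounded (s : R) (N : nat) : 1 < s ->
  \big[Rplus/0]_(k < N) Rpower (1 + INR k) (- s) <= 1 + / (s - 1).
Proof.
intros Hs.
assert (Hi : 0 < / (s - 1)) by (apply Rinv_0_lt_compat; lra).
destruct N as [|N]; [rewrite big_ord0; lra|].
assert (H : \big[Rplus/0]_(k < N.+1) Rpower (1 + INR k) (- s) <=
  1 + / (s - 1) * (1 - Rpower (1 + INR N) (1 - s))).
{ induction N as [|N IH].
  - rewrite big_ord_recr big_ord0 /= Rplus_0_l Rplus_0_r.
    unfold Rpower; rewrite ln_1 !Rmult_0_r exp_0; lra.
  - assert (E0 : \big[Rplus/0]_(k < N.+2) Rpower (1 + INR k) (- s) =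
      \big[Rplus/0]_(k < N.+1) Rpower (1 + INR k) (- s) +
      Rpower (1 + INR N.+1) (- s)) by rewrite big_ord_recr //.
    rewrite E0.
    pose proof (pos_INR N) as HN.
    destruct (MVT_cor2 (fun x => Rpower x (1 - s))
      (fun x => (1 - s) * Rpower x (1 - s - 1))
      (1 + INR N) (1 + INR N.+1)) as [c [Hc1 Hc2]].
    + rewrite S_INR; lra.
    + intros c Hc; apply derivable_pt_lim_power; lra.
    + assert (Hle : Rpower (1 + INR N.+1) (- s) <= Rpower c (- s))
        by (apply Rpower_neg_le; lra).
      replace (1 - s - 1) with (- s) in Hc1 by ring.
      replace (1 + INR N.+1 - (1 + INR N)) with 1 in Hc1
        by (rewrite S_INR; ring).
      assert (E : / (s - 1) * (Rpower (1 + INR N) (1 - s) -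
        Rpower (1 + INR N.+1) (1 - s)) = Rpower c (- s)).
      { replace (Rpower (1 + INR N) (1 - s) - Rpower (1 + INR N.+1) (1 - s))
          with ((s - 1) * Rpower c (- s)) by lra.
        field; lra. }
      lra. }
pose proof (Rpower_pos (1 + INR N) (1 - s)).
assert (0 <= / (s - 1) * Rpower (1 + INR N) (1 - s)).
{ apply Rmult_le_pos; lra. }
lra.
Qed.

Section Lattice.
Context {nu : nat}.
Implicit Types (m n : lattice nu).

Lemma l1norm_ge0 n : 0 <= l1norm n.
Proof.
unfold l1norm; apply big_ind; [apply Rle_refl| |intros; apply Rabs_pos].
intros; apply Rplus_le_le_0_compat; assumption.
Qed.

Lemma coord_le_l1norm n j : Rabs (IZR (n j)) <= l1norm n.
Proof.
unfold l1norm; rewrite (bigD1 j) //=.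
set s := (X in _ <= _ + X).
assert (0 <= s); [|lra].
unfold s; apply big_ind; [apply Rle_refl| |intros; apply Rabs_pos].
intros; apply Rplus_le_le_0_compat; assumption.
Qed.

Definition lsub n m : lattice nu := [ffun j => (n j - m j)%Z].
Definition ladd n m : lattice nu := [ffun j => (n j + m j)%Z].

Lemma ladd_subK n m : ladd (lsub n m) m = n.
Proof. apply/ffunP => j; rewrite !ffunE /=; lia. Qed.

Lemma lsub_addK n m : lsub (ladd n m) m = n.
Proof. apply/ffunP => j; rewrite !ffunE /=; lia. Qed.

Lemma lsub_subK n m : lsub n (lsub n m) = m.
Proof. apply/ffunP => j; rewrite !ffunE /=; lia. Qed.

Lemma l1norm_sub n m : l1norm n <= l1norm m + l1norm (lsub n m).
Proof.
unfold l1norm; rewrite -big_split /=.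
apply (big_ind2 Rle); [apply Rle_refl|intros; apply Rplus_le_compat; assumption|].
intros j _; rewrite ffunE minus_IZR.
eapply Rle_trans; [|apply Rabs_triang].
apply Req_le; f_equal; ring.
Qed.

Lemma pairing_sub n m (omega : 'I_nu -> R) :
  pairing n omega = pairing m omega + pairing (lsub n m) omega.
Proof.
unfold pairing; rewrite -big_split /=; apply eq_bigr => j _.
rewrite ffunE minus_IZR; ring.
Qed.

Lemma pairing_le (omega : 'I_nu -> R) : exists W, 1 <= W /\
  forall n, Rabs (pairing n omega) <= W * (1 + l1norm n).
Proof.
set W := \big[Rplus/0]_(j < nu) Rabs (omega j).
assert (HW : 0 <= W).
{ unfold W; apply big_ind; [apply Rle_refl| |intros; apply Rabs_pos].
  intros; apply Rplus_le_le_0_compat; assumption. }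
exists (1 + W); split; [lra|]; intros n; pose proof (l1norm_ge0 n).
apply Rle_trans with (W * l1norm n); [|nra].
unfold pairing; rewrite /W Rmult_comm big_distrr /=.
apply (big_ind2 (fun x y => Rabs x <= y)).
- rewrite Rabs_R0; lra.
- intros x1 x2 y1 y2 H1 H2; eapply Rle_trans; [apply Rabs_triang|lra].
- intros j _; rewrite Rabs_mult; apply Rmult_le_compat_r; [apply Rabs_pos|].
  apply coord_le_l1norm.
Qed.

Lemma weight_pos (r : R) n : 0 < weight r n.
Proof. apply Rpower_pos. Qed.

(** Each factor 1 + |n| of (1 + |n|)^nu dominates one of the 1 + |n_j|; this
    separates the coordinates. *)
Lemma weight_le_prod (r : R) n : 0 <= r ->
  weight r n <=
  \big[Rmult/1]_(j < nu) Rpower (1 + Rabs (IZR (n j))) (- (r / INR nu)).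
Proof.
intros Hr; pose proof (l1norm_ge0 n) as Hn.
apply Rle_trans with
  (\big[Rmult/1]_(j < nu) Rpower (1 + l1norm n) (- (r / INR nu))).
- rewrite big_const_ord; apply Req_le; unfold weight.
  assert (E : forall k x, iter k (Rmult (Rpower (1 + l1norm n) x)) 1 =
    Rpower (1 + l1norm n) (INR k * x)).
  { intros k x; induction k as [|k IH].
    - simpl; rewrite Rmult_0_l Rpower_O //; lra.
    - rewrite iterS IH -Rpower_plus; f_equal; rewrite S_INR; ring. }
  rewrite E; destruct nu as [|k].
  + unfold l1norm; rewrite big_ord0 Rplus_0_r /Rpower ln_1 !Rmult_0_r //.
  + f_equal; field; apply not_0_INR; discriminate.
- apply (big_ind2 (fun x y => 0 <= x <= y)).
  + lra.
  + intros; split; [apply Rmult_le_pos|apply Rmult_le_compat]; lra.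
  + intros j _; split; [left; apply Rpower_pos|].
    apply Rpower_neg_le.
    * destruct nu as [|k]; [destruct j as [j Hj]; discriminate Hj|].
      apply Rdiv_le_0_compat; [lra|]; apply lt_0_INR; lia.
    * pose proof (Rabs_pos (IZR (n j))); pose proof (coord_le_l1norm n j); lra.
Qed.

(** By [weight_le_prod] a finite sum over a box is at most a product of
    one-dimensional sums with exponent [r / nu > 1].  The box is indexed by
    signs and absolute values, counting zero twice. *)
Lemma weight_summable (r : R) : INR nu < r -> summable (weight (nu := nu) r).
Proof.
intros Hr.
assert (Hr0 : 0 <= r) by (pose proof (pos_INR nu); lra).
split; [intros n; left; apply weight_pos|].
set s := r / INR nu; set C1 := 1 + / (s - 1).
exists (\big[Rmult/1]_(j < nu) (C1 + C1)); intros l Hl.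
assert (HN : exists N : nat, forall n, In n l -> forall j,
  (Z.abs_nat (n j) < N)%coq_nat).
{ clear Hl; induction l as [|n l [N IH]]; [exists O; intros n []|].
  exists (N + \max_(j < nu) (Z.abs_nat (n j)).+1)%coq_nat; intros n' [<-|Hn] j.
  - pose proof (leq_bigmax (F := fun j => (Z.abs_nat (n j)).+1) j) as H.
    move/leP: H => H.
    exact (PeanoNat.Nat.le_trans _ _ _ H (PeanoNat.Nat.le_add_l _ _)).
  - specialize (IH _ Hn j); lia. }
destruct HN as [N HN].
set sg := fun (q : bool * 'I_N) =>
  if q.1 then Z.of_nat q.2 else (- Z.of_nat q.2)%Z.
set emb := fun f : {ffun 'I_nu -> bool * 'I_N} =>
  ([ffun j => sg (f j)] : lattice nu).
eapply Rle_trans; [apply (lsum_incl _ l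
  (List.map emb (enum {ffun 'I_nu -> bool * 'I_N})))|].
- intros n; left; apply weight_pos.
- exact Hl.
- intros n Hn.
  set f : {ffun 'I_nu -> bool * 'I_N} := [ffun j =>
    ((0 <=? n j)%Z, Ordinal (introT ltP (HN n Hn j)))].
  assert (E : n = emb f).
  { apply/ffunP => j; rewrite !ffunE /sg /=.
    destruct (Z.leb_spec 0 (n j)); lia. }
  rewrite E; apply in_map.
  assert (Hin : f \in enum {ffun 'I_nu -> bool * 'I_N}) by (rewrite mem_enum //).
  clear -Hin; induction (enum {ffun 'I_nu -> bool * 'I_N}) as [|g t IH];
    [discriminate Hin|].
  rewrite in_cons in Hin; case/orP: Hin => [/eqP ->|Hin];
    [left; reflexivity|right; apply IH, Hin].
- rewrite lsum_map.
  eapply Rle_trans;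
    [apply lsum_le; intros f _; exact (weight_le_prod r (emb f) Hr0)|].
  rewrite lsum_big.
  rewrite big_enum /=.
  rewrite (eq_bigr (fun f : {ffun 'I_nu -> bool * 'I_N} =>
    \big[Rmult/1]_(j < nu) Rpower (1 + INR (f j).2) (- s))).
  2: { intros f _; apply eq_bigr => j _; rewrite ffunE /sg.
       destruct (f j) as [[] k]; simpl; rewrite -?opp_IZR ?opp_IZR ?Rabs_Ropp
         -INR_IZR_INZ (Rabs_pos_eq (INR k)) //; apply pos_INR. }
  rewrite -(bigA_distr_bigA (fun (j : 'I_nu) (q : bool * 'I_N) =>
    Rpower (1 + INR q.2) (- s))).
  apply (big_ind2 (fun x y => 0 <= x <= y)).
  + lra.
  + intros; split; [apply Rmult_le_pos|apply Rmult_le_compat]; lra.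
  + intros j _; split.
    { apply big_ind; [apply Rle_refl| |intros; left; apply Rpower_pos].
      intros; apply Rplus_le_le_0_compat; assumption. }
    rewrite -(pair_bigA _ (fun (b : bool) (k : 'I_N) =>
      Rpower (1 + INR k) (- s))) /= big_bool.
    assert (Hs : 1 < s).
    { unfold s; assert (0 < INR nu).
      { destruct nu as [|k]; [destruct j as [j Hj]; discriminate Hj|].
        apply lt_0_INR; lia. }
      apply Rlt_div_r; lra. }
    pose proof (sum_Rpower_bounded s N Hs) as H.
    exact (Rplus_le_compat _ _ _ _ H H).
Qed.

Lemma weight_mono (r s : R) n : r <= s -> weight s n <= weight r n.
Proof.
intros H; unfold weight; pose proof (l1norm_ge0 n).
apply Rle_Rpower; lra.
Qed.

Lemma weight_sqr (r : R) n :
  (1 + l1norm n) ^ 2 * weight r n = weight (r - 2) n.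
Proof.
unfold weight; pose proof (l1norm_ge0 n).
rewrite -Rpower_pow; [|lra]; rewrite -Rpower_plus; f_equal; simpl; ring.
Qed.

(** Peetre-type inequality: one of [m], [n - m] has at least half the size
    of [n]. *)
Lemma weight_mul_le (r : R) m n : 0 <= r ->
  weight r m * weight r (lsub n m) <=
  Rpower 2 r * weight r n * (weight r m + weight r (lsub n m)).
Proof.
intros Hr.
pose proof (l1norm_ge0 m); pose proof (l1norm_ge0 n).
pose proof (l1norm_ge0 (lsub n m)); pose proof (l1norm_sub n m).
assert (Hh : forall k : lattice nu, (1 + l1norm n) / 2 <= 1 + l1norm k ->
  weight r k <= Rpower 2 r * weight r n).
{ intros k Hk; unfold weight.
  eapply Rle_trans; [apply (Rpower_neg_le ((1 + l1norm n) / 2)); lra|].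
  apply Req_le; unfold Rdiv; rewrite -Rpower_mult_distr; [|lra|lra].
  rewrite Rmult_comm; f_equal.
  unfold Rpower; rewrite ln_Rinv; [|lra]; f_equal; ring. }
pose proof (weight_pos r m); pose proof (weight_pos r (lsub n m)).
assert (0 < Rpower 2 r * weight r n)
  by (apply Rmult_lt_0_compat; apply Rpower_pos).
destruct (Rle_or_lt ((1 + l1norm n) / 2) (1 + l1norm m)) as [Hm|Hm].
- pose proof (Hh _ Hm); nra.
- assert (Hs : (1 + l1norm n) / 2 <= 1 + l1norm (lsub n m)) by lra.
  pose proof (Hh _ Hs); nra.
Qed.

(** The weights form a convolution algebra up to the constant [Kconst]: by
    [weight_mul_le], m and n - m each contribute 2^r times the sum of all
    weights. *)
Lemma lsum_weight_conv (r : R) n (l : list (lattice nu)) : INR nu < r ->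
  NoDup l ->
  lsum (V := R_NormedModule) (fun m => weight r m * weight r (lsub n m)) l <=
  Kconst r nu * weight r n.
Proof.
intros Hr Hl.
assert (Hr0 : 0 <= r) by (pose proof (pos_INR nu); lra).
pose proof (weight_summable r Hr) as Hw.
eapply Rle_trans;
  [apply lsum_le; intros m _; apply (weight_mul_le r m n Hr0)|].
rewrite (lsum_scal (V := R_NormedModule) (Rpower 2 r * weight r n)).
rewrite (lsum_plus (V := R_NormedModule) (weight r)).
set S := Sum (V := R_CompleteNormedModule) (weight (nu := nu) r).
assert (H1 := lsum_le_Sum _ l Hw Hl); fold S in H1.
assert (H2 : lsum (V := R_NormedModule) (fun m => weight r (lsub n m)) l <= S).
{ rewrite -(lsum_map (V := R_NormedModule)); apply lsum_le_Sum; [exact Hw|].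
  apply FinFun.Injective_map_NoDup; [|exact Hl].
  intros x y Hxy; rewrite -(lsub_subK n x) Hxy lsub_subK //. }
unfold Kconst; change (Sum (fun m : lattice nu => weight r m)) with S.
rewrite Rpower_plus Rpower_1; [|lra].
change (@scal R_Ring _) with Rmult; change (@plus _) with Rplus.
pose proof (weight_pos r n); pose proof (Rpower_pos 2 r).
apply Rle_trans with (Rpower 2 r * weight r n * (S + S)); [|right; ring].
apply Rmult_le_compat_l; [nra|].
apply Rplus_le_compat; assumption.
Qed.

End Lattice.

(** * Products of quasi-periodic series *)

(* The complex plane as a complete normed space over the reals. *)

Notation CV := C_R_CompleteNormedModule.

Lemma Cmod_expi y : Cmod (expi y) = 1.
Proof.
unfold Cmod, expi; simpl fst; simpl snd.
rewrite -sqrt_1; f_equal; pose proof (sin2_cos2 y); unfold Rsqr in *; nra.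
Qed.

Lemma expi_plus x y : expi (x + y) = Cmult (expi x) (expi y).
Proof.
unfold expi, Cmult; simpl; rewrite cos_plus sin_plus; f_equal; ring.
Qed.

Lemma norm_CV (z : C) : norm (V := CV) z = Cmod z.
Proof. symmetry; exact (Cmod_norm z). Qed.

Lemma scal_CV (k : R) (z : C) :
  @scal R_Ring C_R_ModuleSpace k z = Cmult (RtoC k) z.
Proof.
destruct z as [a b]; unfold Cmult, RtoC; simpl.
change ((k * a, k * b) = (k * a - 0 * b, k * b + 0 * a)); f_equal; ring.
Qed.

Lemma is_linear_Cmult (z : C) :
  is_linear (U := C_R_NormedModule) (V := C_R_NormedModule) (Cmult z).
Proof.
constructor.
- intros x y; exact (Cmult_plus_distr_l z x y).
- intros k x.
  change (Cmult z (@scal R_Ring C_R_ModuleSpace k x) =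
    @scal R_Ring C_R_ModuleSpace k (Cmult z x)).
  rewrite !scal_CV; ring.
- exists (Cmod z + 1); split; [pose proof (Cmod_ge_0 z); lra|]; intros x.
  change (norm (V := CV) (Cmult z x) <= (Cmod z + 1) * norm (V := CV) x).
  rewrite !norm_CV Cmod_mult; pose proof (Cmod_ge_0 x); nra.
Qed.

Lemma is_sum_Cmult {I : Type} (z : C) (a : I -> C) (s : C) :
  is_sum (V := C_R_NormedModule) a s ->
  is_sum (V := C_R_NormedModule) (fun i => Cmult z (a i)) (Cmult z s).
Proof. apply is_sum_linear, is_linear_Cmult. Qed.

Lemma filterlim_CVP {T : Type} {F : (T -> Prop) -> Prop} {FF : Filter F}
    (f : T -> C) (y : C) :
  filterlim f F (locally (y : CV)) <->
  (forall eps : posreal, F (fun x => Cmod (Cminus (f x) y) < eps)).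
Proof.
split.
- intros H eps; apply: filter_imp (proj1 (filterlim_normP (V := CV) f y) H eps).
  intros t; rewrite norm_CV //.
- intros H; apply (filterlim_normP (V := CV)); intros eps.
  apply: filter_imp (H eps) => t; rewrite norm_CV //.
Qed.

Lemma filterlim_Cmult {T : Type} {F : (T -> Prop) -> Prop} {FF : Filter F}
    (f g : T -> C) (x y : C) :
  filterlim f F (locally (x : CV)) -> filterlim g F (locally (y : CV)) ->
  filterlim (fun t => Cmult (f t) (g t)) F (locally (Cmult x y : CV)).
Proof.
intros Hf Hg; apply filterlim_CVP; intros [eps He]; simpl.
pose proof (Cmod_ge_0 x); pose proof (Cmod_ge_0 y).
set D := 1 + Cmod x + Cmod y.
assert (Hd : 0 < Rmin 1 (eps / D)).
{ apply Rmin_pos; [lra|]; apply Rdiv_lt_0_compat; unfold D; lra. }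
pose proof (proj1 (filterlim_CVP _ _) Hf (mkposreal _ Hd)) as H1.
pose proof (proj1 (filterlim_CVP _ _) Hg (mkposreal _ Hd)) as H2.
apply: filter_imp (filter_and _ _ H1 H2) => t [H3 H4]; simpl in H3, H4.
pose proof (Rmin_l 1 (eps / D)); pose proof (Rmin_r 1 (eps / D)).
replace (Cminus (Cmult (f t) (g t)) (Cmult x y)) with
  (Cplus (Cmult (Cminus (f t) x) (Cminus (g t) y))
    (Cplus (Cmult x (Cminus (g t) y)) (Cmult y (Cminus (f t) x)))) by ring.
eapply Rle_lt_trans; [apply Cmod_triangle|].
eapply Rle_lt_trans; [apply Rplus_le_compat_l, Cmod_triangle|].
rewrite !Cmod_mult.
pose proof (Cmod_ge_0 (Cminus (f t) x)); pose proof (Cmod_ge_0 (Cminus (g t) y)).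
assert (E : eps / D * D = eps) by (field; unfold D; lra).
set (u := Cmod (Cminus (f t) x)) in *; set (v := Cmod (Cminus (g t) y)) in *.
set (q := Rmin 1 (eps / D)) in *.
assert (u * v <= u * 1) by (apply Rmult_le_compat_l; lra).
assert (Cmod x * v <= Cmod x * q) by (apply Rmult_le_compat_l; lra).
assert (Cmod y * u <= Cmod y * q) by (apply Rmult_le_compat_l; lra).
assert (q * D <= eps) by (apply Rle_trans with (eps / D * D);
  [apply Rmult_le_compat_r; [unfold D; lra|assumption]|rewrite E; lra]).
unfold D in *; lra.
Qed.

Definition decays {nu : nat} (r al : R) (a : lattice nu -> C) : Prop :=
  forall n, Cmod (a n) <= al * weight r n.

Lemma decays_ge0 {nu : nat} (r al : R) (a : lattice nu -> C) :
  decays r al a -> 0 <= al.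
Proof.
intros Ha; apply Rnot_lt_le; intros H.
pose proof (Ha [ffun=> 0%Z]); pose proof (Cmod_ge_0 (a [ffun=> 0%Z])).
pose proof (weight_pos (nu := nu) r [ffun=> 0%Z]); nra.
Qed.

Section QuasiPeriodic.
Context {nu : nat}.
Implicit Types (m n : lattice nu) (a b : lattice nu -> C) (omega : 'I_nu -> R).

Definition conv a b n : C :=
  Sum (V := CV) (fun m => Cmult (a m) (b (lsub n m))).

Lemma conv_dominated (r al be : R) a b n m : decays r al a -> decays r be b ->
  norm (V := CV) (Cmult (a m) (b (lsub n m))) <=
  al * be * (weight r m * weight r (lsub n m)).
Proof.
intros Ha Hb; rewrite norm_CV Cmod_mult.
replace (al * be * (weight r m * weight r (lsub n m))) with
  (al * weight r m * (be * weight r (lsub n m))) by ring.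
apply Rmult_le_compat; auto using Cmod_ge_0.
Qed.

Lemma conv_summable (r al : R) n : INR nu < r -> 0 <= al ->
  summable (fun m => al * (weight r m * weight r (lsub n m))).
Proof.
intros Hr Hal; apply summable_scal; [exact Hal|]; split.
- intros m; apply Rmult_le_pos; left; apply weight_pos.
- exists (Kconst r nu * weight r n); intros l Hl.
  apply lsum_weight_conv; assumption.
Qed.

Lemma Kconst_ge0 (r : R) : INR nu < r -> 0 <= Kconst r nu.
Proof.
intros Hr; pose proof (lsum_weight_conv (nu := nu) r [ffun=> 0%Z] nil Hr).
pose proof (weight_pos (nu := nu) r [ffun=> 0%Z]).
assert (0 <= Kconst r nu * weight (nu := nu) r [ffun=> 0%Z]); [|nra].
apply H; constructor.
Qed.

Lemma conv_decays (r al be : R) a b : INR nu < r ->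
  decays r al a -> decays r be b -> decays r (al * be * Kconst r nu) (conv a b).
Proof.
intros Hr Ha Hb n; rewrite -norm_CV.
pose proof (decays_ge0 _ _ _ Ha); pose proof (decays_ge0 _ _ _ Hb).
apply (norm_Sum_le (V := CV) _
  (fun m : lattice nu => al * be * (weight r m * weight r (lsub n m)))).
- intros m; apply conv_dominated; assumption.
- apply conv_summable; [assumption|nra].
- intros l Hl; rewrite (lsum_scal (V := R_NormedModule) (al * be)) Rmult_assoc.
  apply Rmult_le_compat_l; [nra|]; apply lsum_weight_conv; assumption.
Qed.

Lemma is_sum_conv (r al be : R) a b n : INR nu < r ->
  decays r al a -> decays r be b ->
  is_sum (V := CV) (fun m => Cmult (a m) (b (lsub n m))) (conv a b n).
Proof.
intros Hr Ha Hb.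
pose proof (decays_ge0 _ _ _ Ha); pose proof (decays_ge0 _ _ _ Hb).
apply (is_sum_dominated (V := CV) _
  (fun m : lattice nu => al * be * (weight r m * weight r (lsub n m)))).
- intros m; apply conv_dominated; assumption.
- apply conv_summable; [assumption|nra].
Qed.

Lemma conv_sub_l (r al be : R) a a' b n : INR nu < r ->
  decays r al a -> decays r al a' -> decays r be b ->
  Cminus (conv a b n) (conv a' b n) = conv (fun m => Cminus (a m) (a' m)) b n.
Proof.
intros Hr Ha Ha' Hb.
symmetry; unfold conv at 1; apply (is_sum_Sum (V := CV)).
pose proof (is_sum_conv r al be a b n Hr Ha Hb) as H1.
pose proof (is_sum_Cmult (-1)%C _ _
  (is_sum_conv r al be a' b n Hr Ha' Hb)) as H2.
pose proof (is_sum_plus (V := C_R_NormedModule) _ _ _ _ H1 H2) as H3.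
replace (Cminus (conv a b n) (conv a' b n)) with
  (Cplus (conv a b n) (Cmult (-1)%C (conv a' b n))) by ring.
eapply is_sum_ext; [|exact H3]; intros m.
change (Cplus (Cmult (a m) (b (lsub n m)))
  (Cmult (-1)%C (Cmult (a' m) (b (lsub n m)))) =
  Cmult (Cminus (a m) (a' m)) (b (lsub n m))); ring.
Qed.

Lemma conv_sub_r (r al be : R) a b b' n : INR nu < r ->
  decays r al a -> decays r be b -> decays r be b' ->
  Cminus (conv a b n) (conv a b' n) = conv a (fun m => Cminus (b m) (b' m)) n.
Proof.
intros Hr Ha Hb Hb'.
symmetry; unfold conv at 1; apply (is_sum_Sum (V := CV)).
pose proof (is_sum_conv r al be a b n Hr Ha Hb) as H1.
pose proof (is_sum_Cmult (-1)%C _ _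
  (is_sum_conv r al be a b' n Hr Ha Hb')) as H2.
pose proof (is_sum_plus (V := C_R_NormedModule) _ _ _ _ H1 H2) as H3.
replace (Cminus (conv a b n) (conv a b' n)) with
  (Cplus (conv a b n) (Cmult (-1)%C (conv a b' n))) by ring.
eapply is_sum_ext; [|exact H3]; intros m.
change (Cplus (Cmult (a m) (b (lsub n m)))
  (Cmult (-1)%C (Cmult (a m) (b' (lsub n m)))) =
  Cmult (a m) (Cminus (b (lsub n m)) (b' (lsub n m)))); ring.
Qed.

(** The product of the two series is the double sum over (m, k) of the terms
    a(m) b(k - m) e(k).  Summed over k first it factors; summed over m first
    it is the series of [conv a b]. *)
Lemma is_qp_series_mult (r al be : R) omega a b x s t : INR nu < r ->
  decays r al a -> decays r be b ->
  is_qp_series omega a x s -> is_qp_series omega b x t ->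
  is_qp_series omega (conv a b) x (Cmult s t).
Proof.
intros Hr Ha Hb Hs Ht.
pose proof (decays_ge0 _ _ _ Ha) as Hal; pose proof (decays_ge0 _ _ _ Hb) as Hbe.
pose proof (weight_summable (nu := nu) r Hr) as Hw.
set e := fun n : lattice nu => expi (pairing n omega * x).
set X := fun m k : lattice nu =>
  Cmult (Cmult (a m) (e m)) (Cmult (b (lsub k m)) (e (lsub k m))).
pose proof (is_sum_swap (V := CV) X
  (fun m k : lattice nu => al * weight r m * (be * weight r (lsub k m)))
  (fun m : lattice nu => al * weight r m * (be *
     Sum (V := R_CompleteNormedModule) (weight (nu := nu) r)))) as H.
assert (E1 : forall k, Sum (V := CV) (X^~ k) = Cmult (conv a b k) (e k)).
{ intros k; apply (is_sum_Sum (V := CV)).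
  rewrite (Cmult_comm (conv a b k)).
  eapply is_sum_ext;
    [|exact (is_sum_Cmult (e k) _ _ (is_sum_conv r al be a b k Hr Ha Hb))].
  intros m; unfold X, e.
  rewrite (pairing_sub k m omega) Rmult_plus_distr_r expi_plus; simpl; ring. }
assert (E2 : forall m, Sum (V := CV) (X m) = Cmult t (Cmult (a m) (e m))).
{ intros m; apply (is_sum_Sum (V := CV)).
  rewrite (Cmult_comm t).
  apply (is_sum_Cmult (Cmult (a m) (e m))
    (fun k => Cmult (b (lsub k m)) (e (lsub k m)))).
  exact (is_sum_reindex (V := C_R_NormedModule) (lsub^~ m) (ladd^~ m)
    (fun k => Cmult (b k) (e k)) t
    (fun k => ladd_subK k m) (fun k => lsub_addK k m) Ht). }
unfold is_qp_series.
eapply is_sum_ext; [exact E1|].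
replace (Cmult s t) with (Sum (V := CV) (fun m => Sum (V := CV) (X m))).
- apply H.
  + intros m k; rewrite norm_CV /X !Cmod_mult !Cmod_expi !Rmult_1_r.
    apply Rmult_le_compat; auto using Cmod_ge_0.
  + intros m k; pose proof (weight_pos r m); pose proof (weight_pos r (lsub k m)).
    apply Rmult_le_pos; apply Rmult_le_pos; lra.
  + intros m l Hl.
    rewrite (lsum_scal (V := R_NormedModule) (al * weight r m)
      (fun k => be * weight r (lsub k m))).
    rewrite (lsum_scal (V := R_NormedModule) be (fun k => weight r (lsub k m))).
    pose proof (weight_pos r m).
    apply Rmult_le_compat_l; [nra|apply Rmult_le_compat_l; [exact Hbe|]].
    rewrite -(lsum_map (V := R_NormedModule) (lsub^~ m)).
    apply lsum_le_Sum; [exact Hw|].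
    apply FinFun.Injective_map_NoDup; [|exact Hl].
    intros k k' Hk; rewrite -(ladd_subK k m) Hk; apply ladd_subK.
  + apply (summable_le _ (fun m => (al * (be *
      Sum (V := R_CompleteNormedModule) (weight (nu := nu) r))) * weight r m)).
    * intros m; assert (0 <= Sum (V := R_CompleteNormedModule)
        (weight (nu := nu) r)).
      { apply (lsum_le_Sum (weight (nu := nu) r) nil Hw); constructor. }
      pose proof (weight_pos r m); split; [|right; ring].
      apply Rmult_le_pos; apply Rmult_le_pos; lra.
    * apply summable_scal; [|exact Hw].
      assert (0 <= Sum (V := R_CompleteNormedModule) (weight (nu := nu) r)).
      { apply (lsum_le_Sum (weight (nu := nu) r) nil Hw); constructor. }
      apply Rmult_le_pos; [lra|apply Rmult_le_pos; lra].
- rewrite (Sum_ext (V := CV) _ _ E2) (Cmult_comm s).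
  apply (is_sum_Sum (V := CV)).
  exact (is_sum_Cmult t _ _ Hs).
Qed.

(** The index k stands for the power k + 1, so that each increment of k costs
    exactly one factor [Kconst]. *)
Fixpoint conv_pow a (k : nat) : lattice nu -> C :=
  match k with
  | O => a
  | S k => conv a (conv_pow a k)
  end.

Lemma conv_pow_decays (r al : R) a k : INR nu < r -> decays r al a ->
  decays r (al * (al * Kconst r nu) ^ k) (conv_pow a k).
Proof.
intros Hr Ha; induction k as [|k IH].
- simpl; rewrite Rmult_1_r; exact Ha.
- simpl; intros n; eapply Rle_trans; [apply (conv_decays r _ _ _ _ Hr Ha IH)|].
  right; simpl; ring.
Qed.

Lemma is_qp_series_pow (r al : R) omega a x s k : INR nu < r ->
  decays r al a -> is_qp_series omega a x s ->
  is_qp_series omega (conv_pow a k) x (Cpow s k.+1).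
Proof.
intros Hr Ha Hs; induction k as [|k IH].
- simpl; rewrite Cmult_1_r; exact Hs.
- simpl; exact (is_qp_series_mult r _ _ omega _ _ x s _ Hr Ha
    (conv_pow_decays r al a k Hr Ha) Hs IH).
Qed.

(** Telescoping a^{k+2} - b^{k+2} = (a - b) a^{k+1} + b (a^{k+1} - b^{k+1}), with
    products of coefficients understood as convolutions. *)
Lemma conv_pow_lipschitz (r al de : R) a b k : INR nu < r ->
  decays r al a -> decays r al b ->
  decays r de (fun n => Cminus (a n) (b n)) ->
  decays r (INR k.+1 * de * (al * Kconst r nu) ^ k)
    (fun n => Cminus (conv_pow a k n) (conv_pow b k n)).
Proof.
intros Hr Ha Hb Hd; induction k as [|k IH].
- simpl; intros n; rewrite !Rmult_1_r Rmult_1_l; apply Hd.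
- intros n; simpl conv_pow.
  replace (Cminus (conv a (conv_pow a k) n) (conv b (conv_pow b k) n)) with
    (Cplus (Cminus (conv a (conv_pow a k) n) (conv b (conv_pow a k) n))
       (Cminus (conv b (conv_pow a k) n) (conv b (conv_pow b k) n))) by ring.
  pose proof (conv_pow_decays r al a k Hr Ha) as Hka.
  pose proof (conv_pow_decays r al b k Hr Hb) as Hkb.
  rewrite (conv_sub_l r _ _ _ _ _ n Hr Ha Hb Hka).
  rewrite (conv_sub_r r _ _ _ _ _ n Hr Hb Hka Hkb).
  eapply Rle_trans; [apply Cmod_triangle|].
  eapply Rle_trans; [apply Rplus_le_compat;
    [exact (conv_decays r _ _ _ _ Hr Hd Hka n)|
     exact (conv_decays r _ _ _ _ Hr Hb IH n)]|].
  right; rewrite (S_INR k.+1); simpl pow; ring.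
Qed.

(** A uniform weight bound dominates each convolution sum, so that termwise
    convergence of the coefficients is enough. *)
Lemma conv_pow_filterlim {T : Type} {F : (T -> Prop) -> Prop}
    {FF : ProperFilter F} (r al : R) (f : T -> lattice nu -> C)
    (f0 : lattice nu -> C) k : INR nu < r ->
  (forall t, decays r al (f t)) -> decays r al f0 ->
  (forall n, filterlim (fun t => f t n : CV) F (locally (f0 n : CV))) ->
  forall n, filterlim (fun t => conv_pow (f t) k n : CV) F
    (locally (conv_pow f0 k n : CV)).
Proof.
intros Hr Hf Hf0 Hlim; induction k as [|k IH]; [exact Hlim|]; intros n; simpl.
unfold conv.
pose proof (decays_ge0 _ _ _ Hf0) as Hal; pose proof (Kconst_ge0 r Hr) as HK.
assert (HM : 0 <= al * (al * (al * Kconst r nu) ^ k)).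
{ apply Rmult_le_pos; [lra|apply Rmult_le_pos; [lra|]].
  apply pow_le, Rmult_le_pos; lra. }
apply (Sum_dominated_convergence (V := CV)
  (fun t m => Cmult (f t m) (conv_pow (f t) k (lsub n m))) _ _
  (conv_summable r _ n Hr HM)).
- apply filter_forall; intros t m.
  apply conv_dominated; [apply Hf|apply conv_pow_decays; auto].
- intros m.
  exact (filterlim_Cmult _ _ _ _ (Hlim m) (IH (lsub n m))).
Qed.

End QuasiPeriodic.

(** * The coefficient equation *)

Definition ccont (f : R -> C) : Prop := forall t, continuous (f : R -> CV) t.

Lemma ccont_mult f g : ccont f -> ccont g -> ccont (fun t => Cmult (f t) (g t)).
Proof. intros Hf Hg t; exact (filterlim_Cmult f g _ _ (Hf t) (Hg t)). Qed.

Lemma ccont_plus f g : ccont f -> ccont g -> ccont (fun t => Cplus (f t) (g t)).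
Proof.
intros Hf Hg t; exact (continuous_plus (V := CV) f g t (Hf t) (Hg t)).
Qed.

Lemma ccont_const z : ccont (fun _ => z).
Proof. intros t; apply continuous_const. Qed.

Lemma ccont_RtoC (f : R -> R) : (forall t, continuous f t) ->
  ccont (fun t => RtoC (f t)).
Proof.
intros Hf t; apply filterlim_CVP; intros eps.
pose proof (proj1 (filterlim_locally_ball_norm (U := R_NormedModule) f (f t)) (Hf t) eps) as H.
apply: filter_imp H => s Hs.
rewrite -RtoC_minus Cmod_R; exact Hs.
Qed.

Lemma ccont_comp (f : R -> C) (g : R -> R) : (forall t, continuous g t) ->
  ccont f -> ccont (fun t => f (g t)).
Proof.
intros Hg Hf t; exact (continuous_comp g (f : R -> CV) t (Hg t) (Hf (g t))).
Qed.

Lemma ccont_ext (f g : R -> C) : (forall t, f t = g t) -> ccont f -> ccont g.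
Proof.
intros H Hf t; exact (continuous_ext (f : R -> CV) g t H (Hf t)).
Qed.

Definition primC (f : R -> C) (t : R) : C := RInt (V := CV) f 0 t.

Lemma ex_primC f a b : ccont f -> ex_RInt (V := CV) f a b.
Proof. intros Hf; apply ex_RInt_continuous; intros z _; apply Hf. Qed.

Lemma primC_is_derive f t : ccont f -> is_derive (V := C_R_NormedModule) (primC f) t (f t).
Proof.
intros Hf.
apply (is_derive_RInt (V := C_R_NormedModule) f (primC f) 0 t).
- apply filter_forall; intros s.
  exact (RInt_correct (V := CV) f 0 s (ex_primC f 0 s Hf)).
- exact (Hf t).
Qed.

Lemma primC_ccont f : ccont f -> ccont (primC f).
Proof.
intros Hf t.
apply (ex_derive_continuous (V := C_R_NormedModule)).
exists (f t); apply primC_is_derive, Hf.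
Qed.

Lemma RInt_Cmod_le f a b M : ccont f -> a <= b ->
  (forall s, a <= s <= b -> Cmod (f s) <= M) ->
  Cmod (RInt (V := CV) f a b) <= (b - a) * M.
Proof.
intros Hf Hab HM; rewrite -norm_CV.
apply (norm_RInt_le_const (V := C_R_NormedModule) f a b).
- exact Hab.
- intros s Hs; rewrite (norm_CV (f s)); apply HM, Hs.
- exact (RInt_correct (V := CV) f a b (ex_primC f a b Hf)).
Qed.

Lemma primC_le f t M : ccont f -> 0 <= t ->
  (forall s, 0 <= s <= t -> Cmod (f s) <= M) -> Cmod (primC f t) <= t * M.
Proof.
intros Hf Ht HM; replace (t * M) with ((t - 0) * M) by ring.
apply RInt_Cmod_le; assumption.
Qed.

Lemma primC_lipschitz_le f s t M : ccont f -> 0 <= s <= t ->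
  (forall u, 0 <= u <= t -> Cmod (f u) <= M) ->
  Cmod (Cminus (primC f t) (primC f s)) <= M * Rabs (t - s).
Proof.
intros Hf Hst HM.
assert (E : Cminus (primC f t) (primC f s) = RInt (V := CV) f s t).
{ pose proof (RInt_Chasles (V := CV) f 0 s t (ex_primC f _ _ Hf) (ex_primC f _ _ Hf)) as H.
  unfold primC; rewrite -H.
  change (Cminus (Cplus (RInt (V := CV) f 0 s) (RInt (V := CV) f s t))
    (RInt (V := CV) f 0 s) = RInt (V := CV) f s t); ring. }
rewrite E Rabs_pos_eq; [|lra]; rewrite Rmult_comm.
apply RInt_Cmod_le; [exact Hf|lra|]; intros u Hu; apply HM; lra.
Qed.

Lemma primC_lipschitz f s t L M : ccont f -> 0 <= s <= L -> 0 <= t <= L ->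
  (forall u, 0 <= u <= L -> Cmod (f u) <= M) ->
  Cmod (Cminus (primC f t) (primC f s)) <= M * Rabs (t - s).
Proof.
intros Hf Hs Ht HM; destruct (Rle_dec s t) as [H|H].
- apply primC_lipschitz_le; [exact Hf|lra|]; intros u Hu; apply HM; lra.
- rewrite -Cmod_opp Rabs_minus_sym.
  replace (- Cminus (primC f t) (primC f s))%C with (Cminus (primC f s) (primC f t)) by ring.
  apply primC_lipschitz_le; [exact Hf|lra|]; intros u Hu; apply HM; lra.
Qed.

Lemma primC_minus f g t : ccont f -> ccont g ->
  Cminus (primC f t) (primC g t) = primC (fun s => Cminus (f s) (g s)) t.
Proof.
intros Hf Hg; symmetry.
exact (RInt_minus (V := CV) f g 0 t (ex_primC f _ _ Hf) (ex_primC g _ _ Hg)).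
Qed.

Lemma primC_ext f g t : (forall s, f s = g s) -> primC f t = primC g t.
Proof. intros H; apply (RInt_ext (V := CV)); intros s _; apply H. Qed.

(** Time is frozen outside [0, L]: the coefficient functions are then bounded
    and continuous on the whole line, while nothing changes on [0, L]. *)
Definition clamp (L t : R) : R := Rmax 0 (Rmin L t).

Lemma clamp_id L t : 0 <= t <= L -> clamp L t = t.
Proof.
intros H; unfold clamp; rewrite Rmin_right; [|lra]; apply Rmax_right; lra.
Qed.

Lemma clamp_in L t : 0 <= L -> 0 <= clamp L t <= L.
Proof.
intros H; unfold clamp, Rmax, Rmin.
destruct (Rle_dec L t); destruct Rle_dec; lra.
Qed.

Lemma clamp_lipschitz L s t : Rabs (clamp L s - clamp L t) <= Rabs (s - t).
Proof.
unfold clamp, Rmax, Rmin, Rabs.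
repeat destruct Rle_dec; repeat destruct Rcase_abs; lra.
Qed.

Lemma clamp_continuous L t : continuous (clamp L) t.
Proof.
apply (filterlim_locally_ball_norm (U := R_NormedModule)); intros eps.
exists eps; intros s Hs.
eapply Rle_lt_trans; [apply clamp_lipschitz|exact Hs].
Qed.

Section Picard.
Context {nu : nat} (omega : 'I_nu -> R) (c d : lattice nu -> C).
Context (k : nat) (A r L : R).
Hypothesis (hr : INR nu < r) (hL : 0 <= L) (hA : 0 < A).
Hypothesis (hc : decays r A c) (hd : decays r A d).
Let kappa := (2 * A * Kconst r nu) ^ k.
Hypothesis (hL1 : L ^ 2 * (1 + INR k.+1 * kappa) <= 1 / 2).
Hypothesis (hL2 : L + 2 * L ^ 2 * (1 + kappa) <= 1).

Implicit Types (n : lattice nu) (a b : R -> lattice nu -> C).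

(** On the n-th Fourier mode, minus d_xx (1 - d_xx)^{-1} is multiplication by
    [theta n]. *)
Definition theta n : R :=
  pairing n omega ^ 2 / (1 + pairing n omega ^ 2).

Lemma theta_bound n : 0 <= theta n <= 1.
Proof.
unfold theta; pose proof (pow2_ge_0 (pairing n omega)).
split; [apply Rdiv_le_0_compat; lra|].
apply Rle_div_l; lra.
Qed.

(** The n-th Fourier coefficient of u + u^{k+1}. *)
Definition forcing a t n : C := Cplus (a t n) (conv_pow (a t) k n).

(** On the n-th mode the equation is a'' = - theta * (a + a^{k+1}); this is its
    twice integrated form with initial data c, d. *)
Definition picard a t n : C :=
  Cminus (Cplus (c n) (Cmult (RtoC (clamp L t)) (d n)))
    (Cmult (RtoC (theta n))
       (primC (primC (fun s => forcing a s n)) (clamp L t))).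

Definition admissible a : Prop :=
  (forall t, decays r (2 * A) (a t)) /\ (forall n, ccont (fun t => a t n)).

Lemma kappa_ge0 : 0 <= kappa.
Proof.
pose proof (Kconst_ge0 (nu := nu) r hr).
apply pow_le, Rmult_le_pos; lra.
Qed.

Lemma forcing_decays a : admissible a ->
  forall t, decays r (2 * A * (1 + kappa)) (forcing a t).
Proof.
intros [Ha _] t n; unfold forcing.
eapply Rle_trans; [apply Cmod_triangle|].
eapply Rle_trans; [apply Rplus_le_compat;
  [exact (Ha t n)|exact (conv_pow_decays r (2 * A) (a t) k hr (Ha t) n)]|].
right; unfold kappa; ring.
Qed.

Lemma forcing_ccont a n : admissible a -> ccont (fun t => forcing a t n).
Proof.
intros [Ha Hc]; apply ccont_plus; [apply Hc|]; intros t.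
apply (conv_pow_filterlim r (2 * A) a (a t) k hr Ha (Ha t)); intros m.
exact (Hc m t).
Qed.

Lemma Cmod_RtoC_mult (x : R) (z : C) : Cmod (Cmult (RtoC x) z) = Rabs x * Cmod z.
Proof. rewrite Cmod_mult Cmod_R //. Qed.

Lemma primC2_le f t M : ccont f -> 0 <= t <= L -> 0 <= M ->
  (forall s, Cmod (f s) <= M) -> Cmod (primC (primC f) t) <= L ^ 2 * M.
Proof.
intros Hf Ht HM H.
apply Rle_trans with (t * (L * M)).
- apply primC_le; [apply primC_ccont, Hf|lra|]; intros s Hs.
  apply Rle_trans with (s * M).
  + apply primC_le; [exact Hf|lra|]; intros; apply H.
  + apply Rmult_le_compat_r; lra.
- replace (L ^ 2 * M) with (L * (L * M)) by ring.
  apply Rmult_le_compat_r; [apply Rmult_le_pos|]; lra.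
Qed.

(** The data take up half of the allowed bound 2A up to the factor 1 + L; the
    smallness of L leaves room for the forcing in the other half. *)
Lemma picard_admissible a : admissible a -> admissible (picard a).
Proof.
intros Ha; split.
- intros t n; unfold picard.
  pose proof (weight_pos r n) as Hw; pose proof kappa_ge0 as Hk.
  pose proof (clamp_in L t hL) as Ht; pose proof (theta_bound n) as Hth.
  assert (HM : 0 <= 2 * A * (1 + kappa) * weight r n).
  { apply Rmult_le_pos; [apply Rmult_le_pos; lra|lra]. }
  pose proof (primC2_le _ _ _ (forcing_ccont a n Ha) Ht HM
    (fun s => forcing_decays a Ha s n)) as H.
  eapply Rle_trans; [apply Cmod_triangle|]; rewrite Cmod_opp.
  eapply Rle_trans; [apply Rplus_le_compat_r, Cmod_triangle|].
  rewrite !Cmod_RtoC_mult !Rabs_pos_eq; [|lra|lra].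
  pose proof (hc n) as H1; pose proof (hd n) as H2.
  pose proof (Cmod_ge_0 (d n)).
  pose proof (Cmod_ge_0 (primC (primC (fun s : R => forcing a s n)) (clamp L t))).
  apply Rle_trans with (A * weight r n + L * (A * weight r n) +
    1 * (L ^ 2 * (2 * A * (1 + kappa) * weight r n))).
  + apply Rplus_le_compat; [apply Rplus_le_compat; [exact H1|]|];
      apply Rmult_le_compat; lra.
  + assert (A * weight r n * (L + 2 * L ^ 2 * (1 + kappa)) <=
      A * weight r n * 1) by (apply Rmult_le_compat_l; nra).
    lra.
- intros n; unfold picard.
  apply ccont_plus; [apply ccont_plus; [apply ccont_const|]|].
  + apply ccont_mult; [|apply ccont_const].
    apply ccont_RtoC, clamp_continuous.
  + apply ccont_ext with (fun t => Cmult (RtoC (- theta n))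
      (primC (primC (fun s => forcing a s n)) (clamp L t))).
    * intros t; rewrite RtoC_opp; ring.
    * apply ccont_mult; [apply ccont_const|].
      apply ccont_comp; [apply clamp_continuous|].
      apply primC_ccont, primC_ccont, forcing_ccont, Ha.
Qed.

(** The two time integrals supply L^2, which absorbs the Lipschitz constant
    of [forcing]. *)
Lemma picard_contracts a b de : admissible a -> admissible b ->
  (forall t, decays r de (fun n => Cminus (a t n) (b t n))) ->
  forall t, decays r (de / 2) (fun n => Cminus (picard a t n) (picard b t n)).
Proof.
intros Ha Hb Hd t n; unfold picard.
pose proof (forcing_ccont a n Ha) as Hfa.
pose proof (forcing_ccont b n Hb) as Hfb.
pose proof (decays_ge0 _ _ _ (Hd 0)) as Hde.
pose proof (weight_pos r n) as Hw; pose proof kappa_ge0 as Hk.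
pose proof (clamp_in L t hL) as Ht; pose proof (theta_bound n) as Hth.
set (Ja := primC (primC (fun s => forcing a s n)) (clamp L t)).
set (Jb := primC (primC (fun s => forcing b s n)) (clamp L t)).
replace (Cminus _ _) with (Cmult (RtoC (- theta n)) (Cminus Ja Jb))
  by (rewrite RtoC_opp; ring).
assert (HM : 0 <= INR k.+1 * kappa)
  by (apply Rmult_le_pos; [apply pos_INR|exact Hk]).
assert (HJ : Cmod (Cminus Ja Jb) <=
  L ^ 2 * (de * (1 + INR k.+1 * kappa) * weight r n)).
{ unfold Ja, Jb; rewrite primC_minus; [|apply primC_ccont; assumption..].
  rewrite (primC_ext _ _ _ (fun s => primC_minus _ _ s Hfa Hfb)).
  apply primC2_le.
  - apply ccont_ext with (fun t => Cplus (forcing a t n)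
      (Cmult (Copp (RtoC 1)) (forcing b t n))).
    + intros s; ring.
    + apply ccont_plus; [exact Hfa|].
      apply ccont_mult; [apply ccont_const|exact Hfb].
  - exact Ht.
  - apply Rmult_le_pos; [apply Rmult_le_pos|]; lra.
  - intros s; unfold forcing.
    replace (Cminus _ _) with (Cplus (Cminus (a s n) (b s n))
      (Cminus (conv_pow (a s) k n) (conv_pow (b s) k n))) by ring.
    eapply Rle_trans; [apply Cmod_triangle|].
    eapply Rle_trans; [apply Rplus_le_compat; [exact (Hd s n)|
      exact (conv_pow_lipschitz r (2 * A) de (a s) (b s) k hr
        (proj1 Ha s) (proj1 Hb s) (Hd s) n)]|].
    right; unfold kappa; ring. }
rewrite Cmod_RtoC_mult Rabs_Ropp Rabs_pos_eq; [|lra].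
apply Rle_trans with (1 * (L ^ 2 * (de * (1 + INR k.+1 * kappa) * weight r n))).
- apply Rmult_le_compat; [lra|apply Cmod_ge_0|lra|exact HJ].
- apply Rle_trans with
    (de * weight r n * (L ^ 2 * (1 + INR k.+1 * kappa))); [right; ring|].
  apply Rle_trans with (de * weight r n * (1 / 2)); [|right; field].
  apply Rmult_le_compat_l; [apply Rmult_le_pos; lra|exact hL1].
Qed.

Fixpoint picard_iterate (j : nat) : R -> lattice nu -> C :=
  match j with
  | O => fun _ _ => RtoC 0
  | S j => picard (picard_iterate j)
  end.

Lemma picard_iterate_admissible j : admissible (picard_iterate j).
Proof.
induction j as [|j IH]; [|apply picard_admissible, IH].
split.
- intros t n; simpl; rewrite Cmod_0; pose proof (weight_pos r n); nra.
- intros n; exact (ccont_const (RtoC 0)).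
Qed.

Lemma picard_iterate_step j t :
  decays r (2 * A / 2 ^ j) (fun n => Cminus (picard_iterate j.+1 t n) (picard_iterate j t n)).
Proof.
revert t; induction j as [|j IH]; intros t n.
- simpl (picard_iterate 0 t n); replace (Cminus (picard_iterate 1 t n) (RtoC 0))
    with (picard_iterate 1 t n) by ring.
  replace (2 * A / 2 ^ 0) with (2 * A) by (simpl; field).
  apply (picard_iterate_admissible 1).
- replace (2 * A / 2 ^ j.+1) with (2 * A / 2 ^ j / 2)
    by (simpl; field; apply pow_nonzero; lra).
  apply (picard_contracts (picard_iterate j.+1) (picard_iterate j));
    auto using picard_iterate_admissible.
Qed.

Lemma picard_iterate_cauchy i j t :
  decays r (4 * A / 2 ^ j)
    (fun n => Cminus (picard_iterate (i + j) t n) (picard_iterate j t n)).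
Proof.
intros n.
assert (H : Cmod (Cminus (picard_iterate (i + j) t n) (picard_iterate j t n)) <=
  (4 * A / 2 ^ j - 4 * A / 2 ^ (i + j)) * weight r n).
{ induction i as [|i IH].
  - rewrite add0n.
    replace (Cminus (picard_iterate j t n) (picard_iterate j t n)) with (RtoC 0) by ring.
    rewrite Cmod_0; right; ring.
  - replace (Cminus (picard_iterate (i.+1 + j) t n) (picard_iterate j t n)) with
      (Cplus (Cminus (picard_iterate (i + j).+1 t n) (picard_iterate (i + j) t n))
        (Cminus (picard_iterate (i + j) t n) (picard_iterate j t n)))
      by (rewrite addSn; ring).
    eapply Rle_trans; [apply Cmod_triangle|].
    pose proof (picard_iterate_step (i + j) t n) as Hs.
    assert (E : 4 * A / 2 ^ (i.+1 + j) = 2 * A / 2 ^ (i + j))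
      by (rewrite addSn; simpl; field; apply pow_nonzero; lra).
    assert (E2 : 4 * A / 2 ^ (i + j) = 2 * A / 2 ^ (i + j) + 2 * A / 2 ^ (i + j))
      by (field; apply pow_nonzero; lra).
    rewrite E; simpl in Hs |- *; rewrite E2 in IH; lra. }
eapply Rle_trans; [exact H|].
apply Rmult_le_compat_r; [left; apply weight_pos|].
assert (0 < 4 * A / 2 ^ (i + j)); [|lra].
apply Rdiv_lt_0_compat; [lra|apply pow_lt; lra].
Qed.

Lemma geometric_small (M eps : R) : 0 < eps -> 0 <= M ->
  exists j : nat, M / 2 ^ j < eps.
Proof.
intros He HM.
destruct (pow_lt_1_zero (/ 2)) with (y := eps / (M + 1)) as [N HN].
- rewrite Rabs_pos_eq; lra.
- apply Rdiv_lt_0_compat; lra.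
- exists N; specialize (HN N (le_n N)).
  rewrite Rabs_pos_eq in HN; [|apply pow_le; lra].
  rewrite pow_inv in HN.
  assert (Hp : 0 < / 2 ^ N) by (apply Rinv_0_lt_compat, pow_lt; lra).
  assert (/ 2 ^ N * (M + 1) < eps).
  { apply Rlt_div_r; lra. }
  unfold Rdiv; nra.
Qed.

(** The iterates converge uniformly at geometric rate, relative to the weight;
    the limit is taken separately for each t and n. *)
Definition picard_limit t n : C :=
  iota (fun z : CV =>
    filterlim (fun j => picard_iterate j t n : CV) eventually (locally z)).

Lemma picard_limit_spec t n :
  filterlim (fun j => picard_iterate j t n : CV) eventually (locally (picard_limit t n : CV)).
Proof.
assert (Hex : exists z : CV,
  filterlim (fun j => picard_iterate j t n : CV) eventually (locally z)).
{ apply (proj1 (filterlim_locally_cauchy (U := CV) (F := eventually)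
    (fun j => picard_iterate j t n))).
  intros eps.
  destruct (geometric_small (4 * A * weight r n) (eps / 2)) as [N HN].
  { destruct eps; simpl; lra. }
  { pose proof (weight_pos r n); nra. }
  assert (HN' : forall j, (N <= j)%coq_nat ->
    Cmod (Cminus (picard_iterate j t n) (picard_iterate N t n)) < eps / 2).
  { intros j Hj.
    replace j with ((j - N)%coq_nat + N)%nat
      by (rewrite -plusE; apply PeanoNat.Nat.sub_add, Hj).
    eapply Rle_lt_trans; [apply picard_iterate_cauchy|].
    eapply Rle_lt_trans; [|exact HN]; right; unfold Rdiv; ring. }
  exists (fun j => (N <= j)%coq_nat); split; [exists N; auto|].
  intros i j Hi Hj; apply: norm_compat1.
  change (norm (V := CV) (Cminus (picard_iterate j t n) (picard_iterate i t n)) < eps).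
  rewrite norm_CV.
  replace (Cminus (picard_iterate j t n) (picard_iterate i t n)) with
    (Cplus (Cminus (picard_iterate j t n) (picard_iterate N t n))
      (Copp (Cminus (picard_iterate i t n) (picard_iterate N t n)))) by ring.
  eapply Rle_lt_trans; [apply Cmod_triangle|]; rewrite Cmod_opp.
  pose proof (HN' i Hi); pose proof (HN' j Hj); lra. }
destruct Hex as [z Hz].
unfold picard_limit; rewrite (iota_filterlim_locally _ _ Hz); exact Hz.
Qed.

Lemma picard_limit_rate j t :
  decays r (4 * A / 2 ^ j) (fun n => Cminus (picard_limit t n) (picard_iterate j t n)).
Proof.
intros n; rewrite -norm_CV.
apply (filterlim_norm_le (V := CV) _ _ (picard_iterate j t n) _ (picard_limit_spec t n)).
exists j; intros i Hi.
replace i with ((i - j)%coq_nat + j)%nat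
  by (rewrite -plusE; apply PeanoNat.Nat.sub_add, Hi).
rewrite norm_CV; apply picard_iterate_cauchy.
Qed.

Lemma picard_limit_admissible : admissible picard_limit.
Proof.
split.
- intros t n; rewrite -norm_CV -(minus_zero (V := CV) (picard_limit t n)).
  apply (filterlim_norm_le (V := CV) _ _ _ _ (picard_limit_spec t n)).
  apply filter_forall; intros j; rewrite (minus_zero (V := CV)) norm_CV.
  apply picard_iterate_admissible.
- intros n t; apply filterlim_CVP; intros [eps He]; simpl.
  destruct (geometric_small (4 * A * weight r n) (eps / 3)) as [N HN].
  { lra. }
  { pose proof (weight_pos r n); nra. }
  assert (HN' : forall s,
    Cmod (Cminus (picard_limit s n) (picard_iterate N s n)) < eps / 3).
  { intros s; eapply Rle_lt_trans; [apply picard_limit_rate|].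
    eapply Rle_lt_trans; [|exact HN]; right; unfold Rdiv; ring. }
  assert (He3 : 0 < eps / 3) by lra.
  pose proof (proj1 (filterlim_CVP _ _)
    (proj2 (picard_iterate_admissible N) n t) (mkposreal _ He3)) as H.
  apply: filter_imp H => s Hs; simpl in Hs.
  replace (Cminus (picard_limit s n) (picard_limit t n)) with
    (Cplus (Cminus (picard_limit s n) (picard_iterate N s n))
      (Cplus (Cminus (picard_iterate N s n) (picard_iterate N t n))
        (Copp (Cminus (picard_limit t n) (picard_iterate N t n))))) by ring.
  eapply Rle_lt_trans; [apply Cmod_triangle|].
  eapply Rle_lt_trans; [apply Rplus_le_compat_l, Cmod_triangle|].
  rewrite Cmod_opp.
  pose proof (HN' s); pose proof (HN' t); lra.
Qed.

Lemma picard_limit_fixed t n : picard_limit t n = picard picard_limit t n.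
Proof.
assert (H : forall j, Cmod (Cminus (picard_limit t n) (picard picard_limit t n)) <=
  4 * A * weight r n / 2 ^ j).
{ intros j.
  replace (Cminus (picard_limit t n) (picard picard_limit t n)) with
    (Cplus (Cminus (picard_limit t n) (picard_iterate j.+1 t n))
      (Copp (Cminus (picard picard_limit t n) (picard (picard_iterate j) t n))))
    by (simpl; ring).
  eapply Rle_trans; [apply Cmod_triangle|]; rewrite Cmod_opp.
  pose proof (picard_limit_rate j.+1 t n) as H1.
  pose proof (picard_contracts _ _ _ picard_limit_admissible (picard_iterate_admissible j)
    (picard_limit_rate j) t n) as H2.
  eapply Rle_trans; [apply Rplus_le_compat; [exact H1|exact H2]|].
  right; simpl; field; apply pow_nonzero; lra. }
assert (E : Cmod (Cminus (picard_limit t n) (picard picard_limit t n)) = 0).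
{ apply Rle_antisym; [|apply Cmod_ge_0].
  apply Rnot_lt_le; intros Hlt.
  destruct (geometric_small (4 * A * weight r n) _ Hlt) as [j Hj].
  - pose proof (weight_pos r n); nra.
  - specialize (H j); lra. }
apply Cmod_eq_0 in E.
replace (picard_limit t n) with (Cplus (Cminus (picard_limit t n) (picard picard_limit t n))
  (picard picard_limit t n)) by ring.
rewrite E; ring.
Qed.

End Picard.

(** * Termwise differentiation *)

Lemma Cmod_le_add z : Cmod z <= Rabs (fst z) + Rabs (snd z).
Proof.
destruct z as [x y]; simpl.
replace (x, y) with (Cplus (RtoC x) (Cmult Ci (RtoC y)))
  by (unfold Cplus, Cmult, Ci, RtoC; simpl; f_equal; ring).
eapply Rle_trans; [apply Cmod_triangle|].
rewrite Cmod_mult !Cmod_R Cmod_Ci Rmult_1_l; apply Rle_refl.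
Qed.

Lemma Cmod_imaginary (y : R) : Cmod (0, y) = Rabs y.
Proof. rewrite -Cmod_R; unfold Cmod, RtoC; simpl; f_equal; ring. Qed.

(** Epsilon form of differentiability, for any filter finer than the
    neighbourhoods of t0: it serves for two-sided derivatives in x and for
    derivatives within [0, L] in t. *)
Lemma filterdiff_CP {F : (R -> Prop) -> Prop} {FF : ProperFilter F}
    (f : R -> C) (t0 : R) (l : C) :
  (forall P, locally t0 P -> F P) ->
  filterdiff (U := R_NormedModule) (V := C_R_NormedModule) f F
    (fun s : R => scal s (l : C_R_NormedModule)) <->
  (forall eps : posreal, F (fun s =>
     Cmod (Cminus (Cminus (f s) (f t0)) (Cmult (RtoC (s - t0)) l)) <=
     eps * Rabs (s - t0))).
Proof.
intros HF; split.
- intros [_ H] eps; specialize (H t0 HF eps).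
  apply: filter_imp H => s Hs.
  rewrite -scal_CV -norm_CV; exact Hs.
- intros H; split; [exact (is_linear_scal_l (V := C_R_NormedModule) l)|]; intros x Hx eps.
  assert (E : x = t0).
  { apply (is_filter_lim_unique (K := R_AbsRing) (V := R_NormedModule) (F := F));
      [exact Hx|exact HF]. }
  subst x; apply: filter_imp (H eps) => s.
  rewrite -scal_CV -norm_CV; exact id.
Qed.

(** Dominated convergence for the difference quotients, which are extended by
    the derivative to the base point so that no punctured filter is needed. *)
Lemma Sum_filterdiff {I : Type} {F : (R -> Prop) -> Prop} {FF : ProperFilter F}
    (t0 : R) (f : R -> I -> C) (f' : I -> C) (g : I -> R) :
  (forall P, locally t0 P -> F P) -> summable g ->
  (forall i, filterdiff (U := R_NormedModule) (V := C_R_NormedModule)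
     (fun s => f s i) F (fun s : R => scal s (f' i : C_R_NormedModule))) ->
  (forall i, Cmod (f' i) <= g i) ->
  F (fun s => forall i, Cmod (Cminus (f s i) (f t0 i)) <= g i * Rabs (s - t0)) ->
  F (fun s => is_sum (V := CV) (f s) (Sum (V := CV) (f s))) ->
  is_sum (V := CV) (f t0) (Sum (V := CV) (f t0)) ->
  filterdiff (U := R_NormedModule) (V := C_R_NormedModule)
    (fun s => Sum (V := CV) (f s)) F
    (fun s : R => scal s (Sum (V := CV) f' : C_R_NormedModule)).
Proof.
intros HF Hg Hf Hf' Hlip Hs Hs0.
set (phi := fun s i => if Req_EM_T s t0 then f' i
  else Cmult (RtoC (/ (s - t0))) (Cminus (f s i) (f t0 i))).
assert (phi_eq : forall s i, s = t0 -> phi s i = f' i).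
{ intros s i E; unfold phi; destruct (Req_EM_T s t0); [reflexivity|].
  contradiction. }
assert (phi_ne : forall s i, s <> t0 -> phi s i =
  Cmult (RtoC (/ (s - t0))) (Cminus (f s i) (f t0 i))).
{ intros s i E; unfold phi; destruct (Req_EM_T s t0); [contradiction|].
  reflexivity. }
assert (Hphi : filterlim (fun s => Sum (V := CV) (phi s)) F
  (locally (Sum (V := CV) f' : CV))).
{ apply (Sum_dominated_convergence (V := CV) phi f' g Hg).
  - apply: filter_imp Hlip => s H i; rewrite norm_CV.
    destruct (Req_EM_T s t0) as [E|E]; [rewrite (phi_eq s i E); apply Hf'|].
    rewrite (phi_ne s i E).
    assert (Hst : s - t0 <> 0) by lra.
    rewrite Cmod_mult Cmod_R Rabs_inv Rmult_comm.
    pose proof (Rabs_pos_lt _ Hst).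
    apply Rle_div_l; [assumption|apply H].
  - intros i; apply filterlim_CVP; intros eps.
    assert (He : 0 < eps / 2) by (destruct eps; simpl; lra).
    pose proof (proj1 (filterdiff_CP _ _ _ HF) (Hf i) (mkposreal _ He)) as H.
    apply: filter_imp H => s; simpl; intros H.
    destruct (Req_EM_T s t0) as [E|E].
    + rewrite (phi_eq s i E); replace (Cminus (f' i) (f' i)) with (RtoC 0) by ring.
      rewrite Cmod_0; apply cond_pos.
    + rewrite (phi_ne s i E); assert (Hst : s - t0 <> 0) by lra.
      replace (Cminus _ (f' i)) with (Cmult (RtoC (/ (s - t0)))
        (Cminus (Cminus (f s i) (f t0 i)) (Cmult (RtoC (s - t0)) (f' i)))).
      2: { rewrite RtoC_inv; [|exact Hst].
           field; intros Hc; apply Hst, RtoC_inj, Hc. }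
      rewrite Cmod_mult Cmod_R Rabs_inv Rmult_comm.
      pose proof (Rabs_pos_lt _ Hst).
      apply Rle_lt_trans with (eps / 2); [|lra].
      apply Rle_div_l; assumption. }
apply (proj2 (filterdiff_CP (fun s => Sum (V := CV) (f s)) t0
  (Sum (V := CV) f') HF)); intros eps.
pose proof (proj1 (filterlim_CVP _ _) Hphi eps) as H.
apply: filter_imp (filter_and _ _ H Hs) => s [H1 H2].
destruct (Req_EM_T s t0) as [E|E].
- subst s; rewrite Rminus_diag Rabs_R0 Rmult_0_r.
  replace (Cminus _ _) with (RtoC 0) by ring.
  rewrite Cmod_0; apply Rle_refl.
- assert (Hst : s - t0 <> 0) by lra.
  assert (E2 : Sum (V := CV) (phi s) = Cmult (RtoC (/ (s - t0)))
    (Cminus (Sum (V := CV) (f s)) (Sum (V := CV) (f t0)))).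
  { apply (is_sum_Sum (V := CV)).
    pose proof (is_sum_plus (V := C_R_NormedModule) _ _ _ _ H2
      (is_sum_Cmult (-1)%C _ _ Hs0)) as H3.
    pose proof (is_sum_Cmult (RtoC (/ (s - t0))) _ _ H3) as H4.
    replace (Cminus (Sum (V := CV) (f s)) (Sum (V := CV) (f t0))) with
      (Cplus (Sum (V := CV) (f s)) (Cmult (-1)%C (Sum (V := CV) (f t0)))) by ring.
    eapply is_sum_ext; [|exact H4]; intros i; rewrite (phi_ne s i E).
    change (Cmult (RtoC (/ (s - t0))) (Cplus (f s i) (Cmult (-1)%C (f t0 i))) =
      Cmult (RtoC (/ (s - t0))) (Cminus (f s i) (f t0 i))); ring. }
  rewrite E2 in H1.
  replace (Cminus _ _) with (Cmult (RtoC (s - t0))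
    (Cminus (Cmult (RtoC (/ (s - t0)))
      (Cminus (Sum (V := CV) (f s)) (Sum (V := CV) (f t0))))
      (Sum (V := CV) f'))).
  2: { rewrite RtoC_inv; [|exact Hst].
       field; intros Hc; apply Hst, RtoC_inj, Hc. }
  rewrite Cmod_mult Cmod_R Rmult_comm.
  apply Rmult_le_compat_r; [apply Rabs_pos|lra].
Qed.

Lemma is_derive_expi (mu x : R) :
  is_derive (V := C_R_NormedModule) (fun y => expi (mu * y)) x
    (Cmult (0, mu) (expi (mu * x))).
Proof.
apply (proj2 (filterdiff_CP (F := locally x) _ x _ (fun P HP => HP))); intros eps.
assert (He : 0 < eps / 2) by (destruct eps; simpl; lra).
assert (Hc : is_derive (fun y => cos (mu * y)) x (- mu * sin (mu * x)))
  by (auto_derive; [auto|ring]).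
assert (Hs : is_derive (fun y => sin (mu * y)) x (mu * cos (mu * x)))
  by (auto_derive; [auto|ring]).
pose proof (proj2 Hc x (fun P HP => HP) (mkposreal _ He)) as H1.
pose proof (proj2 Hs x (fun P HP => HP) (mkposreal _ He)) as H2.
apply: filter_imp (filter_and _ _ H1 H2) => y [H3 H4].
change (Rabs (cos (mu * y) - cos (mu * x) - (y - x) * (- mu * sin (mu * x))) <=
  eps / 2 * Rabs (y - x)) in H3.
change (Rabs (sin (mu * y) - sin (mu * x) - (y - x) * (mu * cos (mu * x))) <=
  eps / 2 * Rabs (y - x)) in H4.
eapply Rle_trans; [apply Cmod_le_add|].
replace (fst _) with
  (cos (mu * y) - cos (mu * x) - (y - x) * (- mu * sin (mu * x)))
  by (simpl; ring).
replace (snd _) with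
  (sin (mu * y) - sin (mu * x) - (y - x) * (mu * cos (mu * x)))
  by (simpl; ring).
lra.
Qed.

Lemma expi_lipschitz (mu x y : R) :
  Cmod (Cminus (expi (mu * y)) (expi (mu * x))) <= 2 * Rabs mu * Rabs (y - x).
Proof.
eapply Rle_trans; [apply Cmod_le_add|]; simpl.
assert (Hmvt : forall f f' : R -> R, (forall z, is_derive f z (f' z)) ->
  (forall z, Rabs (f' z) <= 1) ->
  Rabs (f (mu * y) + - f (mu * x)) <= Rabs mu * Rabs (y - x)).
{ intros f f' Hf Hf'.
  destruct (MVT_gen f (mu * x) (mu * y) f') as [z [_ Hz]].
  - intros; apply Hf.
  - intros; apply derivable_continuous_pt.
    exists (f' x0); apply is_derive_Reals, Hf.
  - change (f (mu * y) + - f (mu * x)) with (f (mu * y) - f (mu * x)).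
    rewrite Hz Rabs_mult -Rabs_mult -(Rmult_1_l (Rabs mu * _)) -Rabs_mult.
    replace (mu * (y - x)) with (mu * y - mu * x) by ring.
    rewrite Rabs_mult; apply Rmult_le_compat_r; [apply Rabs_pos|apply Hf']. }
pose proof (Hmvt cos (fun z => - sin z)
  (fun z => ltac:(auto_derive; [auto|ring]))
  (fun z => ltac:(rewrite Rabs_Ropp; apply Rabs_le, SIN_bound))).
pose proof (Hmvt sin cos
  (fun z => ltac:(auto_derive; [auto|ring]))
  (fun z => ltac:(apply Rabs_le, COS_bound))).
lra.
Qed.

Lemma within_proper {U : UniformSpace} (D : U -> Prop) (x : U) :
  D x -> ProperFilter (within D (locally x)).
Proof.
intros Hx; constructor.
- intros P HP; exists x; exact (locally_singleton _ _ HP Hx).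
- apply within_filter, locally_filter.
Qed.

Lemma locally_within {U : UniformSpace} (D : U -> Prop) (x : U) P :
  locally x P -> within D (locally x) P.
Proof. apply: filter_imp => y Hy _; exact Hy. Qed.

Section QPSeries.
Context {nu : nat} (omega : 'I_nu -> R).
Implicit Types (b : R -> lattice nu -> C) (n : lattice nu).

Definition qps b (t x : R) : C :=
  Sum (V := CV) (fun n => Cmult (b t n) (expi (pairing n omega * x))).

Lemma weight_scal_summable (r B : R) : INR nu < r -> 0 <= B ->
  summable (fun n => B * weight r n).
Proof. intros Hr HB; apply summable_scal, weight_summable; assumption. Qed.

Lemma qps_is_qp_series (r B : R) b t x : INR nu < r -> decays r B (b t) ->
  is_qp_series omega (b t) x (qps b t x).
Proof.
intros Hr Hb; apply (is_sum_dominated (V := CV) _ (fun n => B * weight r n)).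
- intros n; rewrite norm_CV Cmod_mult Cmod_expi Rmult_1_r; apply Hb.
- apply weight_scal_summable; [exact Hr|exact (decays_ge0 _ _ _ Hb)].
Qed.

Lemma qps_continuous_strip (r B L : R) b : INR nu < r ->
  (forall t, decays r B (b t)) -> (forall n, ccont (fun t => b t n)) ->
  continuous_strip L (qps b).
Proof.
intros Hr Hb Hc [t x] Htx.
pose proof (within_proper (U := prod_UniformSpace R_UniformSpace R_UniformSpace)
  (fun z : R * R => 0 <= fst z <= L) (t, x) Htx) as FF.
apply (Sum_dominated_convergence (V := CV)
  (fun z n => Cmult (b (fst z) n) (expi (pairing n omega * snd z))) _
  (fun n => B * weight r n)).
- apply weight_scal_summable; [exact Hr|exact (decays_ge0 _ _ _ (Hb 0))].
- apply filter_forall; intros z n.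
  rewrite norm_CV Cmod_mult Cmod_expi Rmult_1_r; apply Hb.
- intros n; apply filterlim_Cmult.
  + eapply filterlim_filter_le_1; [intros P; apply locally_within|].
    apply (filterlim_comp _ _ _ (fun z : R * R => fst z) (fun s => b s n : CV) _
      (locally t)); [|exact (Hc n t)].
    exact (continuous_fst (U := R_UniformSpace) (V := R_UniformSpace) t x).
  + eapply filterlim_filter_le_1; [intros P; apply locally_within|].
    apply (filterlim_comp _ _ _ (fun z : R * R => snd z)
      (fun y => expi (pairing n omega * y) : CV) _ (locally x)).
    * exact (continuous_snd (U := R_UniformSpace) (V := R_UniformSpace) t x).
    * change (continuous (fun y => expi (pairing n omega * y) : CV) x).
      apply (ex_derive_continuous (V := C_R_NormedModule)).
      eexists; apply is_derive_expi.
Qed.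

(** Coefficients of the first and of the second x-derivative. *)
Definition dx_coef b t n : C := Cmult (0, pairing n omega) (b t n).
Definition dxx_coef b t n : C := Cmult (RtoC (- pairing n omega ^ 2)) (b t n).

Lemma qps_partial_x (r B L : R) b : INR nu < r ->
  (forall t, decays r B (b t)) -> (forall t, decays r B (dx_coef b t)) ->
  is_partial_x L (qps b) (qps (dx_coef b)).
Proof.
intros Hr Hb Hmu t x _.
pose proof (decays_ge0 _ _ _ (Hb 0)) as HB.
assert (E : qps (dx_coef b) t x = Sum (V := CV) (fun n =>
  Cmult (b t n) (Cmult (0, pairing n omega) (expi (pairing n omega * x))))).
{ apply (Sum_ext (V := CV)); intros n.
  change (Cmult (dx_coef b t n) (expi (pairing n omega * x)) =
    Cmult (b t n) (Cmult (0, pairing n omega) (expi (pairing n omega * x)))).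
  unfold dx_coef; ring. }
rewrite E.
apply (Sum_filterdiff (F := locally x) x
  (fun y n => Cmult (b t n) (expi (pairing n omega * y))) _
  (fun n => (2 * B) * weight r n)); [auto|..].
- apply weight_scal_summable; [exact Hr|lra].
- intros n.
  apply (proj2 (filterdiff_CP (F := locally x) _ x _ (fun P HP => HP))); intros eps.
  assert (Hp : 0 < Cmod (b t n) + 1) by (pose proof (Cmod_ge_0 (b t n)); lra).
  assert (He : 0 < eps / (Cmod (b t n) + 1)).
  { apply Rdiv_lt_0_compat; [apply cond_pos|exact Hp]. }
  pose proof (proj1 (filterdiff_CP (F := locally x) _ _ _ (fun P HP => HP))
    (is_derive_expi (pairing n omega) x) (mkposreal _ He)) as H.
  apply: filter_imp H => y; simpl; intros H.
  replace (Cminus _ _) with (Cmult (b t n)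
    (Cminus (Cminus (expi (pairing n omega * y)) (expi (pairing n omega * x)))
      (Cmult (RtoC (y - x)) (Cmult (0, pairing n omega)
        (expi (pairing n omega * x)))))) by ring.
  rewrite Cmod_mult.
  apply Rle_trans with ((Cmod (b t n) + 1) *
    (eps / (Cmod (b t n) + 1) * Rabs (y - x))).
  + apply Rmult_le_compat; [apply Cmod_ge_0|apply Cmod_ge_0|lra|exact H].
  + right; field; lra.
- intros n; rewrite Cmod_mult Cmod_mult Cmod_expi Rmult_1_r.
  pose proof (Hmu t n) as H; unfold dx_coef in H; rewrite Cmod_mult in H.
  pose proof (weight_pos r n); nra.
- apply filter_forall; intros y n.
  replace (Cminus _ _) with (Cmult (b t n)
    (Cminus (expi (pairing n omega * y)) (expi (pairing n omega * x)))) by ring.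
  rewrite Cmod_mult.
  pose proof (expi_lipschitz (pairing n omega) x y) as H1.
  pose proof (Hmu t n) as H2; unfold dx_coef in H2; rewrite Cmod_mult in H2.
  rewrite Cmod_imaginary in H2.
  eapply Rle_trans; [apply Rmult_le_compat_l; [apply Cmod_ge_0|exact H1]|].
  pose proof (Rabs_pos (y - x)).
  replace (Cmod (b t n) * (2 * Rabs (pairing n omega) * Rabs (y - x))) with
    (2 * (Rabs (pairing n omega) * Cmod (b t n)) * Rabs (y - x)) by ring.
  apply Rmult_le_compat_r; [assumption|lra].
- apply filter_forall; intros y; exact (qps_is_qp_series r B b t y Hr (Hb t)).
- exact (qps_is_qp_series r B b t x Hr (Hb t)).
Qed.

(** The Lipschitz bound dominates the difference quotients of the series by a
    summable family. *)
Definition coef_derivative (r B L : R) b b' : Prop :=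
  (forall t n, 0 <= t <= L ->
    filterdiff (U := R_NormedModule) (V := C_R_NormedModule)
      (fun s : R => b s n) (within (fun s : R => 0 <= s <= L) (locally t))
      (fun s : R => scal s (b' t n : C_R_NormedModule))) /\
  (forall s t n, 0 <= s <= L -> 0 <= t <= L ->
    Cmod (Cminus (b s n) (b t n)) <= B * weight r n * Rabs (s - t)).

Lemma qps_partial_t (r B L : R) b b' : INR nu < r ->
  (forall t, decays r B (b t)) -> (forall t, decays r B (b' t)) ->
  coef_derivative r B L b b' -> is_partial_t L (qps b) (qps b').
Proof.
intros Hr Hb Hb' [Hd Hl] t x Ht.
pose proof (decays_ge0 _ _ _ (Hb 0)) as HB.
pose proof (within_proper (U := R_UniformSpace)
  (fun s : R => 0 <= s <= L) t Ht) as FF.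
assert (HF : forall P, locally t P ->
  within (fun s : R => 0 <= s <= L) (locally t) P)
  by (intros P; apply locally_within).
apply (Sum_filterdiff t
  (fun s n => Cmult (b s n) (expi (pairing n omega * x))) _
  (fun n => B * weight r n) HF).
- apply weight_scal_summable; assumption.
- intros n.
  apply (proj2 (filterdiff_CP _ t _ HF)); intros eps.
  pose proof (proj1 (filterdiff_CP _ _ _ HF) (Hd t n Ht) eps) as H.
  apply: filter_imp H => s H.
  replace (Cminus _ _) with (Cmult (expi (pairing n omega * x))
    (Cminus (Cminus (b s n) (b t n)) (Cmult (RtoC (s - t)) (b' t n)))) by ring.
  rewrite Cmod_mult Cmod_expi Rmult_1_l; exact H.
- intros n; rewrite Cmod_mult Cmod_expi Rmult_1_r; apply Hb'.
- unfold within; apply filter_forall; intros s Hs n.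
  replace (Cminus _ _) with (Cmult (expi (pairing n omega * x))
    (Cminus (b s n) (b t n))) by ring.
  rewrite Cmod_mult Cmod_expi Rmult_1_l; apply Hl; assumption.
- apply filter_forall; intros s; exact (qps_is_qp_series r B b s x Hr (Hb s)).
- exact (qps_is_qp_series r B b t x Hr (Hb t)).
Qed.

Lemma coef_derivative_dxx (r B B' L : R) b b' : INR nu < r ->
  (forall n, pairing n omega ^ 2 * (B * weight r n) <= B' * weight (r - 2) n) ->
  coef_derivative r B L b b' ->
  coef_derivative (r - 2) B' L (dxx_coef b) (dxx_coef b').
Proof.
intros Hr HW [Hd Hl]; split.
- intros t n Ht.
  pose proof (within_proper (U := R_UniformSpace)
    (fun s : R => 0 <= s <= L) t Ht) as FF.
  assert (HF : forall P, locally t P ->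
    within (fun s : R => 0 <= s <= L) (locally t) P)
    by (intros P; apply locally_within).
  apply (proj2 (filterdiff_CP _ t _ HF)); intros eps.
  set (M := Cmod (RtoC (- pairing n omega ^ 2))).
  assert (Hp : 0 < M + 1).
  { pose proof (Cmod_ge_0 (RtoC (- pairing n omega ^ 2))); unfold M; lra. }
  assert (He : 0 < eps / (M + 1)).
  { apply Rdiv_lt_0_compat; [apply cond_pos|exact Hp]. }
  pose proof (proj1 (filterdiff_CP _ _ _ HF) (Hd t n Ht) (mkposreal _ He)) as H.
  apply: filter_imp H => s; simpl; intros H; unfold dxx_coef.
  replace (Cminus _ _) with (Cmult (RtoC (- pairing n omega ^ 2))
    (Cminus (Cminus (b s n) (b t n)) (Cmult (RtoC (s - t)) (b' t n)))) by ring.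
  rewrite Cmod_mult; fold M.
  apply Rle_trans with ((M + 1) * (eps / (M + 1) * Rabs (s - t))).
  + apply Rmult_le_compat; [apply Cmod_ge_0|apply Cmod_ge_0|lra|exact H].
  + right; field; lra.
- intros s t n Hs Ht; unfold dxx_coef.
  replace (Cminus _ _) with (Cmult (RtoC (- pairing n omega ^ 2))
    (Cminus (b s n) (b t n))) by ring.
  rewrite Cmod_mult Cmod_R Rabs_Ropp Rabs_pos_eq; [|apply pow2_ge_0].
  eapply Rle_trans;
    [apply Rmult_le_compat_l; [apply pow2_ge_0|apply (Hl s t n Hs Ht)]|].
  rewrite -Rmult_assoc.
  apply Rmult_le_compat_r; [apply Rabs_pos|apply HW].
Qed.

End QPSeries.

(** * Existence *)

Lemma decays_le {nu : nat} (r al be : R) (a : lattice nu -> C) :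
  al <= be -> decays r al a -> decays r be a.
Proof.
intros H Ha n; eapply Rle_trans; [apply Ha|].
apply Rmult_le_compat_r; [left; apply weight_pos|exact H].
Qed.

Lemma decays_weaken {nu : nat} (r s al : R) (a : lattice nu -> C) :
  s <= r -> decays r al a -> decays s al a.
Proof.
intros H Ha n; eapply Rle_trans; [apply Ha|].
apply Rmult_le_compat_l; [exact (decays_ge0 _ _ _ Ha)|apply weight_mono, H].
Qed.

(** The increments of G are - th times those of the primitive of f; since th
    is at most 1, differentiability of the primitive is inherited. *)
Lemma filterdiff_primC (L th t : R) (f G : R -> C) (l : C) :
  ccont f -> 0 <= th <= 1 -> 0 <= t <= L ->
  (forall s, 0 <= s <= L ->
    Cminus (Cminus (G s) (G t)) (Cmult (RtoC (s - t)) l) =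
    Copp (Cmult (RtoC th)
      (Cminus (Cminus (primC f s) (primC f t)) (Cmult (RtoC (s - t)) (f t))))) ->
  filterdiff (U := R_NormedModule) (V := C_R_NormedModule) G
    (within (fun s : R => 0 <= s <= L) (locally t))
    (fun s : R => scal s (l : C_R_NormedModule)).
Proof.
intros Hf Hth Ht HG.
pose proof (within_proper (U := R_UniformSpace)
  (fun s : R => 0 <= s <= L) t Ht) as FF.
assert (HF : forall P, locally t P ->
  within (fun s : R => 0 <= s <= L) (locally t) P)
  by (intros P; apply locally_within).
apply (proj2 (filterdiff_CP _ t _ HF)); intros eps.
pose proof (proj1 (filterdiff_CP (F := locally t) _ _ _ (fun P HP => HP))
  (primC_is_derive f t Hf) eps) as H.
unfold within; apply: filter_imp H => s H Hs.
rewrite (HG s Hs) Cmod_opp Cmod_mult Cmod_R Rabs_pos_eq; [|lra].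
pose proof (Cmod_ge_0 (Cminus (Cminus (primC f s) (primC f t))
  (Cmult (RtoC (s - t)) (f t)))).
nra.
Qed.

Lemma primC_0 f : primC f 0 = RtoC 0.
Proof. exact (RInt_point (V := CV) 0 f). Qed.

Section Existence.
Context {nu : nat} (omega : 'I_nu -> R) (c d : lattice nu -> C).
Context (k : nat) (A r L : R).
Hypothesis (hr : INR nu + 2 < r) (hL : 0 <= L) (hA : 0 < A).
Hypothesis (hc : decays r A c) (hd : decays r A d).
Let kappa := (2 * A * Kconst r nu) ^ k.
Hypothesis (hL1 : L ^ 2 * (1 + INR k.+1 * kappa) <= 1 / 2).
Hypothesis (hL2 : L + 2 * L ^ 2 * (1 + kappa) <= 1).

Let uhat := picard_limit omega c d k L.
Let th := theta omega.
Let force := fun t n => forcing k uhat t n.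
Let uhat_t := fun t n => Cminus (d n)
  (Cmult (RtoC (th n)) (primC (fun s => force s n) (clamp L t))).
Let uhat_tt := fun t n => Copp (Cmult (RtoC (th n)) (force t n)).
Let power := fun t => conv_pow (uhat t) k.

Let Q := 2 * A * (1 + kappa).
Let B := 3 * A + L * Q + Q.

Let hr0 : INR nu < r. Proof. lra. Qed.
Let hr2 : INR nu < r - 2. Proof. lra. Qed.

Let kappa0 : 0 <= kappa := kappa_ge0 (nu := nu) k A r hr0 hA.

Let Q0 : 0 <= Q. Proof. apply Rmult_le_pos; lra. Qed.
Let LQ0 : 0 <= L * Q. Proof. apply Rmult_le_pos; [exact hL|exact Q0]. Qed.

Lemma uhat_admissible : admissible A r uhat.
Proof. exact (picard_limit_admissible omega c d k A r L hr0 hL hA hc hd hL1 hL2). Qed.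

Lemma uhat_fixed t n : uhat t n = picard omega c d k L uhat t n.
Proof. exact (picard_limit_fixed omega c d k A r L hr0 hL hA hc hd hL1 hL2 t n). Qed.

Lemma force_ccont n : ccont (fun t => force t n).
Proof. apply (forcing_ccont k A r hr0 uhat n uhat_admissible). Qed.

Lemma force_decays t : decays r Q (force t).
Proof. exact (forcing_decays k A r hr0 uhat uhat_admissible t). Qed.

Lemma uhat_decays t : decays r B (uhat t).
Proof.
apply (decays_le r (2 * A)); [unfold B; lra|apply (proj1 uhat_admissible)].
Qed.

Lemma power_decays t : decays r B (power t).
Proof.
apply (decays_le r (2 * A * kappa)).
- unfold B, Q; pose proof LQ0; unfold Q in *; lra.
- apply conv_pow_decays; [exact hr0|apply (proj1 uhat_admissible)].
Qed.

Lemma uhat_t_decays t : decays r B (uhat_t t).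
Proof.
intros n; pose proof (weight_pos r n); pose proof (clamp_in L t hL).
pose proof (theta_bound omega n) as Hth; fold th in Hth.
assert (H1 : Cmod (primC (fun s => force s n) (clamp L t)) <= L * (Q * weight r n)).
{ apply Rle_trans with (clamp L t * (Q * weight r n)).
  - apply primC_le; [apply force_ccont|lra|]; intros; apply force_decays.
  - apply Rmult_le_compat_r; [apply Rmult_le_pos; [exact Q0|lra]|lra]. }
unfold uhat_t; eapply Rle_trans; [apply Cmod_triangle|].
rewrite Cmod_opp Cmod_mult Cmod_R Rabs_pos_eq; [|lra].
pose proof (Cmod_ge_0 (primC (fun s => force s n) (clamp L t))).
pose proof (hd n).
apply Rle_trans with (A * weight r n + 1 * (L * (Q * weight r n))).
- apply Rplus_le_compat; [assumption|apply Rmult_le_compat; lra].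
- pose proof Q0; unfold B.
  apply Rle_trans with ((A + L * Q) * weight r n); [right; ring|].
  apply Rmult_le_compat_r; lra.
Qed.

Lemma uhat_tt_decays t : decays r B (uhat_tt t).
Proof.
intros n; pose proof (weight_pos r n).
pose proof (theta_bound omega n) as Hth; fold th in Hth.
unfold uhat_tt; rewrite Cmod_opp Cmod_mult Cmod_R Rabs_pos_eq; [|lra].
apply Rle_trans with (1 * (Q * weight r n)).
- apply Rmult_le_compat; [lra|apply Cmod_ge_0|lra|apply force_decays].
- pose proof LQ0; rewrite Rmult_1_l; apply Rmult_le_compat_r; unfold B; lra.
Qed.

Lemma uhat_ccont n : ccont (fun t => uhat t n).
Proof. apply (proj2 uhat_admissible). Qed.

Lemma power_ccont n : ccont (fun t => power t n).
Proof.
intros t; unfold power.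
apply (conv_pow_filterlim r (2 * A) uhat (uhat t) k hr0
  (proj1 uhat_admissible) (proj1 uhat_admissible t)); intros m.
exact (uhat_ccont m t).
Qed.

Lemma uhat_t_ccont n : ccont (fun t => uhat_t t n).
Proof.
apply ccont_ext with (fun t => Cplus (d n) (Cmult (RtoC (- th n))
  (primC (fun s => force s n) (clamp L t)))).
- intros t; unfold uhat_t; rewrite RtoC_opp; ring.
- apply ccont_plus; [apply ccont_const|].
  apply ccont_mult; [apply ccont_const|].
  apply ccont_comp; [apply clamp_continuous|apply primC_ccont, force_ccont].
Qed.

Lemma uhat_tt_ccont n : ccont (fun t => uhat_tt t n).
Proof.
apply ccont_ext with (fun t => Cmult (RtoC (- th n)) (force t n)).
- intros t; unfold uhat_tt; rewrite RtoC_opp; ring.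
- apply ccont_mult; [apply ccont_const|apply force_ccont].
Qed.

Lemma dxx_coef_ccont b n : ccont (fun t => b t n) -> ccont (fun t => dxx_coef omega b t n).
Proof. intros H; apply ccont_mult; [apply ccont_const|exact H]. Qed.

Lemma uhat_derivative : coef_derivative r B L uhat uhat_t.
Proof.
split.
- intros t n Ht.
  apply (filterdiff_primC L (th n) t (primC (fun s => force s n))).
  + apply primC_ccont, force_ccont.
  + apply theta_bound.
  + exact Ht.
  + intros s Hs; rewrite !uhat_fixed; unfold picard, uhat_t.
    rewrite !(clamp_id L) //; fold th.
    change (fun s => forcing k uhat s n) with (fun s => force s n).
    rewrite RtoC_minus; ring.
- intros s t n Hs Ht; rewrite !uhat_fixed; unfold picard.
  rewrite !(clamp_id L) //; fold th.
  change (fun s => forcing k uhat s n) with (fun s => force s n).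
  set (Js := primC (primC (fun s => force s n)) s).
  set (Jt := primC (primC (fun s => force s n)) t).
  replace (Cminus _ _) with (Cplus (Cmult (RtoC (s - t)) (d n))
    (Copp (Cmult (RtoC (th n)) (Cminus Js Jt)))) by (rewrite RtoC_minus; ring).
  pose proof (weight_pos r n) as Hw; pose proof (theta_bound omega n) as Hth.
  fold th in Hth.
  assert (HJ : Cmod (Cminus Js Jt) <= L * Q * weight r n * Rabs (s - t)).
  { apply (primC_lipschitz _ t s L); [apply primC_ccont, force_ccont|exact Ht|exact Hs|].
    intros u Hu; apply Rle_trans with (u * (Q * weight r n)).
    - apply primC_le; [apply force_ccont|lra|]; intros; apply force_decays.
    - rewrite Rmult_assoc; apply Rmult_le_compat_r; [|lra].
      apply Rmult_le_pos; [exact Q0|lra]. }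
  eapply Rle_trans; [apply Cmod_triangle|].
  rewrite Cmod_opp !Cmod_mult !Cmod_R (Rabs_pos_eq (th n)); [|lra].
  pose proof (Rabs_pos (s - t)) as Hst; pose proof (hd n) as Hdn.
  apply Rle_trans with (Rabs (s - t) * (A * weight r n) +
    1 * (L * Q * weight r n * Rabs (s - t))).
  + apply Rplus_le_compat.
    * apply Rmult_le_compat_l; assumption.
    * apply Rmult_le_compat; [lra|apply Cmod_ge_0|lra|exact HJ].
  + apply Rle_trans with ((A + L * Q) * (weight r n * Rabs (s - t)));
      [right; ring|].
    rewrite Rmult_assoc; apply Rmult_le_compat_r.
    * apply Rmult_le_pos; lra.
    * pose proof Q0; unfold B; lra.
Qed.

Lemma uhat_t_derivative : coef_derivative r B L uhat_t uhat_tt.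
Proof.
split.
- intros t n Ht.
  apply (filterdiff_primC L (th n) t (fun s => force s n)).
  + apply force_ccont.
  + apply theta_bound.
  + exact Ht.
  + intros s Hs; unfold uhat_t, uhat_tt; rewrite !(clamp_id L) //; ring.
- intros s t n Hs Ht; unfold uhat_t; rewrite !(clamp_id L) //.
  set (Js := primC (fun s => force s n) s).
  set (Jt := primC (fun s => force s n) t).
  replace (Cminus _ _) with (Copp (Cmult (RtoC (th n)) (Cminus Js Jt))) by ring.
  pose proof (weight_pos r n) as Hw; pose proof (theta_bound omega n) as Hth.
  fold th in Hth.
  assert (HJ : Cmod (Cminus Js Jt) <= Q * weight r n * Rabs (s - t)).
  { apply (primC_lipschitz _ t s L); [apply force_ccont|exact Ht|exact Hs|].
    intros; apply force_decays. }
  rewrite Cmod_opp Cmod_mult Cmod_R Rabs_pos_eq; [|lra].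
  apply Rle_trans with (1 * (Q * weight r n * Rabs (s - t))).
  + apply Rmult_le_compat; [lra|apply Cmod_ge_0|lra|exact HJ].
  + rewrite Rmult_1_l (Rmult_assoc Q) (Rmult_assoc B); apply Rmult_le_compat_r.
    * apply Rmult_le_pos; [lra|apply Rabs_pos].
    * pose proof LQ0; unfold B; lra.
Qed.

(** With mu the frequency of the n-th mode, this is (1 + mu^2) theta = mu^2. *)
Lemma coefficient_equation t n :
  Cminus (Cminus (Cminus (uhat_tt t n) (dxx_coef omega uhat t n)) (dxx_coef omega uhat_tt t n))
    (dxx_coef omega power t n) = RtoC 0.
Proof.
unfold dxx_coef, uhat_tt, force, forcing, power.
assert (E : th n = pairing n omega ^ 2 - pairing n omega ^ 2 * th n).
{ unfold th, theta; field; pose proof (pow2_ge_0 (pairing n omega)); nra. }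
assert (E2 : RtoC (th n) = Cminus (RtoC (pairing n omega ^ 2))
  (Cmult (RtoC (pairing n omega ^ 2)) (RtoC (th n)))).
{ rewrite {1}E RtoC_minus RtoC_mult //. }
rewrite RtoC_opp.
set (z := RtoC (th n)) in *; set (m := RtoC (pairing n omega ^ 2)) in *.
set (q := Cplus (uhat t n) (conv_pow (uhat t) k n)).
replace (Cminus _ _) with (Cmult q (Cminus (Cminus m (Cmult m z)) z))
  by (unfold q; ring).
rewrite -E2; ring.
Qed.

(** Two x-derivatives cost a factor of order (1 + |n|)^2 and turn the decay
    exponent r into r - 2, which is still larger than nu. *)
Lemma solution_exists : exists (u : R -> R -> C) (a : R -> lattice nu -> C),
  qp_classical_solution k.+1 omega c d L u a /\ poly_decay A r L a.
Proof.
destruct (pairing_le omega) as [W [HW1 HW]].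
set (B2 := W ^ 2 * B).
assert (HB : 0 <= B) by (pose proof Q0; pose proof LQ0; unfold B; lra).
assert (HBB2 : B <= B2).
{ unfold B2; replace B with (1 * B) at 1 by ring.
  apply Rmult_le_compat_r; [exact HB|]; nra. }
assert (Hmu2w : forall n, pairing n omega ^ 2 * (B * weight r n) <=
  B2 * weight (r - 2) n).
{ intros n; rewrite -weight_sqr; unfold B2.
  pose proof (weight_pos r n); pose proof (l1norm_ge0 n); pose proof (HW n).
  replace (W ^ 2 * B * ((1 + l1norm n) ^ 2 * weight r n)) with
    ((W * (1 + l1norm n)) ^ 2 * (B * weight r n)) by ring.
  apply Rmult_le_compat_r; [apply Rmult_le_pos; lra|].
  rewrite -(pow2_abs (pairing n omega)); apply pow_incr.
  split; [apply Rabs_pos|assumption]. }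
assert (Hmu1w : forall n, Rabs (pairing n omega) * (B * weight r n) <=
  B2 * weight (r - 2) n).
{ intros n; rewrite -weight_sqr; unfold B2.
  pose proof (weight_pos r n); pose proof (l1norm_ge0 n); pose proof (HW n).
  replace (W ^ 2 * B * ((1 + l1norm n) ^ 2 * weight r n)) with
    ((W * (1 + l1norm n)) ^ 2 * (B * weight r n)) by ring.
  apply Rmult_le_compat_r; [apply Rmult_le_pos; lra|].
  eapply Rle_trans; [eassumption|].
  assert (1 <= W * (1 + l1norm n)) by nra.
  simpl; rewrite Rmult_1_r; nra. }
assert (Hmu2 : forall b, (forall t, decays r B (b t)) ->
  forall t, decays (r - 2) B2 (dxx_coef omega b t)).
{ intros b Hb t n; unfold dxx_coef.
  rewrite Cmod_mult Cmod_R Rabs_Ropp Rabs_pos_eq; [|apply pow2_ge_0].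
  eapply Rle_trans; [|apply Hmu2w].
  apply Rmult_le_compat_l; [apply pow2_ge_0|apply Hb]. }
assert (Hmu1 : forall b, (forall t, decays r B (b t)) ->
  forall t, decays (r - 2) B2 (dx_coef omega b t)).
{ intros b Hb t n; unfold dx_coef; rewrite Cmod_mult.
  rewrite Cmod_imaginary; eapply Rle_trans; [|apply Hmu1w].
  apply Rmult_le_compat_l; [apply Rabs_pos|apply Hb]. }
assert (Hlow : forall b : R -> lattice nu -> C, (forall t, decays r B (b t)) ->
  forall t, decays (r - 2) B2 (b t)).
{ intros b Hb t; apply (decays_le _ B); [exact HBB2|].
  apply (decays_weaken r); [lra|apply Hb]. }
assert (Hx2 : forall b : R -> lattice nu -> C, (forall t, decays r B (b t)) ->
  is_partial_x L (qps omega b) (qps omega (dx_coef omega b)) /\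
  is_partial_x L (qps omega (dx_coef omega b)) (qps omega (dxx_coef omega b))).
{ intros b Hb.
  assert (E : dx_coef omega (dx_coef omega b) = dxx_coef omega b).
  { apply functional_extensionality; intros t.
    apply functional_extensionality; intros n.
    unfold dx_coef, dxx_coef; rewrite Cmult_assoc; f_equal.
    unfold Cmult, RtoC; simpl; f_equal; ring. }
  split.
  - apply (qps_partial_x omega (r - 2) B2); auto.
  - rewrite -E; apply (qps_partial_x omega (r - 2) B2); auto.
    rewrite E; auto. }
assert (Hct : forall b b' : R -> lattice nu -> C, (forall t, decays r B (b t)) ->
  (forall t, decays r B (b' t)) -> coef_derivative r B L b b' ->
  is_partial_t L (qps omega b) (qps omega b') /\
  is_partial_t L (qps omega (dxx_coef omega b)) (qps omega (dxx_coef omega b'))).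
{ intros b b' Hb Hb' Hd; split.
  - apply (qps_partial_t omega r B); auto.
  - apply (qps_partial_t omega (r - 2) B2); auto.
    apply (coef_derivative_dxx omega r B); auto. }
destruct (Hct _ _ uhat_decays uhat_t_decays uhat_derivative) as [Ht1 Ht1x].
destruct (Hct _ _ uhat_t_decays uhat_tt_decays uhat_t_derivative) as [Ht2 Ht2x].
assert (Epow : (fun t x => Cpow (qps omega uhat t x) k.+1) = qps omega power).
{ apply functional_extensionality; intros t.
  apply functional_extensionality; intros x.
  apply (is_sum_unique (V := CV)
    (fun n => Cmult (power t n) (expi (pairing n omega * x)))).
  - apply (is_qp_series_pow r B omega (uhat t) x _ k hr0 (uhat_decays t)).
    exact (qps_is_qp_series omega r B uhat t x hr0 (uhat_decays t)).
  - exact (qps_is_qp_series omega r B power t x hr0 (power_decays t)). }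
exists (qps omega uhat), uhat; split; [split|].
- intros t x _; exact (qps_is_qp_series omega r B uhat t x hr0 (uhat_decays t)).
- exists (qps omega uhat_t), (qps omega uhat_tt),
    (qps omega (dx_coef omega uhat)), (qps omega (dxx_coef omega uhat)),
    (qps omega (dxx_coef omega uhat_t)), (qps omega (dxx_coef omega uhat_tt)),
    (qps omega (dx_coef omega power)), (qps omega (dxx_coef omega power)).
  rewrite Epow.
  split; [split; assumption|].
  split; [apply Hx2, uhat_decays|].
  split; [split; assumption|].
  split; [apply Hx2, power_decays|].
  split.
  { repeat split.
    - apply (qps_continuous_strip omega r B); auto using uhat_t_decays, uhat_t_ccont.
    - apply (qps_continuous_strip omega r B); auto using uhat_tt_decays, uhat_tt_ccont.
    - apply (qps_continuous_strip omega (r - 2) B2);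
        auto using uhat_decays, uhat_ccont, dxx_coef_ccont.
    - apply (qps_continuous_strip omega (r - 2) B2);
        auto using uhat_tt_decays, uhat_tt_ccont, dxx_coef_ccont.
    - apply (qps_continuous_strip omega (r - 2) B2);
        auto using power_decays, power_ccont, dxx_coef_ccont. }
  split; [|split].
  + intros t x Ht.
    pose proof (qps_is_qp_series omega r B uhat_tt t x hr0 (uhat_tt_decays t)) as S1.
    pose proof (qps_is_qp_series omega (r - 2) B2 (dxx_coef omega uhat) t x hr2
      (Hmu2 _ uhat_decays t)) as S2.
    pose proof (qps_is_qp_series omega (r - 2) B2 (dxx_coef omega uhat_tt) t x hr2
      (Hmu2 _ uhat_tt_decays t)) as S3.
    pose proof (qps_is_qp_series omega (r - 2) B2 (dxx_coef omega power) t x hr2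
      (Hmu2 _ power_decays t)) as S4.
    pose proof (is_sum_plus (V := C_R_NormedModule) _ _ _ _
      (is_sum_plus (V := C_R_NormedModule) _ _ _ _
        (is_sum_plus (V := C_R_NormedModule) _ _ _ _ S1
          (is_sum_Cmult (-1)%C _ _ S2)) (is_sum_Cmult (-1)%C _ _ S3))
      (is_sum_Cmult (-1)%C _ _ S4)) as S.
    refine (is_sum_unique (V := CV) (fun _ => zero) _ _ _ (is_sum_zero (V := CV))).
    replace (Cminus _ _) with
      (Cplus (Cplus (Cplus (qps omega uhat_tt t x)
        (Cmult (-1)%C (qps omega (dxx_coef omega uhat) t x)))
        (Cmult (-1)%C (qps omega (dxx_coef omega uhat_tt) t x)))
        (Cmult (-1)%C (qps omega (dxx_coef omega power) t x))) by ring.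
    eapply is_sum_ext; [|exact S]; intros n.
    set (e := expi (pairing n omega * x)).
    change (Cplus (Cplus (Cplus (Cmult (uhat_tt t n) e)
      (Cmult (-1)%C (Cmult (dxx_coef omega uhat t n) e)))
      (Cmult (-1)%C (Cmult (dxx_coef omega uhat_tt t n) e)))
      (Cmult (-1)%C (Cmult (dxx_coef omega power t n) e)) = RtoC 0).
    pose proof (coefficient_equation t n) as E.
    replace (Cplus _ _) with (Cmult (Cminus (Cminus (Cminus (uhat_tt t n)
      (dxx_coef omega uhat t n)) (dxx_coef omega uhat_tt t n)) (dxx_coef omega power t n)) e) by ring.
    rewrite E; ring.
  + intros x.
    eapply is_sum_ext;
      [|exact (qps_is_qp_series omega r B uhat 0 x hr0 (uhat_decays 0))].
    intros n; simpl; f_equal; rewrite uhat_fixed; unfold picard.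
    rewrite clamp_id; [|lra]; rewrite primC_0; ring.
  + intros x.
    eapply is_sum_ext;
      [|exact (qps_is_qp_series omega r B uhat_t 0 x hr0 (uhat_t_decays 0))].
    intros n; simpl; f_equal; unfold uhat_t.
    rewrite clamp_id; [|lra]; rewrite primC_0; ring.
- intros t n _; apply (proj1 uhat_admissible).
Qed.

End Existence.

(** * One-sided calculus on [0, L] *)

(** Derivatives along [0, L], one-sided at the endpoints, for real functions. *)
Definition sderiv (L : R) (f f' : R -> R) : Prop :=
  forall t, 0 <= t <= L -> forall eps, 0 < eps ->
  exists delta, 0 < delta /\ forall s, 0 <= s <= L -> Rabs (s - t) < delta ->
    Rabs (f s - f t - (s - t) * f' t) <= eps * Rabs (s - t).

Lemma sderiv_lin L (a b : R) f f' g g' :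
  sderiv L f f' -> sderiv L g g' ->
  sderiv L (fun t => a * f t + b * g t) (fun t => a * f' t + b * g' t).
Proof.
intros Hf Hg t Ht eps He.
assert (Hp : 0 < Rabs a + Rabs b + 1)
  by (pose proof (Rabs_pos a); pose proof (Rabs_pos b); lra).
assert (He' : 0 < eps / (Rabs a + Rabs b + 1)) by (apply Rdiv_lt_0_compat; lra).
destruct (Hf t Ht _ He') as [d1 [Hd1 H1]].
destruct (Hg t Ht _ He') as [d2 [Hd2 H2]].
exists (Rmin d1 d2); split; [apply Rmin_pos; assumption|]; intros s Hs Hst.
pose proof (Rmin_l d1 d2); pose proof (Rmin_r d1 d2).
specialize (H1 s Hs ltac:(lra)); specialize (H2 s Hs ltac:(lra)).
replace (_ - _ - _) with (a * (f s - f t - (s - t) * f' t) +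
  b * (g s - g t - (s - t) * g' t)) by ring.
eapply Rle_trans; [apply Rabs_triang|]; rewrite !Rabs_mult.
set (e := eps / (Rabs a + Rabs b + 1)) in *.
assert (E : eps = (Rabs a + Rabs b + 1) * e) by (unfold e; field; lra).
pose proof (Rabs_pos a); pose proof (Rabs_pos b); pose proof (Rabs_pos (s - t)).
apply Rle_trans with (Rabs a * (e * Rabs (s - t)) + Rabs b * (e * Rabs (s - t))).
- apply Rplus_le_compat; apply Rmult_le_compat_l; assumption.
- rewrite E; assert (0 <= e * Rabs (s - t)) by (apply Rmult_le_pos; lra).
  lra.
Qed.

Lemma sderiv_ext L f f' g g' : (forall t, 0 <= t <= L -> f t = g t) ->
  (forall t, 0 <= t <= L -> f' t = g' t) -> sderiv L f f' -> sderiv L g g'.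
Proof.
intros E E' H t Ht eps He; destruct (H t Ht eps He) as [de [Hde H1]].
exists de; split; [exact Hde|]; intros s Hs Hst.
rewrite -!E // -E' //; apply H1; assumption.
Qed.

Lemma is_derive_eps (f : R -> R) (x l : R) :
  is_derive f x l -> forall eps, 0 < eps -> exists delta, 0 < delta /\
  forall y, Rabs (y - x) < delta ->
    Rabs (f y - f x - (y - x) * l) <= eps * Rabs (y - x).
Proof.
intros [_ H] eps He; destruct (H x (fun P HP => HP) (mkposreal _ He)) as [de Hde].
exists de; split; [apply cond_pos|]; intros y Hy; exact (Hde y Hy).
Qed.

Lemma is_derive_sderiv L f f' : (forall t, is_derive f t (f' t)) -> sderiv L f f'.
Proof.
intros H t _ eps He; destruct (is_derive_eps f t _ (H t) eps He) as [de [Hde H1]].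
exists de; split; [exact Hde|]; intros s _ Hs; apply H1, Hs.
Qed.

Lemma sderiv_continuous L f f' : 0 <= L -> sderiv L f f' ->
  forall t, continuous (fun s => f (clamp L s)) t.
Proof.
intros HL H t; apply (filterlim_locally_ball_norm (U := R_NormedModule)).
intros [eps He].
pose proof (clamp_in L t HL) as Ht; set (c := clamp L t) in *.
destruct (H c Ht 1 Rlt_0_1) as [de [Hde H1]].
assert (Hp : 0 < 1 + Rabs (f' c)) by (pose proof (Rabs_pos (f' c)); lra).
assert (He2 : 0 < Rmin de (eps / (1 + Rabs (f' c)))).
{ apply Rmin_pos; [exact Hde|apply Rdiv_lt_0_compat; lra]. }
exists (mkposreal _ He2); intros s Hs.
change (Rabs (s - t) < Rmin de (eps / (1 + Rabs (f' c)))) in Hs.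
change (Rabs (f (clamp L s) - f c) < eps).
pose proof (Rmin_l de (eps / (1 + Rabs (f' c)))).
pose proof (Rmin_r de (eps / (1 + Rabs (f' c)))).
pose proof (clamp_lipschitz L s t) as Hl; fold c in Hl.
pose proof (H1 (clamp L s) (clamp_in L s HL) ltac:(lra)) as H4.
replace (f (clamp L s) - f c) with ((f (clamp L s) - f c -
  (clamp L s - c) * f' c) + (clamp L s - c) * f' c) by ring.
eapply Rle_lt_trans; [apply Rabs_triang|]; rewrite (Rabs_mult (clamp L s - c)).
assert (Hq : Rabs (clamp L s - c) < eps / (1 + Rabs (f' c))) by lra.
apply Rlt_div_r in Hq; [|exact Hp]; lra.
Qed.

Lemma sderiv_is_derive L f f' t : sderiv L f f' -> 0 < t < L ->
  is_derive (fun s => f (clamp L s)) t (f' t).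
Proof.
intros H Ht; split; [exact (is_linear_scal_l (V := R_NormedModule) (f' t))|].
intros x Hx [eps He].
assert (E : t = x) by exact (is_filter_lim_locally_unique _ _ Hx).
subst x; destruct (H t ltac:(lra) eps He) as [de [Hde H1]].
assert (Hm : 0 < Rmin de (Rmin t (L - t))) by (repeat apply Rmin_pos; lra).
exists (mkposreal _ Hm); intros s Hs.
change (Rabs (s - t) < Rmin de (Rmin t (L - t))) in Hs.
pose proof (Rmin_l de (Rmin t (L - t))); pose proof (Rmin_r de (Rmin t (L - t))).
pose proof (Rmin_l t (L - t)); pose proof (Rmin_r t (L - t)).
assert (Hs2 : 0 <= s <= L) by (apply Rabs_lt_between' in Hs; lra).
change (Rabs (f (clamp L s) - f (clamp L t) - (s - t) * f' t) <=
  eps * Rabs (s - t)).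
rewrite !clamp_id; [|lra|lra]; apply H1; [exact Hs2|lra].
Qed.

(** The mean value theorem for the extension of f that is constant outside
    [0, L], which is continuous everywhere and differentiable inside. *)
Lemma sderiv_bound L f f' M s t : sderiv L f f' -> 0 <= s <= t -> t <= L ->
  (forall u, s <= u <= t -> Rabs (f' u) <= M) ->
  Rabs (f t - f s) <= M * (t - s).
Proof.
intros H Hst HtL HM.
destruct (MVT_gen (fun u => f (clamp L u)) s t f') as [z [Hz1 Hz2]].
- rewrite Rmin_left; [|lra]; rewrite Rmax_right; [|lra]; intros x Hx.
  apply sderiv_is_derive; [exact H|lra].
- intros x _; apply continuity_pt_filterlim, sderiv_continuous with f';
    [lra|exact H].
- rewrite Rmin_left in Hz1; [|lra]; rewrite Rmax_right in Hz1; [|lra].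
  rewrite !clamp_id in Hz2; [|lra|lra].
  rewrite Hz2 Rabs_mult (Rabs_pos_eq (t - s)); [|lra].
  apply Rmult_le_compat_r; [lra|apply HM, Hz1].
Qed.

(** All the double time integrals of the uniqueness proof are estimated through
    this: it applies to any linear combination of functions whose second
    derivative is known. *)
Lemma sderiv2_bound L f f1 f2 M t : sderiv L f f1 -> sderiv L f1 f2 ->
  f 0 = 0 -> f1 0 = 0 -> 0 <= t <= L ->
  (forall u, 0 <= u <= L -> Rabs (f2 u) <= M) -> Rabs (f t) <= M * t ^ 2.
Proof.
intros H1 H2 E0 E1 Ht HM.
assert (HM0 : 0 <= M).
{ eapply Rle_trans; [apply Rabs_pos|apply (HM 0); lra]. }
replace (f t) with (f t - f 0) by lra.
eapply Rle_trans.
- apply (sderiv_bound L f f1 (M * t) 0 t H1); [lra|lra|]; intros u Hu.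
  replace (f1 u) with (f1 u - f1 0) by lra.
  eapply Rle_trans; [apply (sderiv_bound L f1 f2 M 0 u H2); [lra|lra|]|].
  + intros z Hz; apply HM; lra.
  + apply Rmult_le_compat_l; lra.
- right; ring.
Qed.

(** * Continuity on the strip *)

Definition rcont (L : R) (F : R -> R -> R) : Prop :=
  forall t x, 0 <= t <= L -> forall eps, 0 < eps ->
  exists delta, 0 < delta /\ forall s y, 0 <= s <= L ->
    Rabs (s - t) < delta -> Rabs (y - x) < delta ->
    Rabs (F s y - F t x) < eps.

Lemma rcont_continuous_t L F x : 0 <= L -> rcont L F ->
  forall t, continuous (fun s => F (clamp L s) x) t.
Proof.
intros HL H t; apply (filterlim_locally_ball_norm (U := R_NormedModule)).
intros [eps He].
destruct (H (clamp L t) x (clamp_in L t HL) eps He) as [de [Hde H1]].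
exists (mkposreal _ Hde); intros s Hs.
apply H1; [apply clamp_in, HL| |rewrite Rminus_diag Rabs_R0; exact Hde].
eapply Rle_lt_trans; [apply clamp_lipschitz|exact Hs].
Qed.

Lemma rcont_bounded L F x : 0 <= L -> rcont L F ->
  exists M, forall t, 0 <= t <= L -> Rabs (F t x) <= M.
Proof.
intros HL H.
destruct (continuity_ab_maj (fun s => Rabs (F (clamp L s) x)) 0 L HL)
  as [m [Hm _]].
- intros s _; apply continuity_pt_filterlim.
  apply (continuous_comp (fun s => F (clamp L s) x) Rabs).
  + apply rcont_continuous_t; assumption.
  + apply continuous_Rabs.
- exists (Rabs (F (clamp L m) x)); intros t Ht.
  specialize (Hm t Ht); simpl in Hm; rewrite (clamp_id L t Ht) in Hm; exact Hm.
Qed.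

(** Compactness of [0, L] makes the continuity in [x] uniform in [t]. *)
Lemma rcont_tube L F x eps : 0 <= L -> rcont L F -> 0 < eps ->
  exists delta, 0 < delta /\ forall t y, 0 <= t <= L ->
    Rabs (y - x) < delta -> Rabs (F t y - F t x) < eps.
Proof.
intros HL H He.
destruct (uniform_continuity_2d (fun s y => F (clamp L s) y) 0 L (x - 1) (x + 1))
  with (eps := mkposreal _ He) as [de Hde].
- intros s y Hs Hy [e Hpe].
  destruct (H s y Hs e Hpe) as [d1 [Hd1 H1]].
  exists (mkposreal _ Hd1); simpl; intros u v Hu Hv.
  rewrite (clamp_id L s Hs).
  apply H1; [apply clamp_in, HL| |exact Hv].
  rewrite -{1}(clamp_id L s Hs).
  eapply Rle_lt_trans; [apply clamp_lipschitz|exact Hu].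
- assert (Hm : 0 < Rmin 1 de) by (apply Rmin_pos; [lra|apply cond_pos]).
  exists (Rmin 1 de); split; [exact Hm|]; intros t y Ht Hy.
  pose proof (Rmin_l 1 de); pose proof (Rmin_r 1 de).
  assert (Hy' : x - 1 <= y <= x + 1) by (apply Rabs_lt_between' in Hy; lra).
  specialize (Hde t x t y Ht ltac:(lra) Ht Hy').
  simpl in Hde; rewrite !(clamp_id L t Ht) in Hde.
  apply Hde; [rewrite Rminus_diag Rabs_R0; apply cond_pos|lra].
Qed.

Lemma rcont_x L F t x : rcont L F -> 0 <= t <= L -> forall eps, 0 < eps ->
  exists delta, 0 < delta /\ forall y,
    Rabs (y - x) < delta -> Rabs (F t y - F t x) < eps.
Proof.
intros H Ht eps He; destruct (H t x Ht eps He) as [de [Hde H1]].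
exists de; split; [exact Hde|]; intros y Hy; apply H1; auto.
rewrite Rminus_diag Rabs_R0; exact Hde.
Qed.

(** * Second differences and a maximum principle *)

Definition diff2 (f : R -> R) (x h : R) : R := f (x + h) - 2 * f x + f (x - h).

Lemma diff2_mean_value (f f1 f2 : R -> R) (x h : R) :
  (forall y, is_derive f y (f1 y)) -> (forall y, is_derive f1 y (f2 y)) ->
  0 < h -> exists xi, Rabs (xi - x) <= h /\ diff2 f x h = h ^ 2 * f2 xi.
Proof.
intros Hf Hf1 Hh.
set (q := diff2 f x h / h ^ 2).
assert (Hq : diff2 f x h = h ^ 2 * q) by (unfold q; field; lra).
(* Rolle for s |-> diff2 f x s - q s^2, then the mean value theorem for f1. *)
assert (Hd : forall s, is_derive (fun s => diff2 f x s - q * s ^ 2) s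
  (f1 (x + s) - f1 (x - s) - 2 * q * s)).
{ intros s; unfold diff2.
  assert (E1 : is_derive (fun s => f (x + s)) s (f1 (x + s))).
  { replace (f1 (x + s)) with (scal 1 (f1 (x + s)))
      by (change (1 * f1 (x + s) = f1 (x + s)); ring).
    apply (is_derive_comp f (fun s => x + s)); [apply Hf|].
    auto_derive; [auto|ring]. }
  assert (E2 : is_derive (fun s => f (x - s)) s (- f1 (x - s))).
  { replace (- f1 (x - s)) with (scal (-1) (f1 (x - s)))
      by (change (-1 * f1 (x - s) = - f1 (x - s)); ring).
    apply (is_derive_comp f (fun s => x - s)); [apply Hf|].
    auto_derive; [auto|ring]. }
  assert (E3 : is_derive (fun s => q * s ^ 2 + 2 * f x) s (2 * q * s))
    by (auto_derive; [auto|ring]).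
  pose proof (is_derive_minus _ _ _ _ _ (is_derive_plus _ _ _ _ _ E1 E2) E3) as E.
  apply (is_derive_ext (fun s => minus (plus (f (x + s)) (f (x - s)))
    (q * s ^ 2 + 2 * f x))).
  - intros y; change (f (x + y) + f (x - y) - (q * y ^ 2 + 2 * f x) =
      f (x + y) - 2 * f x + f (x - y) - q * y ^ 2); ring.
  - replace (f1 (x + s) - f1 (x - s) - 2 * q * s) with
      (minus (plus (f1 (x + s)) (- f1 (x - s))) (2 * q * s)); [exact E|].
    change (f1 (x + s) + - f1 (x - s) - 2 * q * s =
      f1 (x + s) - f1 (x - s) - 2 * q * s); ring. }
destruct (MVT_cor2 (fun s => diff2 f x s - q * s ^ 2)
  (fun s => f1 (x + s) - f1 (x - s) - 2 * q * s) 0 h Hh) as [s [Hs1 Hs2]].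
{ intros s _; apply is_derive_Reals, Hd. }
assert (E0 : diff2 f x 0 = 0)
  by (unfold diff2; rewrite Rplus_0_r Rminus_0_r; ring).
rewrite E0 in Hs1.
assert (Hz : (f1 (x + s) - f1 (x - s) - 2 * q * s) * h = 0) by nra.
apply Rmult_integral in Hz; destruct Hz as [Hz|Hz]; [|lra].
destruct (MVT_cor2 f1 f2 (x - s) (x + s)) as [xi [Hx1 Hx2]]; [lra| |].
{ intros y _; apply is_derive_Reals, Hf1. }
exists xi; split; [apply Rabs_le; lra|].
rewrite Hq; f_equal; nra.
Qed.

(** The hypothesis is h'' = h - g for the second difference quotients in the
    place of h''.  As h is bounded, h - e x^2 has a global maximum, where second
    differences are nonpositive; there h - g <= 2 e up to the error e. *)
Lemma maximum_principle (h g : R -> R) (C G : R) :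
  (forall x, continuous h x) -> (forall x, Rabs (h x) <= C) ->
  (forall x, g x <= G) ->
  (forall x eps, 0 < eps -> exists s, 0 < s /\
     Rabs (diff2 h x s - s ^ 2 * (h x - g x)) <= eps * s ^ 2) ->
  forall x, h x <= G.
Proof.
intros Hc HC HG Hd x0.
assert (H : forall e, 0 < e -> h x0 <= G + e * (3 + x0 ^ 2)).
{ intros e He.
  assert (HC0 : 0 <= C) by (eapply Rle_trans; [apply Rabs_pos|apply (HC x0)]).
  assert (Hxe : 0 <= e * x0 ^ 2) by (apply Rmult_le_pos; [lra|apply pow2_ge_0]).
  set (X := 1 + Rabs x0 + (2 * C + e * x0 ^ 2) / e).
  assert (Hdiv : 0 <= (2 * C + e * x0 ^ 2) / e) by (apply Rdiv_le_0_compat; lra).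
  pose proof (Rabs_pos x0) as Hx0.
  assert (HX : 1 <= X) by (unfold X; lra).
  destruct (continuity_ab_maj (fun x => h x - e * x ^ 2) (- X) X)
    as [x1 [Hmax Hx1]]; [lra| |].
  { intros x _; apply continuity_pt_minus.
    - apply continuity_pt_filterlim, Hc.
    - apply continuity_pt_filterlim.
      apply (ex_derive_continuous (V := R_NormedModule) (fun x => e * x ^ 2)).
      auto_derive; auto. }
  assert (Hglob : forall x, h x - e * x ^ 2 <= h x1 - e * x1 ^ 2).
  { assert (H0 : h x0 - e * x0 ^ 2 <= h x1 - e * x1 ^ 2).
    { apply Hmax; unfold X in *; pose proof (Rle_abs x0).
      pose proof (Rle_abs (- x0)) as Hn; rewrite Rabs_Ropp in Hn; lra. }
    intros x; destruct (Rle_dec (Rabs x) X) as [Hx|Hx].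
    - apply Hmax; apply Rabs_le_between in Hx; exact Hx.
    - eapply Rle_trans; [|exact H0].
      pose proof (HC x) as H1; apply Rabs_le_between in H1.
      pose proof (HC x0) as H2; apply Rabs_le_between in H2.
      assert (HX2 : X <= x ^ 2).
      { rewrite -(pow2_abs x); nra. }
      assert (e * X <= e * x ^ 2) by (apply Rmult_le_compat_l; lra).
      assert (E : e * X = e * (1 + Rabs x0) + (2 * C + e * x0 ^ 2))
        by (unfold X; field; lra).
      assert (0 <= e * (1 + Rabs x0)) by (apply Rmult_le_pos; lra).
      lra. }
  destruct (Hd x1 e He) as [s [Hs1 Hs2]].
  apply Rabs_le_between in Hs2.
  pose proof (Hglob (x1 + s)) as H1; pose proof (Hglob (x1 - s)) as H2.
  pose proof (Hglob x0) as H3.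
  assert (H4 : diff2 h x1 s <= 2 * e * s ^ 2) by (unfold diff2; nra).
  assert (H5 : s ^ 2 * (h x1 - g x1) <= s ^ 2 * (3 * e)) by lra.
  apply Rmult_le_reg_l in H5; [|apply pow_lt, Hs1].
  pose proof (HG x1); pose proof (pow2_ge_0 x1); nra. }
apply Rnot_lt_le; intros Hlt.
pose proof (pow2_ge_0 x0) as Hx2.
assert (He : 0 < (h x0 - G) / (2 * (3 + x0 ^ 2))) by (apply Rdiv_lt_0_compat; lra).
pose proof (H _ He) as H1.
replace ((h x0 - G) / (2 * (3 + x0 ^ 2)) * (3 + x0 ^ 2)) with ((h x0 - G) / 2)
  in H1 by (field; lra).
lra.
Qed.

(** * The linear estimate *)

(** The extension by [clamp] makes the integrand continuous on the whole line. *)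
Definition primR (L : R) (f : R -> R) (t : R) : R :=
  RInt (fun s => f (clamp L s)) 0 t.

Lemma primR_sderiv L f : (forall t, continuous (fun s => f (clamp L s)) t) ->
  sderiv L (primR L f) f.
Proof.
intros Hf.
apply (sderiv_ext L (primR L f) (fun t => f (clamp L t))); [auto| |].
- intros t Ht; rewrite clamp_id //.
- apply is_derive_sderiv; intros t.
  apply (is_derive_RInt (V := R_NormedModule) (fun s => f (clamp L s)) _ 0);
    [|apply Hf].
  apply filter_forall; intros s.
  apply (RInt_correct (V := R_CompleteNormedModule)), ex_RInt_continuous.
  intros; apply Hf.
Qed.

Lemma primR_0 L f : primR L f 0 = 0.
Proof. exact (RInt_point (V := R_CompleteNormedModule) 0 _). Qed.

Section LinearEstimate.
Context (L C S : R) (w wt wtt wx wxx wxxt wxxtt P Px Pxx : R -> R -> R).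
Hypothesis (HL : 0 < L).
Hypothesis (Hwt : forall x, sderiv L (fun t => w t x) (fun t => wt t x)).
Hypothesis (Hwtt : forall x, sderiv L (fun t => wt t x) (fun t => wtt t x)).
Hypothesis (Hwxxt : forall x, sderiv L (fun t => wxx t x) (fun t => wxxt t x)).
Hypothesis (Hwxxtt :
  forall x, sderiv L (fun t => wxxt t x) (fun t => wxxtt t x)).
Hypothesis (Hwx : forall t x, 0 <= t <= L -> is_derive (w t) x (wx t x)).
Hypothesis (Hwxx : forall t x, 0 <= t <= L -> is_derive (wx t) x (wxx t x)).
Hypothesis (HPx : forall t x, 0 <= t <= L -> is_derive (P t) x (Px t x)).
Hypothesis (HPxx : forall t x, 0 <= t <= L -> is_derive (Px t) x (Pxx t x)).
Hypothesis (Cwtt : rcont L wtt) (Cwxx : rcont L wxx) (Cwxxtt : rcont L wxxtt).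
Hypothesis (CP : rcont L P) (CPxx : rcont L Pxx).
Hypothesis (Heq : forall t x, 0 <= t <= L -> wtt t x - wxxtt t x - Pxx t x = 0).
Hypothesis (Hw0 : forall x, w 0 x = 0) (Hwt0 : forall x, wt 0 x = 0).
Hypothesis (HC : forall t x, 0 <= t <= L -> Rabs (w t x) <= C).
Hypothesis (HS : forall t x, 0 <= t <= L -> Rabs (P t x) <= S).

Lemma wxx_initial x : wxx 0 x = 0.
Proof.
assert (H0 : 0 <= 0 <= L) by lra.
assert (E1 : forall y, wx 0 y = 0).
{ intros y; rewrite -(is_derive_unique _ _ _ (Hwx 0 y H0)).
  apply is_derive_unique, (is_derive_ext (fun _ => 0)); [auto|].
  apply (is_derive_const (V := R_NormedModule)). }
rewrite -(is_derive_unique _ _ _ (Hwxx 0 x H0)).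
apply is_derive_unique, (is_derive_ext (fun _ => 0)); [auto|].
apply (is_derive_const (V := R_NormedModule)).
Qed.

(** The initial data only prescribe [wt], not the mixed derivative.
    Since w = O(t^2), so are its second differences; but these equal
    h^2 wxx(t, xi) = h^2 (t wxxt(0, xi) + O(t^2)). *)
Lemma wxxt_initial x : wxxt 0 x = 0.
Proof.
assert (HL0 : 0 <= L) by lra.
assert (H0 : 0 <= 0 <= L) by lra.
set (g := fun y => wxxt 0 y).
(* R is the remainder of the first-order Taylor expansion of wxx at t = 0. *)
set (R := fun t y => wxx t y - t * g y).
assert (HR1 : forall y, sderiv L (fun t => R t y) (fun t => wxxt t y - g y)).
{ intros y.
  apply (sderiv_ext L (fun t => 1 * wxx t y + (- g y) * t)
    (fun t => 1 * wxxt t y + (- g y) * 1)).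
  - intros; unfold R; ring.
  - intros; ring.
  - apply sderiv_lin; [apply Hwxxt|].
    apply is_derive_sderiv; intros; auto_derive; auto. }
assert (HR2 : forall y, sderiv L (fun t => wxxt t y - g y) (fun t => wxxtt t y)).
{ intros y.
  apply (sderiv_ext L (fun t => 1 * wxxt t y + (- g y) * 1)
    (fun t => 1 * wxxtt t y + (- g y) * 0)).
  - intros; ring.
  - intros; ring.
  - apply sderiv_lin; [apply Hwxxtt|].
    apply is_derive_sderiv; intros; auto_derive; auto. }
assert (HR0 : forall y, R 0 y = 0).
{ intros y; unfold R; rewrite wxx_initial; ring. }
destruct (rcont_bounded L wtt x HL0 Cwtt) as [M1 HM1].
destruct (rcont_bounded L wxxtt x HL0 Cwxxtt) as [M2 HM2].
destruct (rcont_tube L wtt x 1 HL0 Cwtt Rlt_0_1) as [d1 [Hd1 T1]].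
destruct (rcont_tube L wxxtt x 1 HL0 Cwxxtt Rlt_0_1) as [d2 [Hd2 T2]].
assert (Bw : forall t y, 0 <= t <= L -> Rabs (y - x) < d1 ->
  Rabs (w t y) <= (M1 + 1) * t ^ 2).
{ intros t y Ht Hy.
  apply (sderiv2_bound L (fun t => w t y) (fun t => wt t y) (fun t => wtt t y));
    auto.
  intros u Hu; pose proof (T1 u y Hu Hy) as HT; pose proof (HM1 u Hu).
  replace (wtt u y) with ((wtt u y - wtt u x) + wtt u x) by ring.
  eapply Rle_trans; [apply Rabs_triang|lra]. }
assert (BR : forall t y, 0 <= t <= L -> Rabs (y - x) < d2 ->
  Rabs (R t y) <= (M2 + 1) * t ^ 2).
{ intros t y Ht Hy.
  apply (sderiv2_bound L (fun t => R t y) (fun t => wxxt t y - g y)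
    (fun t => wxxtt t y)); auto.
  { unfold g; ring. }
  intros u Hu; pose proof (T2 u y Hu Hy) as HT; pose proof (HM2 u Hu).
  replace (wxxtt u y) with ((wxxtt u y - wxxtt u x) + wxxtt u x) by ring.
  eapply Rle_trans; [apply Rabs_triang|lra]. }
(* g is continuous, since L g = wxx L - R L. *)
assert (Cg : forall eps, 0 < eps -> exists de, 0 < de /\
  forall y, Rabs (y - x) < de -> Rabs (g y - g x) <= eps).
{ intros eps He.
  assert (He2 : 0 < eps * L / 2) by nra.
  assert (He3 : 0 < eps / (2 * L)) by (apply Rdiv_lt_0_compat; lra).
  destruct (rcont_x L wxx L x Cwxx (conj HL0 (Rle_refl L)) _ He2)
    as [e1 [He1 A1]].
  destruct (rcont_tube L wxxtt x _ HL0 Cwxxtt He3) as [e2 [He2' A2]].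
  exists (Rmin e1 e2); split; [apply Rmin_pos; assumption|]; intros y Hy.
  pose proof (Rmin_l e1 e2); pose proof (Rmin_r e1 e2).
  assert (HRR : Rabs (R L y - R L x) <= eps / (2 * L) * L ^ 2).
  { apply (sderiv2_bound L (fun t => R t y - R t x)
      (fun t => (wxxt t y - g y) - (wxxt t x - g x))
      (fun t => wxxtt t y - wxxtt t x)).
    - apply (sderiv_ext L (fun t => 1 * R t y + (- 1) * R t x)
        (fun t => 1 * (wxxt t y - g y) + (- 1) * (wxxt t x - g x)));
        [intros; ring..|].
      apply (sderiv_lin L 1 (- 1)); apply HR1.
    - apply (sderiv_ext L
        (fun t => 1 * (wxxt t y - g y) + (- 1) * (wxxt t x - g x))
        (fun t => 1 * wxxtt t y + (- 1) * wxxtt t x)); [intros; ring..|].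
      apply (sderiv_lin L 1 (- 1)); apply HR2.
    - rewrite !HR0; ring.
    - unfold g; ring.
    - lra.
    - intros u Hu; left; apply A2; [exact Hu|lra]. }
  replace (eps / (2 * L) * L ^ 2) with (eps * L / 2) in HRR by (field; lra).
  pose proof (A1 y ltac:(lra)) as HA.
  apply (Rmult_le_reg_l L); [exact HL|].
  rewrite -{1}(Rabs_pos_eq L); [|lra]; rewrite -Rabs_mult.
  replace (L * (g y - g x)) with ((wxx L y - wxx L x) + - (R L y - R L x))
    by (unfold R; ring).
  eapply Rle_trans; [apply Rabs_triang|]; rewrite Rabs_Ropp; lra. }
apply Rabs_eq_0, Rle_antisym; [|apply Rabs_pos].
apply le_epsilon; intros eps He; rewrite Rplus_0_l.
assert (He2 : 0 < eps / 2) by lra.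
destruct (Cg (eps / 2) He2) as [d3 [Hd3 A3]].
set (h := Rmin d1 (Rmin d2 d3) / 2).
assert (Hm : 0 < Rmin d1 (Rmin d2 d3)) by (repeat apply Rmin_pos; assumption).
pose proof (Rmin_l d1 (Rmin d2 d3)); pose proof (Rmin_r d1 (Rmin d2 d3)).
pose proof (Rmin_l d2 d3); pose proof (Rmin_r d2 d3).
assert (Hh : 0 < h < d1) by (unfold h; lra).
assert (Hh2 : h < d2 /\ h < d3) by (unfold h; lra).
assert (HM1' : 0 <= M1).
{ eapply Rle_trans; [apply Rabs_pos|exact (HM1 0 H0)]. }
assert (HM2' : 0 <= M2).
{ eapply Rle_trans; [apply Rabs_pos|exact (HM2 0 H0)]. }
set (K := 4 * (M1 + 1) / h ^ 2 + (M2 + 1)).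
assert (Hh2p : 0 < h ^ 2) by (apply pow_lt; lra).
assert (HK : 0 < K).
{ unfold K; assert (0 < 4 * (M1 + 1) / h ^ 2)
    by (apply Rdiv_lt_0_compat; lra); lra. }
set (t := Rmin L (eps / 2 / K)).
assert (Ht : 0 < t <= L).
{ split; [|apply Rmin_l]; apply Rmin_pos; [exact HL|].
  apply Rdiv_lt_0_compat; lra. }
assert (HtK : t * K <= eps / 2).
{ apply Rle_div_r; [exact HK|apply Rmin_r]. }
assert (Ht' : 0 <= t <= L) by lra.
destruct (diff2_mean_value (w t) (wx t) (wxx t) x h
  (fun y => Hwx t y Ht') (fun y => Hwxx t y Ht') (proj1 Hh)) as [xi [Hxi E]].
assert (HD : Rabs (diff2 (w t) x h) <= 4 * ((M1 + 1) * t ^ 2)).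
{ unfold diff2.
  pose proof (Bw t (x + h) Ht') as B1; pose proof (Bw t (x - h) Ht') as B2.
  pose proof (Bw t x Ht') as B3.
  replace (x + h - x) with h in B1 by ring.
  replace (x - h - x) with (- h) in B2 by ring.
  rewrite Rabs_Ropp in B2; rewrite Rminus_diag Rabs_R0 in B3.
  rewrite (Rabs_pos_eq h) in B1; [|lra]; rewrite (Rabs_pos_eq h) in B2; [|lra].
  specialize (B1 (proj2 Hh)); specialize (B2 (proj2 Hh)); specialize (B3 Hd1).
  apply Rabs_le_between in B1; apply Rabs_le_between in B2.
  apply Rabs_le_between in B3; apply Rabs_le; lra. }
assert (Hxi3 : Rabs (xi - x) < d3) by lra.
assert (Hxi2 : Rabs (xi - x) < d2) by lra.
pose proof (A3 xi Hxi3) as HA; pose proof (BR t xi Ht' Hxi2) as HB.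
rewrite E Rabs_mult (Rabs_pos_eq (h ^ 2)) in HD; [|lra].
assert (HD' : Rabs (wxx t xi) <= 4 * (M1 + 1) / h ^ 2 * t ^ 2).
{ apply (Rmult_le_reg_l (h ^ 2)); [exact Hh2p|].
  eapply Rle_trans; [exact HD|right; field; lra]. }
assert (Hg : t * Rabs (g xi) <= t * (t * K)).
{ rewrite -{1}(Rabs_pos_eq t); [|lra]; rewrite -Rabs_mult.
  replace (t * g xi) with (wxx t xi + - R t xi) by (unfold R; ring).
  eapply Rle_trans; [apply Rabs_triang|]; rewrite Rabs_Ropp.
  unfold K; simpl in HB, HD' |- *; lra. }
apply Rmult_le_reg_l in Hg; [|lra].
change (Rabs (g x) <= eps).
replace (g x) with (g xi + - (g xi - g x)) by ring.
eapply Rle_trans; [apply Rabs_triang|]; rewrite Rabs_Ropp; lra.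
Qed.

(* Double primitives in time of P and of Pxx, with zero initial data. *)
Let G1 x := primR L (fun s => P s x).
Let G x := primR L (G1 x).
Let K1 x := primR L (fun s => Pxx s x).
Let K x := primR L (K1 x).

Let HG1 x : sderiv L (G1 x) (fun t => P t x).
Proof. apply primR_sderiv, rcont_continuous_t; [lra|exact CP]. Qed.

Let HK1 x : sderiv L (K1 x) (fun t => Pxx t x).
Proof. apply primR_sderiv, rcont_continuous_t; [lra|exact CPxx]. Qed.

Let HG x : sderiv L (G x) (G1 x).
Proof.
apply primR_sderiv, sderiv_continuous with (fun t => P t x); [lra|apply HG1].
Qed.

Let HK x : sderiv L (K x) (K1 x).
Proof.
apply primR_sderiv, sderiv_continuous with (fun t => Pxx t x);
  [lra|apply HK1].
Qed.

Lemma G_bound t x : 0 <= t <= L -> Rabs (G x t) <= S * t ^ 2.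
Proof.
intros Ht; apply (sderiv2_bound L (G x) (G1 x) (fun t => P t x)).
- apply HG.
- apply HG1.
- exact (primR_0 L (G1 x)).
- exact (primR_0 L (fun s => P s x)).
- exact Ht.
- intros u Hu; apply HS, Hu.
Qed.

(** The difference of the two sides has vanishing second time derivative, by
    the equation, and vanishing initial data, by [wxxt_initial]. *)
Lemma integrated_equation t x : 0 <= t <= L -> w t x = wxx t x + K x t.
Proof.
intros Ht.
assert (H : Rabs (1 * w t x + (-1) * (1 * wxx t x + 1 * K x t)) <= 0 * t ^ 2).
{ apply (sderiv2_bound L (fun t => 1 * w t x + (-1) * (1 * wxx t x + 1 * K x t))
    (fun t => 1 * wt t x + (-1) * (1 * wxxt t x + 1 * K1 x t))
    (fun t => 1 * wtt t x + (-1) * (1 * wxxtt t x + 1 * Pxx t x))).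
  - apply sderiv_lin; [apply Hwt|apply sderiv_lin; [apply Hwxxt|apply HK]].
  - apply sderiv_lin; [apply Hwtt|apply sderiv_lin; [apply Hwxxtt|apply HK1]].
  - rewrite Hw0 wxx_initial /K primR_0; ring.
  - rewrite Hwt0 wxxt_initial /K1 primR_0; ring.
  - exact Ht.
  - intros u Hu; pose proof (Heq u x Hu) as E.
    replace (_ + _) with (wtt u x - wxxtt u x - Pxx u x) by ring.
    rewrite E Rabs_R0; apply Rle_refl. }
rewrite Rmult_0_l in H; pose proof (Rabs_pos
  (1 * w t x + (-1) * (1 * wxx t x + 1 * K x t))).
assert (E : Rabs (1 * w t x + (-1) * (1 * wxx t x + 1 * K x t)) = 0) by lra.
apply Rabs_eq_0 in E; lra.
Qed.

(** Second differences of the double integral of P approach h^2 times the double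
    integral of [Pxx]: the former are h^2 [Pxx] at a point near x, uniformly in
    time by compactness.  No derivative is taken under the integral sign. *)
Lemma G_diff2 t x eps : 0 <= t <= L -> 0 < eps ->
  exists delta, 0 < delta /\ forall h, 0 < h < delta ->
  Rabs (diff2 (fun y => G y t) x h - h ^ 2 * K x t) <= eps * h ^ 2.
Proof.
intros Ht He.
assert (He2 : 0 < eps / L ^ 2)
  by (apply Rdiv_lt_0_compat; [exact He|apply pow_lt, HL]).
destruct (rcont_tube L Pxx x _ (Rlt_le _ _ HL) CPxx He2) as [de [Hde T]].
exists de; split; [exact Hde|]; intros h Hh.
apply Rle_trans with (h ^ 2 * (eps / L ^ 2) * t ^ 2).
- replace (_ - _) with (1 * (1 * G (x + h) t + (-2) * G x t) +
    1 * (1 * G (x - h) t + (- h ^ 2) * K x t)) by (unfold diff2; ring).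
  apply (sderiv2_bound L
    (fun t => 1 * (1 * G (x + h) t + (-2) * G x t) +
       1 * (1 * G (x - h) t + (- h ^ 2) * K x t))
    (fun t => 1 * (1 * G1 (x + h) t + (-2) * G1 x t) +
       1 * (1 * G1 (x - h) t + (- h ^ 2) * K1 x t))
    (fun t => 1 * (1 * P t (x + h) + (-2) * P t x) +
       1 * (1 * P t (x - h) + (- h ^ 2) * Pxx t x))).
  + apply sderiv_lin; apply sderiv_lin;
      [apply HG|apply HG|apply HG|apply HK].
  + apply sderiv_lin; apply sderiv_lin;
      [apply HG1|apply HG1|apply HG1|apply HK1].
  + unfold G, K; rewrite !primR_0; ring.
  + unfold G1, K1; rewrite !primR_0; ring.
  + exact Ht.
  + intros u Hu.
    destruct (diff2_mean_value (P u) (Px u) (Pxx u) x h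
      (fun y => HPx u y Hu) (fun y => HPxx u y Hu) (proj1 Hh)) as [xi [Hxi E]].
    unfold diff2 in E.
    replace (_ + _) with (h ^ 2 * (Pxx u xi - Pxx u x)) by lra.
    rewrite Rabs_mult (Rabs_pos_eq (h ^ 2)); [|apply pow2_ge_0].
    apply Rmult_le_compat_l; [apply pow2_ge_0|].
    left; apply T; [exact Hu|lra].
- replace (eps * h ^ 2) with (h ^ 2 * (eps / L ^ 2) * L ^ 2)
    by (field; apply Rgt_not_eq, HL).
  apply Rmult_le_compat_l; [|apply pow_incr; lra].
  apply Rmult_le_pos; [apply pow2_ge_0|lra].
Qed.

(** Put g = G and h = w + g.  Then h - h'' = g by [integrated_equation] and
    [G_diff2], so |h| <= sup |g| by the maximum principle, and w = h - g. *)
Lemma linear_estimate t x : 0 <= t <= L -> Rabs (w t x) <= 2 * S * t ^ 2.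
Proof.
intros Ht.
set (h := fun y => w t y + G y t).
assert (Hh : forall y, continuous h y).
{ intros y; apply (continuous_plus (V := R_NormedModule) (w t)).
  - apply (ex_derive_continuous (V := R_NormedModule)).
    exists (wx t y); apply Hwx, Ht.
  - apply (filterlim_locally_ball_norm (U := R_NormedModule)); intros [eps He].
    assert (HL2 : 0 < L ^ 2) by (apply pow_lt, HL).
    assert (He2 : 0 < eps / 2 / L ^ 2) by (apply Rdiv_lt_0_compat; lra).
    destruct (rcont_tube L P y _ (Rlt_le _ _ HL) CP He2) as [de [Hde T]].
    exists (mkposreal _ Hde); intros z Hz.
    change (Rabs (z - y) < de) in Hz; change (Rabs (G z t - G y t) < eps).
    apply Rle_lt_trans with (eps / 2 / L ^ 2 * t ^ 2).
    + replace (G z t - G y t) with (1 * G z t + (-1) * G y t) by ring.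
      apply (sderiv2_bound L (fun t => 1 * G z t + (-1) * G y t)
        (fun t => 1 * G1 z t + (-1) * G1 y t)
        (fun t => 1 * P t z + (-1) * P t y)).
      * apply sderiv_lin; apply HG.
      * apply sderiv_lin; apply HG1.
      * unfold G; rewrite !primR_0; ring.
      * unfold G1; rewrite !primR_0; ring.
      * exact Ht.
      * intros u Hu; replace (_ + _) with (P u z - P u y) by ring.
        left; apply T; assumption.
    + apply Rle_lt_trans with (eps / 2 / L ^ 2 * L ^ 2).
      * apply Rmult_le_compat_l; [lra|apply pow_incr; lra].
      * replace (eps / 2 / L ^ 2 * L ^ 2) with (eps / 2)
          by (field; apply Rgt_not_eq, HL); lra. }
assert (Hb : forall y, Rabs (h y) <= C + S * t ^ 2).
{ intros y; eapply Rle_trans; [apply Rabs_triang|].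
  apply Rplus_le_compat; [apply HC, Ht|apply G_bound, Ht]. }
assert (Hd : forall y eps, 0 < eps -> exists s, 0 < s /\
  Rabs (diff2 h y s - s ^ 2 * (h y - G y t)) <= eps * s ^ 2).
{ intros y eps He.
  assert (He2 : 0 < eps / 2) by lra.
  destruct (G_diff2 t y _ Ht He2) as [d1 [Hd1 A1]].
  destruct (rcont_x L wxx t y Cwxx Ht _ He2) as [d2 [Hd2 A2]].
  set (s := Rmin d1 d2 / 2).
  assert (0 < Rmin d1 d2) by (apply Rmin_pos; assumption).
  pose proof (Rmin_l d1 d2); pose proof (Rmin_r d1 d2).
  assert (Hs : 0 < s < d1 /\ s < d2) by (unfold s; lra).
  exists s; split; [lra|].
  destruct (diff2_mean_value (w t) (wx t) (wxx t) y s
    (fun y => Hwx t y Ht) (fun y => Hwxx t y Ht) ltac:(lra)) as [xi [Hxi E]].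
  specialize (A1 s (proj1 Hs)); specialize (A2 xi ltac:(lra)).
  pose proof (pow2_ge_0 s) as Hs2.
  replace (_ - _) with (s ^ 2 * (wxx t xi - wxx t y) +
    (diff2 (fun y => G y t) y s - s ^ 2 * K y t)).
  2: { pose proof (integrated_equation t y Ht) as Hi.
       unfold h; replace (w t y + G y t - G y t) with (w t y) by ring.
       rewrite Hi; unfold diff2 in *; lra. }
  eapply Rle_trans; [apply Rabs_triang|].
  rewrite Rabs_mult (Rabs_pos_eq (s ^ 2)); [|exact Hs2].
  assert (s ^ 2 * Rabs (wxx t xi - wxx t y) <= s ^ 2 * (eps / 2))
    by (apply Rmult_le_compat_l; lra).
  lra. }
assert (Hup : forall y, h y <= S * t ^ 2).
{ apply (maximum_principle h (fun y => G y t) (C + S * t ^ 2));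
    [exact Hh|exact Hb| |exact Hd].
  intros y; pose proof (G_bound t y Ht) as HGb.
  apply Rabs_le_between in HGb; lra. }
assert (Hdown : forall y, - h y <= S * t ^ 2).
{ apply (maximum_principle (fun y => - h y) (fun y => - G y t) (C + S * t ^ 2)).
  - intros y; exact (continuous_opp (V := R_NormedModule) h y (Hh y)).
  - intros y; rewrite Rabs_Ropp; apply Hb.
  - intros y; pose proof (G_bound t y Ht) as HGb.
    apply Rabs_le_between in HGb; lra.
  - intros y eps He; destruct (Hd y eps He) as [s [Hs H]].
    exists s; split; [exact Hs|].
    rewrite -Rabs_Ropp; replace (- _) with
      (diff2 h y s - s ^ 2 * (h y - G y t)) by (unfold diff2; ring).
    exact H. }
pose proof (Hup x) as H1; pose proof (Hdown x) as H2; unfold h in H1, H2.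
pose proof (G_bound t x Ht) as H3; apply Rabs_le_between in H3.
apply Rabs_le; lra.
Qed.

End LinearEstimate.

(** * Uniqueness *)

Lemma rcont_lin L (a b : R) F G : rcont L F -> rcont L G ->
  rcont L (fun t x => a * F t x + b * G t x).
Proof.
intros HF HG t x Ht eps He.
assert (Hp : 0 < Rabs a + Rabs b + 1)
  by (pose proof (Rabs_pos a); pose proof (Rabs_pos b); lra).
set (e := eps / (Rabs a + Rabs b + 1)).
assert (He' : 0 < e) by (apply Rdiv_lt_0_compat; lra).
destruct (HF t x Ht _ He') as [d1 [Hd1 H1]].
destruct (HG t x Ht _ He') as [d2 [Hd2 H2]].
exists (Rmin d1 d2); split; [apply Rmin_pos; assumption|]; intros s y Hs Hst Hy.
pose proof (Rmin_l d1 d2); pose proof (Rmin_r d1 d2).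
specialize (H1 s y Hs ltac:(lra) ltac:(lra)).
specialize (H2 s y Hs ltac:(lra) ltac:(lra)).
replace (_ - _) with (a * (F s y - F t x) + b * (G s y - G t x)) by ring.
eapply Rle_lt_trans; [apply Rabs_triang|]; rewrite !Rabs_mult.
assert (E : eps = (Rabs a + Rabs b + 1) * e) by (unfold e; field; lra).
pose proof (Rabs_pos a); pose proof (Rabs_pos b).
apply Rle_lt_trans with (Rabs a * e + Rabs b * e); [|lra].
apply Rplus_le_compat; apply Rmult_le_compat_l; lra.
Qed.

(** Local boundedness of the time derivative makes w equicontinuous in time near
    x, so that separate continuity is joint. *)
Lemma rcont_of_sderiv L w wt : 0 <= L ->
  (forall x, sderiv L (fun t => w t x) (fun t => wt t x)) -> rcont L wt ->
  (forall t x, 0 <= t <= L -> continuous (w t) x) -> rcont L w.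
Proof.
intros HL Hd Hc Hx t x Ht eps He.
destruct (rcont_bounded L wt x HL Hc) as [M HM].
destruct (rcont_tube L wt x 1 HL Hc Rlt_0_1) as [d1 [Hd1 T]].
assert (HM0 : 0 <= M) by (eapply Rle_trans; [apply Rabs_pos|apply (HM t Ht)]).
assert (He2 : 0 < eps / 2) by lra.
pose proof (proj1 (filterlim_locally_ball_norm (U := R_NormedModule) (w t) (w t x))
  (Hx t x Ht) (mkposreal _ He2)) as [d2 H2].
assert (He3 : 0 < eps / 2 / (M + 1)) by (apply Rdiv_lt_0_compat; lra).
assert (Hm : 0 < Rmin d1 (Rmin d2 (eps / 2 / (M + 1))))
  by (repeat apply Rmin_pos; try assumption; apply cond_pos).
exists (Rmin d1 (Rmin d2 (eps / 2 / (M + 1)))); split; [exact Hm|].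
intros s y Hs Hst Hy.
pose proof (Rmin_l d1 (Rmin d2 (eps / 2 / (M + 1)))).
pose proof (Rmin_r d1 (Rmin d2 (eps / 2 / (M + 1)))).
pose proof (Rmin_l d2 (eps / 2 / (M + 1))).
pose proof (Rmin_r d2 (eps / 2 / (M + 1))).
assert (Hyd : Rabs (y - x) < d2) by lra.
assert (A : Rabs (w t y - w t x) < eps / 2) by exact (H2 y Hyd).
assert (HB : forall u, 0 <= u <= L -> Rabs (wt u y) <= M + 1).
{ intros u Hu; replace (wt u y) with ((wt u y - wt u x) + wt u x) by ring.
  eapply Rle_trans; [apply Rabs_triang|].
  pose proof (T u y Hu ltac:(lra)); pose proof (HM u Hu); lra. }
assert (B : Rabs (w s y - w t y) <= (M + 1) * Rabs (s - t)).
{ destruct (Rle_dec s t) as [Hle|Hle].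
  - rewrite Rabs_minus_sym (Rabs_minus_sym s) (Rabs_pos_eq (t - s)); [|lra].
    apply (sderiv_bound L (fun t => w t y) (fun t => wt t y)); auto; try lra.
    intros u Hu; apply HB; lra.
  - rewrite (Rabs_pos_eq (s - t)); [|lra].
    apply (sderiv_bound L (fun t => w t y) (fun t => wt t y)); auto; try lra.
    intros u Hu; apply HB; lra. }
assert (B2 : (M + 1) * Rabs (s - t) < eps / 2).
{ assert (Hq : Rabs (s - t) < eps / 2 / (M + 1)) by lra.
  apply Rlt_div_r in Hq; [|lra]; lra. }
replace (w s y - w t x) with ((w s y - w t y) + (w t y - w t x)) by ring.
eapply Rle_lt_trans; [apply Rabs_triang|lra].
Qed.

Lemma continuous_stripP L (f : R -> R -> C) :
  continuous_strip L f <->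
  (forall t x, 0 <= t <= L -> forall eps, 0 < eps ->
   exists delta, 0 < delta /\ forall s y, 0 <= s <= L ->
     Rabs (s - t) < delta -> Rabs (y - x) < delta ->
     Cmod (Cminus (f s y) (f t x)) < eps).
Proof.
split.
- intros H t x Ht eps He.
  pose proof (within_proper (U := prod_UniformSpace R_UniformSpace R_UniformSpace)
    (fun z : R * R => 0 <= fst z <= L) (t, x) Ht) as FF.
  destruct (proj1 (filterlim_CVP (fun z : R * R => f (fst z) (snd z)) (f t x))
    (H (t, x) Ht) (mkposreal _ He)) as [de Hde].
  exists de; split; [apply cond_pos|]; intros s y Hs Hst Hy.
  exact (Hde (s, y) (conj Hst Hy) Hs).
- intros H [t x] Ht.
  pose proof (within_proper (U := prod_UniformSpace R_UniformSpace R_UniformSpace)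
    (fun z : R * R => 0 <= fst z <= L) (t, x) Ht) as FF.
  apply (proj2 (filterlim_CVP (fun z : R * R => f (fst z) (snd z)) (f t x))).
  intros [eps He]; destruct (H t x Ht eps He) as [de [Hde H1]].
  exists (mkposreal _ Hde); intros [s y] [Hs Hy] Hsy.
  exact (H1 s y Hsy Hs Hy).
Qed.

Lemma continuous_strip_pow L (f : R -> R -> C) k :
  continuous_strip L f -> continuous_strip L (fun t x => Cpow (f t x) k).
Proof.
intros H; induction k as [|k IH]; intros z Hz; simpl.
- apply filterlim_const.
- pose proof (within_proper (U := prod_UniformSpace R_UniformSpace R_UniformSpace)
    (fun z : R * R => 0 <= fst z <= L) z Hz) as FF.
  exact (filterlim_Cmult (fun z : R * R => f (fst z) (snd z))
    (fun z : R * R => Cpow (f (fst z) (snd z)) k) _ _ (H z Hz) (IH z Hz)).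
Qed.

(** The real and the imaginary part are treated alike, as real functionals. *)
Section RealFunctional.
Context (rho : C -> R).
Hypothesis rho_minus : forall a b, rho (Cminus a b) = rho a - rho b.
Hypothesis rho_scal : forall s a, rho (Cmult (RtoC s) a) = s * rho a.
Hypothesis rho_le : forall a, Rabs (rho a) <= Cmod a.

Lemma rho_sderiv L f g x : is_partial_t L f g ->
  sderiv L (fun t => rho (f t x)) (fun t => rho (g t x)).
Proof.
intros H t Ht eps He.
pose proof (within_proper (U := R_UniformSpace)
  (fun s : R => 0 <= s <= L) t Ht) as FF.
assert (HF : forall P, locally t P ->
  within (fun s : R => 0 <= s <= L) (locally t) P)
  by (intros P; apply locally_within).
destruct (proj1 (filterdiff_CP _ _ _ HF) (H t x Ht) (mkposreal _ He)) as [de Hde].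
exists de; split; [apply cond_pos|]; intros s Hs Hst.
rewrite -rho_scal -!rho_minus.
eapply Rle_trans; [apply rho_le|exact (Hde s Hst Hs)].
Qed.

Lemma rho_is_derive L f g t x : is_partial_x L f g -> 0 <= t <= L ->
  is_derive (fun y => rho (f t y)) x (rho (g t x)).
Proof.
intros H Ht.
split; [exact (is_linear_scal_l (V := R_NormedModule) (rho (g t x)))|].
intros z Hz eps.
assert (E : x = z) by exact (is_filter_lim_locally_unique _ _ Hz).
subst z.
pose proof (proj1 (filterdiff_CP (F := locally x) _ _ _ (fun P HP => HP))
  (H t x Ht) eps) as H1.
apply: filter_imp H1 => y Hy.
change (Rabs (rho (f t y) - rho (f t x) - (y - x) * rho (g t x)) <=
  eps * Rabs (y - x)).
rewrite -rho_scal -!rho_minus.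
eapply Rle_trans; [apply rho_le|exact Hy].
Qed.

Lemma rho_rcont L f : continuous_strip L f -> rcont L (fun t x => rho (f t x)).
Proof.
intros H t x Ht eps He.
destruct (proj1 (continuous_stripP L f) H t x Ht eps He) as [de [Hde H1]].
exists de; split; [exact Hde|]; intros s y Hs Hst Hy.
rewrite -rho_minus; eapply Rle_lt_trans; [apply rho_le|apply H1; assumption].
Qed.

Lemma rho_rcont_solution L u ut ux : 0 <= L -> is_partial_t L u ut ->
  continuous_strip L ut -> is_partial_x L u ux ->
  rcont L (fun t x => rho (u t x)).
Proof.
intros HL Ht Hc Hx.
apply (rcont_of_sderiv L _ (fun t x => rho (ut t x)) HL).
- intros x; apply rho_sderiv, Ht.
- apply rho_rcont, Hc.
- intros t x Htt; apply (ex_derive_continuous (V := R_NormedModule)).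
  eexists; exact (rho_is_derive L u ux t x Hx Htt).
Qed.

End RealFunctional.

Lemma fst_Cminus a b : fst (Cminus a b) = fst a - fst b.
Proof. reflexivity. Qed.
Lemma snd_Cminus a b : snd (Cminus a b) = snd a - snd b.
Proof. reflexivity. Qed.
Lemma fst_Cscal s a : fst (Cmult (RtoC s) a) = s * fst a.
Proof. simpl; ring. Qed.
Lemma snd_Cscal s a : snd (Cmult (RtoC s) a) = s * snd a.
Proof. simpl; ring. Qed.
Lemma fst_le a : Rabs (fst a) <= Cmod a.
Proof. eapply Rle_trans; [apply Rmax_l|apply Rmax_Cmod]. Qed.
Lemma snd_le a : Rabs (snd a) <= Cmod a.
Proof. eapply Rle_trans; [apply Rmax_r|apply Rmax_Cmod]. Qed.

Lemma solution_continuous L u ut ux : 0 <= L -> is_partial_t L u ut ->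
  continuous_strip L ut -> is_partial_x L u ux -> continuous_strip L u.
Proof.
intros HL Ht Hc Hx.
pose proof (rho_rcont_solution fst fst_Cminus fst_Cscal fst_le
  L u ut ux HL Ht Hc Hx) as H1.
pose proof (rho_rcont_solution snd snd_Cminus snd_Cscal snd_le
  L u ut ux HL Ht Hc Hx) as H2.
apply continuous_stripP; intros t x Htt eps He.
assert (He2 : 0 < eps / 2) by lra.
destruct (H1 t x Htt _ He2) as [d1 [Hd1 A1]].
destruct (H2 t x Htt _ He2) as [d2 [Hd2 A2]].
exists (Rmin d1 d2); split; [apply Rmin_pos; assumption|]; intros s y Hs Hst Hy.
pose proof (Rmin_l d1 d2); pose proof (Rmin_r d1 d2).
specialize (A1 s y Hs ltac:(lra) ltac:(lra)).
specialize (A2 s y Hs ltac:(lra) ltac:(lra)).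
eapply Rle_lt_trans; [apply Cmod_le_add|].
rewrite fst_Cminus snd_Cminus; lra.
Qed.

Lemma Cmod_pow_le u B k : Cmod u <= B -> Cmod (Cpow u k) <= B ^ k.
Proof.
intros H; induction k as [|k IH]; simpl; [rewrite Cmod_1; lra|].
rewrite Cmod_mult; apply Rmult_le_compat; auto using Cmod_ge_0.
Qed.

Lemma Cpow_lipschitz u v B k : Cmod u <= B -> Cmod v <= B ->
  Cmod (Cminus (Cpow v k.+1) (Cpow u k.+1)) <=
  INR k.+1 * B ^ k * Cmod (Cminus v u).
Proof.
intros Hu Hv; induction k as [|k IH].
- replace (Cminus (Cpow v 1) (Cpow u 1)) with (Cminus v u) by (simpl; ring).
  simpl; lra.
- replace (Cminus (Cpow v k.+2) (Cpow u k.+2)) with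
    (Cplus (Cmult v (Cminus (Cpow v k.+1) (Cpow u k.+1)))
      (Cmult (Cpow u k.+1) (Cminus v u))) by (simpl; ring).
  eapply Rle_trans; [apply Cmod_triangle|].
  rewrite (Cmod_mult v) (Cmod_mult (Cpow u k.+1)).
  pose proof (Cmod_pow_le u B k.+1 Hu) as Hp.
  pose proof (Cmod_ge_0 (Cminus v u)).
  apply Rle_trans with (B * (INR k.+1 * B ^ k * Cmod (Cminus v u)) +
    B ^ k.+1 * Cmod (Cminus v u)).
  + apply Rplus_le_compat.
    * apply Rmult_le_compat; auto using Cmod_ge_0.
    * apply Rmult_le_compat_r; assumption.
  + right; rewrite (S_INR k.+1); simpl pow; ring.
Qed.

Section Uniqueness.
Context {nu : nat} (omega : 'I_nu -> R) (c d : lattice nu -> C) (k : nat).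
Context (L B : R) (u v : R -> R -> C).
Hypothesis (HL : 0 < L).
Hypothesis (Hu : classical_solution k.+1 omega c d L u).
Hypothesis (Hv : classical_solution k.+1 omega c d L v).
Hypothesis (Bu : forall t x, 0 <= t <= L -> Cmod (u t x) <= B).
Hypothesis (Bv : forall t x, 0 <= t <= L -> Cmod (v t x) <= B).

(** The linear estimate for w = rho(v - u) and P = w + rho(v^p - u^p), where
    P is controlled by N through the Lipschitz bound of the power. *)
Lemma rho_difference (rho : C -> R) (N : R)
  (rho_minus : forall a b, rho (Cminus a b) = rho a - rho b)
  (rho_scal : forall s a, rho (Cmult (RtoC s) a) = s * rho a)
  (rho_le : forall a, Rabs (rho a) <= Cmod a) :
  (forall t x, 0 <= t <= L -> Cmod (Cminus (v t x) (u t x)) <= N) ->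
  forall t x, 0 <= t <= L ->
  Rabs (rho (Cminus (v t x) (u t x))) <=
  2 * (N * (1 + INR k.+1 * B ^ k)) * L ^ 2.
Proof.
intros HN t x Ht.
destruct Hu as (ut & utt & ux & uxx & uxxt & uxxtt & wx & wxx &
  [U1 U2] & [U3 U4] & [U5 U6] & [U7 U8] & (K1 & K2 & K3 & K4 & K5) &
  UE & UI1 & UI2).
destruct Hv as (vt & vtt & vx & vxx & vxxt & vxxtt & zx & zxx &
  [V1 V2] & [V3 V4] & [V5 V6] & [V7 V8] & (J1 & J2 & J3 & J4 & J5) &
  VE & VI1 & VI2).
assert (HL0 : 0 <= L) by lra.
pose proof (solution_continuous L u ut ux HL0 U1 K1 U3) as Cu.
pose proof (solution_continuous L v vt vx HL0 V1 J1 V3) as Cv.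
pose proof (continuous_strip_pow L u k.+1 Cu) as Cup.
pose proof (continuous_strip_pow L v k.+1 Cv) as Cvp.
set (D := fun (f g : R -> R -> C) (t x : R) =>
  1 * rho (f t x) + (-1) * rho (g t x)).
set (up := fun t x => Cpow (u t x) k.+1) in *.
set (vp := fun t x => Cpow (v t x) k.+1) in *.
assert (HDt : forall f f' g g', is_partial_t L f f' -> is_partial_t L g g' ->
  forall x, sderiv L (fun t => D f g t x) (fun t => D f' g' t x)).
{ intros f f' g g' Hf Hg y.
  apply (sderiv_lin L 1 (-1)); apply rho_sderiv; assumption. }
assert (HDx : forall f f' g g', is_partial_x L f f' -> is_partial_x L g g' ->
  forall t x, 0 <= t <= L -> is_derive (D f g t) x (D f' g' t x)).
{ intros f f' g g' Hf Hg s y Hs.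
  apply (is_derive_plus (V := R_NormedModule) (fun y => 1 * rho (f s y))
    (fun y => -1 * rho (g s y))).
  - apply (is_derive_scal (fun y => rho (f s y)) y 1).
    exact (rho_is_derive rho rho_minus rho_scal rho_le L f f' s y Hf Hs).
  - apply (is_derive_scal (fun y => rho (g s y)) y (-1)).
    exact (rho_is_derive rho rho_minus rho_scal rho_le L g g' s y Hg Hs). }
assert (HDc : forall f g, continuous_strip L f -> continuous_strip L g ->
  rcont L (D f g)).
{ intros f g Hf Hg; apply rcont_lin; apply rho_rcont; assumption. }
assert (HD : forall f g t x, D f g t x = rho (Cminus (f t x) (g t x))).
{ intros; unfold D; rewrite rho_minus; ring. }
assert (HBk : 0 <= INR k.+1 * B ^ k).
{ apply Rmult_le_pos; [apply pos_INR|apply pow_le].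
  eapply Rle_trans; [apply Cmod_ge_0|apply (Bu t x Ht)]. }
assert (HN0 : 0 <= N).
{ eapply Rle_trans; [apply Cmod_ge_0|apply (HN t x Ht)]. }
rewrite -HD.
eapply Rle_trans; [apply (linear_estimate L N (N * (1 + INR k.+1 * B ^ k))
  (D v u) (D vt ut) (D vtt utt) (D vx ux) (D vxx uxx) (D vxxt uxxt)
  (D vxxtt uxxtt)
  (fun t x => 1 * D v u t x + 1 * D vp up t x)
  (fun t x => 1 * D vx ux t x + 1 * D zx wx t x)
  (fun t x => 1 * D vxx uxx t x + 1 * D zxx wxx t x)); auto|].
- intros s y Hs.
  apply (is_derive_plus (V := R_NormedModule) (fun y => 1 * D v u s y)
    (fun y => 1 * D vp up s y)).
  + apply (is_derive_scal (D v u s) y 1); auto.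
  + apply (is_derive_scal (D vp up s) y 1); auto.
- intros s y Hs.
  apply (is_derive_plus (V := R_NormedModule) (fun y => 1 * D vx ux s y)
    (fun y => 1 * D zx wx s y)).
  + apply (is_derive_scal (D vx ux s) y 1); auto.
  + apply (is_derive_scal (D zx wx s) y 1); auto.
- apply rcont_lin; auto.
- apply rcont_lin; auto.
- intros s y Hs.
  pose proof (UE s y Hs) as E1; pose proof (VE s y Hs) as E2.
  replace (_ - _ - _) with (rho (Cminus
    (Cminus (Cminus (Cminus (vtt s y) (vxx s y)) (vxxtt s y)) (zxx s y))
    (Cminus (Cminus (Cminus (utt s y) (uxx s y)) (uxxtt s y)) (wxx s y))))
    by (rewrite !rho_minus; unfold D; ring).
  rewrite E1 E2 rho_minus; ring.
- intros y; rewrite HD.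
  replace (v 0 y) with (u 0 y)
    by exact (is_sum_unique (V := CV) _ _ _ (UI1 y) (VI1 y)).
  rewrite rho_minus; ring.
- intros y; rewrite HD.
  replace (vt 0 y) with (ut 0 y)
    by exact (is_sum_unique (V := CV) _ _ _ (UI2 y) (VI2 y)).
  rewrite rho_minus; ring.
- intros s y Hs; rewrite HD; eapply Rle_trans; [apply rho_le|apply HN, Hs].
- intros s y Hs; rewrite !HD.
  eapply Rle_trans; [apply Rabs_triang|]; rewrite !Rmult_1_l.
  pose proof (HN s y Hs) as H1.
  pose proof (Cpow_lipschitz (u s y) (v s y) B k (Bu s y Hs) (Bv s y Hs)) as H2.
  pose proof (rho_le (Cminus (v s y) (u s y))).
  pose proof (rho_le (Cminus (vp s y) (up s y))) as H4; unfold vp, up in H4.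
  assert (INR k.+1 * B ^ k * Cmod (Cminus (v s y) (u s y)) <=
    INR k.+1 * B ^ k * N) by (apply Rmult_le_compat_l; assumption).
  unfold vp, up; lra.
- apply Rmult_le_compat_l; [|apply pow_incr; lra].
  apply Rmult_le_pos; [lra|apply Rmult_le_pos; lra].
Qed.

(** Each application of [rho_difference] to the real and the imaginary part
    halves the bound on |v - u|. *)
Lemma classical_solution_unique : 8 * L ^ 2 * (1 + INR k.+1 * B ^ k) <= 1 ->
  forall t x, 0 <= t <= L -> v t x = u t x.
Proof.
intros Hsmall.
assert (Hhalf : forall j t x, 0 <= t <= L ->
  Cmod (Cminus (v t x) (u t x)) <= 2 * B / 2 ^ j).
{ induction j as [|j IH]; intros t x Ht.
  - unfold Cminus; eapply Rle_trans; [apply Cmod_triangle|]; rewrite Cmod_opp.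
    pose proof (Bu t x Ht); pose proof (Bv t x Ht); simpl; lra.
  - eapply Rle_trans; [apply Cmod_le_add|].
    pose proof (rho_difference fst _ fst_Cminus fst_Cscal fst_le IH t x Ht) as H1.
    pose proof (rho_difference snd _ snd_Cminus snd_Cscal snd_le IH t x Ht) as H2.
    set (N := 2 * B / 2 ^ j) in *.
    assert (HN0 : 0 <= N).
    { eapply Rle_trans; [apply Cmod_ge_0|apply (IH t x Ht)]. }
    replace (2 * B / 2 ^ j.+1) with (N * (1 / 2))
      by (unfold N; simpl; field; apply pow_nonzero; lra).
    assert (N * (8 * L ^ 2 * (1 + INR k.+1 * B ^ k)) <= N * 1)
      by (apply Rmult_le_compat_l; assumption).
    lra. }
intros t x Ht.
assert (E : Cmod (Cminus (v t x) (u t x)) = 0).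
{ apply Rle_antisym; [|apply Cmod_ge_0].
  apply Rnot_lt_le; intros Hlt.
  destruct (geometric_small (2 * B) _ Hlt) as [j Hj].
  - pose proof (Cmod_ge_0 (u t x)); pose proof (Bu t x Ht); lra.
  - pose proof (Hhalf j t x Ht); lra. }
apply Cmod_eq_0 in E.
replace (v t x) with (Cplus (Cminus (v t x) (u t x)) (u t x)) by ring.
rewrite E; ring.
Qed.

End Uniqueness.

Lemma is_qp_series_bound {nu : nat} (omega : 'I_nu -> R) (r al : R)
    (a : lattice nu -> C) x s : INR nu < r -> decays r al a ->
  is_qp_series omega a x s ->
  Cmod s <= al * Sum (V := R_CompleteNormedModule) (weight (nu := nu) r).
Proof.
intros Hr Ha Hs; rewrite -norm_CV.
apply (norm_is_sum_le (V := CV)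
  (fun n => Cmult (a n) (expi (pairing n omega * x)))
  (fun n => al * weight r n) s).
- intros n; rewrite norm_CV Cmod_mult Cmod_expi Rmult_1_r; apply Ha.
- intros l Hl; rewrite (lsum_scal (V := R_NormedModule) al).
  apply Rmult_le_compat_l; [exact (decays_ge0 _ _ _ Ha)|].
  apply lsum_le_Sum; [apply weight_summable, Hr|exact Hl].
- exact Hs.
Qed.

Theorem theorem4p2 (nu p : nat) (omega : 'I_nu -> R) (c d : lattice nu -> C)
    (A r : R)
    (hnu : (2 <= nu)%N) (hp : (3 <= p)%N)
    (homega : nonresonant omega)
    (hA : 0 < A) (hr : INR nu + 2 < r)
    (hc : forall n : lattice nu, Cmod (c n) <= A * weight r n)
    (hd : forall n : lattice nu, Cmod (d n) <= A * weight r n) :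
  exists (u : R -> R -> C) (uhat : R -> lattice nu -> C),
    qp_classical_solution p omega c d (Lconst nu p A r) u uhat /\
    poly_decay A r (Lconst nu p A r) uhat /\
    (forall (v : R -> R -> C) (vhat : R -> lattice nu -> C),
       qp_classical_solution p omega c d (Lconst nu p A r) v vhat ->
       poly_decay A r (Lconst nu p A r) vhat ->
       forall t x : R, 0 <= t <= Lconst nu p A r -> v t x = u t x).
Proof.
destruct p as [|k]; [discriminate hp|].
assert (hr0 : INR nu < r) by lra.
set (K := Kconst r nu); set (M := Mconst nu A r).
set (S := Sum (V := R_CompleteNormedModule) (weight (nu := nu) r)).
set (Z := 2 ^ k * M ^ k).
set (L := Lconst nu k.+1 A r).
assert (HK : 0 <= K) by (apply Kconst_ge0, hr0).
assert (HAK : 0 <= A * K) by (apply Rmult_le_pos; lra).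
assert (HM1 : 1 <= M) by apply Rmax_l.
assert (HMK : A * K <= M) by apply Rmax_r.
assert (HZ : 1 <= Z).
{ unfold Z; rewrite -Rpow_mult_distr; apply pow_R1_Rle; lra. }
assert (Hp3 : 3 <= INR k.+1).
{ replace 3 with (INR 3) by (simpl; ring); apply le_INR; move/leP: hp; auto. }
assert (HpZ : 3 <= INR k.+1 * Z) by nra.
assert (HL : L = 1 / (16 * (INR k.+1 * Z))).
{ unfold L, Lconst; rewrite subn1 -pred_Sn -/M.
  replace (k.+1 + 3)%N with (k + 4)%coq_nat by (rewrite plusE addn3 addn4 //).
  rewrite pow_add; unfold Z; f_equal; simpl (2 ^ 4); ring. }
assert (HLpos : 0 < L) by (rewrite HL; apply Rdiv_lt_0_compat; lra).
assert (HLZ : L * (INR k.+1 * Z) = 1 / 16) by (rewrite HL; field; lra).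
assert (HL48 : L <= 1 / 48) by nra.
assert (Hkap : forall X, 0 <= X <= 2 * M -> X ^ k <= Z).
{ intros X HX; unfold Z; rewrite -Rpow_mult_distr; apply pow_incr, HX. }
assert (Hk1 : (2 * A * K) ^ k <= Z) by (apply Hkap; nra).
assert (HZp : L * Z <= 1 / 48) by nra.
(* Z bounds the k-th power of every quantity of size at most 2M, and L was
   chosen so that L p Z = 1/16: this is the smallness used in both parts. *)
assert (Hsmall : forall X, X <= Z -> 8 * L ^ 2 * (1 + INR k.+1 * X) <= 1).
{ intros X HX.
  assert (L * (INR k.+1 * X) <= 1 / 16).
  { rewrite -HLZ; apply Rmult_le_compat_l; [lra|].
    apply Rmult_le_compat_l; lra. }
  replace (8 * L ^ 2 * (1 + INR k.+1 * X)) with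
    (8 * L * (L + L * (INR k.+1 * X))) by ring.
  nra. }
destruct (solution_exists omega c d k A r L hr ltac:(lra) hA hc hd) as [u [uhat [Hu Hd]]].
{ fold K; pose proof (Hsmall _ Hk1); lra. }
{ fold K.
  assert (L * (2 * A * K) ^ k <= 1 / 48).
  { eapply Rle_trans; [|exact HZp]; apply Rmult_le_compat_l; lra. }
  nra. }
exists u, uhat; split; [exact Hu|split; [exact Hd|]].
intros v vhat Hv Hdv.
assert (HS0 : 0 <= S).
{ apply (lsum_le_Sum (weight (nu := nu) r) nil); [|constructor].
  apply weight_summable, hr0. }
assert (HSK : S <= K).
{ change K with (Rpower 2 (r + 1) * S).
  assert (1 <= Rpower 2 (r + 1));
    [|rewrite -{1}(Rmult_1_l S); apply Rmult_le_compat_r; assumption].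
  apply Rle_trans with (Rpower 2 0); [rewrite Rpower_O; lra|].
  apply Rle_Rpower; [lra|].
  pose proof (pos_INR nu); lra. }
assert (Hbound : forall y yhat, qp_classical_solution k.+1 omega c d L y yhat ->
  poly_decay A r L yhat -> forall t x, 0 <= t <= L -> Cmod (y t x) <= 2 * A * S).
{ intros y yhat [Hy _] Hdy t x Ht.
  apply (is_qp_series_bound omega r _ (yhat t) x _ hr0); [|apply Hy, Ht].
  intros n; apply Hdy, Ht. }
apply (classical_solution_unique omega c d k L (2 * A * S) u v HLpos
  (proj2 Hu) (proj2 Hv) (Hbound u uhat Hu Hd) (Hbound v vhat Hv Hdv)).
apply Hsmall, Hkap; nra.
Qed.
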